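(* Let $\Lambda\subset\mathbb{R}$ be a set such that the measure $\mu=\sum_{\lambda\in\Lambda}\delta_\lambda$ is a Fourier quasicrystal. Then there is an exponential polynomial $$p(x)=\sum_{k=1}^{n} b_k e^{i\gamma_k x},\qquad n\in\mathbb{N},\ b_k\in\mathbb{C},\ \gamma_k\in\mathbb{R},\ k=1,\dots,n,$$ all of whose zeros (as an entire function on $\mathbb{C}$) are real and simple, such that $\Lambda$ is the zero set of $p$.
   Context: Here $\delta_x$ is the Dirac measure (unit mass) at the point $x$. The Fourier transform is normalized by $\hat h(t)=\int_{\mathbb{R}}e^{-2\pi i t x}h(x)\,dx$ for $h\in L^1(\mathbb{R})$ and extended to tempered distributions in the usual way. A set in $\mathbb{R}$ is locally finite if it has finitely many points in every bounded interval. A crystalline measure is an atomic measure $\mu$ on $\mathbb{R}$ which is a tempered distribution and whose distributional Fourier transform $\hat\mu$ is also an atomic measure, $$\mu=\sum_{\lambda\in\Lambda}c_\lambda\delta_\lambda,\qquad \hat\mu=\sum_{s\in S}a_s\delta_s,\qquad c_\lambda,a_s\in\mathbb{C},$$ where the support $\Lambda$ and the spectrum $S$ of $\mu$ are locally finite subsets of $\mathbb{R}$. If in addition the total variation measures $|\mu|$ and $|\hat\mu|$ are tempered (i.e. define tempered distributions), then $\mu$ is called a Fourier quasicrystal. *)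

(* Defs.v *)
From HB Require Import structures.
From mathcomp Require Import all_boot all_order all_algebra.
From mathcomp Require Import complex.
From mathcomp Require Import all_classical all_reals all_analysis.

Set Implicit Arguments.
Unset Strict Implicit.
Unset Printing Implicit Defensive.

Import Order.TTheory GRing.Theory Num.Theory.
Import numFieldNormedType.Exports.
Import ComplexField.Normc.

Local Open Scope classical_set_scope.
Local Open Scope complex_scope.
Local Open Scope ring_scope.

(* For z : R[i], `|z| is R[i]-valued, while normc z is the modulus in R. *)

Section complex_functions.
Variable R : realType.
Implicit Types (f g h : R -> R[i]) (z : R[i]) (m n : nat).

Definition cexp z : R[i] :=
  (expR (complex.Re z))%:C * (cos (complex.Im z) +i* sin (complex.Im z)).

(* R[i] carries no topology as a vector space over R, so derivatives and
   integrals of functions R -> R[i] are taken on real and imaginary parts. *)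
Definition cderiven n f (x : R) : R[i] :=
  derive1n n (@complex.Re R \o f) x +i* derive1n n (@complex.Im R \o f) x.

Definition smooth f : Prop :=
  forall n x, derivable (derive1n n (@complex.Re R \o f)) x 1 /\
              derivable (derive1n n (@complex.Im R \o f)) x 1.

Definition cintegral f : R[i] :=
  Rintegral lebesgue_measure setT (@complex.Re R \o f) +i*
  Rintegral lebesgue_measure setT (@complex.Im R \o f).

Definition fourier h (t : R) : R[i] :=
  cintegral (fun x => cexp (0 -i* (2 * pi * t * x)) * h x).

End complex_functions.

Section tempered_distributions.
Variable R : realType.
Implicit Types (f g : R -> R[i]) (m n : nat).

Definition schwartz_seminorm m n f : \bar R :=
  ereal_sup (range (fun x : R => (normc (x%:C ^+ m * cderiven n f x))%:E)).

Definition schwartz f : Prop :=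
  smooth f /\ forall m n, (schwartz_seminorm m n f < +oo)%E.

Definition test_function f : Prop :=
  smooth f /\ compact (closure [set x | f x != 0]).

(* A functional is a total map on R -> R[i]; only its values at Schwartz
   functions matter.  Continuity refers to the topology defined by the
   seminorms above. *)
Definition tempered_distribution (T : (R -> R[i]) -> R[i]) : Prop :=
  (forall (a : R[i]) f g, schwartz f -> schwartz g ->
     T (fun x => a * f x + g x) = a * T f + T g) /\
  (forall f, schwartz f -> forall e : R, 0 < e ->
     exists N : nat, exists2 d : R, 0 < d &
       forall g, schwartz g ->
         (forall m n, (m <= N)%N -> (n <= N)%N ->
            (schwartz_seminorm m n (fun x => (g x - f x)%R) < d%:E)%E) ->
         normc (T g - T f) < e).

Definition fourier_distribution (T : (R -> R[i]) -> R[i]) :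
    (R -> R[i]) -> R[i] :=
  fun f => T (fourier f).

End tempered_distributions.

Section fourier_quasicrystals.
Variable R : realType.

Definition locally_finite (A : set R) : Prop :=
  forall a b : R, finite_set (A `&` `[a, b]).

(* An atomic measure sum_x c_x delta_x is represented by its mass function
   c : R -> R[i]; its support is [set x | c x != 0]. *)
Implicit Types c a : R -> R[i].

Definition atoms c : set R := [set x | c x != 0].

(* For f of compact support and locally finite atoms c this is a finite sum
   (\sum_(x \in A) is 0 when infinitely many terms are nonzero). *)
Definition integral_atomic c (f : R -> R[i]) : R[i] :=
  \sum_(x \in atoms c) (c x * f x).

Definition agrees_with_measure (T : (R -> R[i]) -> R[i]) c : Prop :=
  forall f, test_function f -> T f = integral_atomic c f.

Definition tempered_measure c : Prop :=
  locally_finite (atoms c) /\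
  exists2 T, tempered_distribution T & agrees_with_measure T c.

Definition variation_measure c : R -> R[i] := fun x => `|c x|.

Definition crystalline_pair c a : Prop :=
  [/\ locally_finite (atoms c), locally_finite (atoms a) &
      exists T, [/\ tempered_distribution T, agrees_with_measure T c &
                    agrees_with_measure (fourier_distribution T) a]].

Definition fourier_quasicrystal c : Prop :=
  exists a, [/\ crystalline_pair c a,
                tempered_measure (variation_measure c) &
                tempered_measure (variation_measure a)].

Definition unit_masses (Lambda : set R) : R -> R[i] :=
  fun x => (\1_Lambda x)%:C.

End fourier_quasicrystals.

Section exponential_polynomials.
Variable R : realType.

Definition exp_poly n (b : 'I_n -> R[i]) (gamma : 'I_n -> R) (z : R[i]) :
    R[i] :=
  \sum_(k < n) b k * cexp ((0 +i* 1) * (gamma k)%:C * z).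

(* R[i]^o is R[i] as a normed space over itself: the derivative is complex. *)
Definition simple_zero (p : R[i] -> R[i]) (z : R[i]) : Prop :=
  [/\ p z = 0, derivable (p : R[i]^o -> R[i]^o) z 1 &
      derive1 (p : R[i]^o -> R[i]^o) z != 0].

End exponential_polynomials.

(* Main.v *)
Require Import Defs.
From mathcomp Require Import all_boot all_order all_algebra.
From mathcomp Require Import complex.
From mathcomp Require Import ring lra zify.
From mathcomp Require Import all_classical all_reals all_analysis.
Import Order.TTheory GRing.Theory Num.Theory.
Import numFieldNormedType.Exports.
Import ComplexField.Normc.
Local Open Scope classical_set_scope.
Local Open Scope complex_scope.
Local Open Scope ring_scope.

(** Let mu be the sum of unit masses on Lambda, and let a be the masses of its transform.

The idea is to recover from mu an entire function with zero set Lambda, as a limit of finite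
products over the points of Lambda, and to show that the spectrum of mu forces this limit to be a
finite exponential sum.

Summation formula.  Testing the distribution on transforms of test functions gives
  sum_(l in Lambda) f^(l) = sum_s a_s f(s)
(poisson_summation).  Averaging it over translates of one test function bounds the number of points
of Lambda in an interval of given length (bounded_density), so the sum of 1 / (1 + l^2) over Lambda
converges.  Applied to smooth truncations of s e^(2 pi i s z) on s > 0, the formula gives for
Im z > 0
  sum_(l in Lambda) (z - l)^(-2) = - 4 pi^2 sum_(s > 0) s a_s e^(2 pi i s z)
(summation_resolvent); the right-hand side converges absolutely since |a| grows polynomially.

Integration.  Up to sign the left-hand side is the second derivative of the logarithm of a product
with zeros Lambda.  Integrating twice from i shows that, for suitable real c_N, the products
  psi_N(z) = e^(c_N (z - i)) prod_(l in Lambda, |l| <= N) (z - l) / (i - l)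
converge in the upper half plane to F(z) = kappa e^(- i sigma z) e^(H(z)), where H is a series of
exponentials with positive frequencies (psi_converges).  In particular F has no zeros there, and
expanding e^H shows that F is a finite exponential sum up to O(e^(- 2 pi r Im z)), for every r
(exp_series_truncation).

Finiteness.  As all zeros of psi_N are real, |psi_N(x + i y)| is even in y and increases with |y|.
Integrate psi_N(z) e^(- 2 pi i t z) along a long rectangle with horizontal sides at heights Y and -Y:
the vertical sides are negligible, so its means on both lines agree (contour_comparison).  The
upper mean approximates the coefficient of frequency t in F; the lower mean is small for large Y as
soon as t exceeds the exponential type of F.  Hence only finitely many frequencies occur in F, and F
is the restriction of an exponential polynomial p (limit_exp_sum).

Zeros.  The same comparison, at a fixed height, shows that p is proportional to its reflection
conj p(conj z) (coefs_reflection); so p has no zeros in the lower half plane either.  On the real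
line, |psi_N(l + i y)| <= y |psi_N(l + i)| for l in Lambda, so that p(l) = 0; and by convergence of
the sum of 1 / (1 + l^2) the ratio |psi_N(x + i y)| / |psi_N(x + i)| is at least a constant times the
distance from x to a point l0 of Lambda, uniformly in y and N, if x stays away from the other points
(evl_lower_bound).  So p has no other zeros, and those in Lambda are simple.

Convergence is only needed along horizontal and vertical segments, and the products times
exponentials have explicit primitives; so the mean value inequality in one real variable takes the
place of complex integration throughout. *)

Set Implicit Arguments.
Unset Strict Implicit.
Unset Printing Implicit Defensive.

(** * Complex numbers, the exponential and derivatives along the real line *)

Section complex_modulus.
Variable R : realType.
Local Notation C := R[i].
Local Notation Re := (@complex.Re R).
Local Notation Im := (@complex.Im R).
Implicit Types (z w : C) (x y : R).

Lemma Re_add z w : Re (z + w) = Re z + Re w. Proof. by case: z; case: w. Qed.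
Lemma Im_add z w : Im (z + w) = Im z + Im w. Proof. by case: z; case: w. Qed.
Lemma Re_opp z : Re (- z) = - Re z. Proof. by case: z. Qed.
Lemma Im_opp z : Im (- z) = - Im z. Proof. by case: z. Qed.
Lemma Re_sub z w : Re (z - w) = Re z - Re w. Proof. by rewrite Re_add Re_opp. Qed.
Lemma Im_sub z w : Im (z - w) = Im z - Im w. Proof. by rewrite Im_add Im_opp. Qed.
Lemma Re_mul z w : Re (z * w) = Re z * Re w - Im z * Im w.
Proof. by case: z; case: w. Qed.
Lemma Im_mul z w : Im (z * w) = Re z * Im w + Im z * Re w.
Proof. by case: z; case: w. Qed.

Lemma complex_ext z w : Re z = Re w -> Im z = Im w -> z = w.
Proof. by case: z => a b; case: w => c d /= -> ->. Qed.

Lemma Im_sum I (r : seq I) (P : pred I) (F : I -> C) :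
  Im (\sum_(i <- r | P i) F i) = \sum_(i <- r | P i) Im (F i).
Proof. exact: (big_morph _ Im_add). Qed.

Lemma normc_ge0 z : 0 <= normc z.
Proof. by case: z => a b; exact: sqrtr_ge0. Qed.

Lemma normcD z w : normc (z + w) <= normc z + normc w.
Proof. exact: le_normcD. Qed.

Lemma normc_opp z : normc (- z) = normc z.
Proof. exact: normcN. Qed.

Lemma normcB z w : normc (z - w) <= normc z + normc w.
Proof. by rewrite -(normc_opp w); exact: normcD. Qed.

Lemma normc_distC z w : normc (z - w) = normc (w - z).
Proof. by rewrite -normc_opp opprB. Qed.

Lemma normc_sum I (r : seq I) (P : pred I) (F : I -> C) :
  normc (\sum_(i <- r | P i) F i) <= \sum_(i <- r | P i) normc (F i).
Proof.
elim/big_rec2: _ => [|i a b _ h]; first by rewrite normc0.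
by apply: le_trans (normcD _ _) _; rewrite lerD2l.
Qed.

Lemma normc_prod I (r : seq I) (P : pred I) (F : I -> C) :
  normc (\prod_(i <- r | P i) F i) = \prod_(i <- r | P i) normc (F i).
Proof. apply: (big_morph _ (@normcM R)); exact: normc1. Qed.

Lemma normcX z n : normc (z ^+ n) = normc z ^+ n.
Proof. by elim: n => [|n IH]; rewrite ?normc1 // !exprS normcM IH. Qed.

Lemma normc_sqrE z : normc z ^+ 2 = Re z ^+ 2 + Im z ^+ 2.
Proof. by case: z => a b /=; rewrite sqr_sqrtr // addr_ge0 ?sqr_ge0. Qed.

Lemma normcR x : normc x%:C = `|x|.
Proof. by rewrite /= expr0n /= addr0 sqrtr_sqr. Qed.

Lemma normc_i x : normc (0 +i* x) = `|x|.
Proof. by rewrite /= expr0n /= add0r sqrtr_sqr. Qed.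

Lemma ler_Re_normc z : `|Re z| <= normc z.
Proof.
by rewrite -sqrtr_sqr; case: z => a b /=; rewrite ler_sqrt ?lerDl ?sqr_ge0 // addr_ge0 ?sqr_ge0.
Qed.

Lemma ler_Im_normc z : `|Im z| <= normc z.
Proof.
by rewrite -sqrtr_sqr; case: z => a b /=; rewrite ler_sqrt ?lerDr ?sqr_ge0 // addr_ge0 ?sqr_ge0.
Qed.

Lemma Re_le_normc z : Re z <= normc z.
Proof. by apply: le_trans (ler_norm _) (ler_Re_normc z). Qed.

Lemma normc_le_ReIm z : normc z <= `|Re z| + `|Im z|.
Proof.
case: z => a b; have -> : a +i* b = a%:C + (0 +i* b).
  by apply: complex_ext; rewrite /= ?addr0 ?add0r.
by apply: le_trans (normcD _ _) _; rewrite normcR normc_i /= addr0 add0r.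
Qed.

Lemma normc_eq0 z : (normc z == 0) = (z == 0).
Proof. by apply/eqP/eqP => [/eq0_normc //|->]; rewrite normc0. Qed.

Lemma normc_gt0 z : (0 < normc z) = (z != 0).
Proof. by rewrite lt_neqAle normc_ge0 andbT eq_sym normc_eq0. Qed.

Lemma normc_conj z : normc (conjc z) = normc z.
Proof. by case: z => a b /=; rewrite sqrrN. Qed.

Lemma normc_real_ge0 x : 0 <= x -> normc x%:C = x.
Proof. by move=> x0; rewrite normcR ger0_norm. Qed.

Lemma mul_conjc z : z * conjc z = (normc z ^+ 2)%:C.
Proof.
rewrite normc_sqrE; case: z => a b; apply: complex_ext => /=; ring.
Qed.

Lemma complexRM x y : (x * y)%:C = x%:C * y%:C :> C.
Proof. exact: rmorphM. Qed.
Lemma complexRD x y : (x + y)%:C = x%:C + y%:C :> C.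
Proof. exact: rmorphD. Qed.

End complex_modulus.

Section complex_exponential.
Variable R : realType.
Local Notation C := R[i].
Local Notation Re := (@complex.Re R).
Implicit Types (z w : C) (x y : R).

Lemma cexpD z w : cexp (z + w) = cexp z * cexp w.
Proof.
rewrite /cexp Re_add Im_add expRD cosD sinD.
by apply: complex_ext => /=; ring.
Qed.

Lemma cexp0 : cexp (0 : C) = 1.
Proof. by rewrite /cexp /= expR0 cos0 sin0 mul1r. Qed.

Lemma normc_cexp z : normc (cexp z) = expR (Re z).
Proof.
rewrite normcM normcR ger0_norm ?expR_ge0 // /= cos2Dsin2.
by rewrite sqrtr1 mulr1.
Qed.

Lemma cexp_neq0 z : cexp z != 0.
Proof. by rewrite -normc_gt0 normc_cexp expR_gt0. Qed.

Lemma conjc_cexp z : conjc (cexp z) = cexp (conjc z).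
Proof. by case: z => a b; rewrite /cexp /= cosN sinN; apply: complex_ext => /=; ring. Qed.

End complex_exponential.

Section complex_derivative.
Variable R : realType.
Local Notation C := R[i].
Local Notation Re := (@complex.Re R).
Local Notation Im := (@complex.Im R).
Implicit Types (f g : R -> C) (d e : C) (x : R).

(** R[i] is not a normed space over R, so a derivative in a real variable is taken
  componentwise. *)
Definition cder f x d := is_derive x 1 (Re \o f) (Re d) /\ is_derive x 1 (Im \o f) (Im d).

Lemma cder_eq f x d d' : cder f x d -> d = d' -> cder f x d'.
Proof. by move=> h <-. Qed.

Lemma cder_ext f g x d : (forall x, f x = g x) -> cder f x d -> cder g x d.
Proof. by move=> /funext ->. Qed.

Lemma cder_unique f x d d' : cder f x d -> cder f x d' -> d = d'.
Proof.
by move=> [h1 h2] [h3 h4]; apply: complex_ext; [rewrite -(@derive_val _ _ _ _ _ _ _ h1) (@derive_val _ _ _ _ _ _ _ h3)|rewrite -(@derive_val _ _ _ _ _ _ _ h2) (@derive_val _ _ _ _ _ _ _ h4)].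
Qed.

Lemma cder_cst d x : cder (fun _ => d) x 0.
Proof. by split; exact: is_derive_cst. Qed.

Lemma cderD f g x d e : cder f x d -> cder g x e -> cder (fun x => f x + g x) x (d + e).
Proof.
move=> [f1 f2] [g1 g2]; split.
- rewrite Re_add; have -> : Re \o (fun x => f x + g x) = (Re \o f) + (Re \o g).
    by apply/funext => t; rewrite /= Re_add.
  exact: is_deriveD.
- rewrite Im_add; have -> : Im \o (fun x => f x + g x) = (Im \o f) + (Im \o g).
    by apply/funext => t; rewrite /= Im_add.
  exact: is_deriveD.
Qed.

Lemma cderM f g x d e : cder f x d -> cder g x e ->
  cder (fun x => f x * g x) x (d * g x + f x * e).
Proof.
move=> [f1 f2] [g1 g2]; split.
- have -> : Re \o (fun x => f x * g x) = (Re \o f) * (Re \o g) - (Im \o f) * (Im \o g).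
    by apply/funext => t; rewrite /= Re_mul.
  apply: (is_derive_eq (is_deriveB (is_deriveM f1 g1) (is_deriveM f2 g2))); rewrite !(Re_add, Re_mul) /= /GRing.scale /=; ring.
- have -> : Im \o (fun x => f x * g x) = (Re \o f) * (Im \o g) + (Im \o f) * (Re \o g).
    by apply/funext => t; rewrite /= Im_mul.
  apply: (is_derive_eq (is_deriveD (is_deriveM f1 g2) (is_deriveM f2 g1))); rewrite !(Im_add, Im_mul) /= /GRing.scale /=; ring.
Qed.

Lemma cderZ (k : C) f x d : cder f x d -> cder (fun x => k * f x) x (k * d).
Proof. by move=> h; apply: cder_eq (cderM (cder_cst k x) h) _; rewrite mul0r add0r. Qed.

Lemma cderN f x d : cder f x d -> cder (fun x => - f x) x (- d).
Proof.
move=> h; apply: cder_eq (cder_ext _ (cderZ (-1) h)) _; last by rewrite mulN1r.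
by move=> t; rewrite mulN1r.
Qed.

Lemma cderB f g x d e : cder f x d -> cder g x e -> cder (fun x => f x - g x) x (d - e).
Proof. by move=> hf hg; exact: cderD hf (cderN hg). Qed.

Lemma cder_real (f : R -> R) x (d : R) : is_derive x 1 f d -> cder (fun x => (f x)%:C) x d%:C.
Proof. by move=> h; split => //; exact: is_derive_cst. Qed.

Lemma cder_id x : cder (fun x => x%:C) x 1.
Proof. by apply: (@cder_real id); exact: is_derive_id. Qed.

Lemma cder_sum (I : Type) (r : seq I) (F : I -> R -> C) (D : I -> C) x :
  (forall i, cder (F i) x (D i)) ->
  cder (fun x => \sum_(i <- r) F i x) x (\sum_(i <- r) D i).
Proof.
move=> h; elim: r => [|i r IH].
  by rewrite big_nil; apply: cder_ext (cder_cst 0 x) => t; rewrite big_nil.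
rewrite big_cons; apply: cder_ext (cderD (h i) IH) => t.
by rewrite big_cons.
Qed.

Lemma is_derive_chain (f g : R -> R) x (df dg : R) : is_derive (g x) 1 f df ->
  is_derive x 1 g dg -> is_derive x 1 (f \o g) (df * dg).
Proof. exact: is_derive1_comp. Qed.

Lemma cder_comp f (u : R -> R) x d (du : R) : cder f (u x) d -> is_derive x 1 u du ->
  cder (fun x => f (u x)) x (d * du%:C).
Proof.
move=> [f1 f2] hu; split.
  rewrite Re_mul /= mulr0 subr0; exact: (@is_derive_chain (Re \o f)).
rewrite Im_mul /= mulr0 add0r; exact: (@is_derive_chain (Im \o f)).
Qed.

Lemma cder_cexp f x d : cder f x d -> cder (fun x => cexp (f x)) x (d * cexp (f x)).
Proof.
move=> [f1 f2].
have e1 : is_derive x 1 (fun x => expR (Re (f x))) (expR (Re (f x)) * Re d).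
  by apply: (@is_derive_chain expR (Re \o f)); exact: is_derive_expR.
have e2 : is_derive x 1 (fun x => cos (Im (f x))) (- sin (Im (f x)) * Im d).
  by apply: (@is_derive_chain cos (Im \o f)); exact: is_derive_cos.
have e3 : is_derive x 1 (fun x => sin (Im (f x))) (cos (Im (f x)) * Im d).
  by apply: (@is_derive_chain sin (Im \o f)); exact: is_derive_sin.
have h : cder (fun x => cos (Im (f x)) +i* sin (Im (f x))) x
   ((- sin (Im (f x)) * Im d) +i* (cos (Im (f x)) * Im d)) by [].
apply: cder_eq (cderM (cder_real e1) h) _.
by rewrite /cexp; apply: complex_ext; rewrite !(Re_add, Re_mul, Im_add, Im_mul) /=; ring.
Qed.

Lemma cderV f x d : f x != 0 -> cder f x d -> cder (fun x => (f x)^-1) x (- d / f x ^+ 2).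
Proof.
move=> f0 [f1 f2].
set n2 := fun x => Re (f x) ^+ 2 + Im (f x) ^+ 2.
have n20 : n2 x != 0.
  by rewrite /n2 -normc_sqrE expf_neq0 // normc_eq0.
have dn2 : is_derive x 1 n2 (2 * (Re (f x) * Re d + Im (f x) * Im d)).
  have -> : n2 = (Re \o f) * (Re \o f) + (Im \o f) * (Im \o f) by [].
  by apply: is_derive_eq (is_deriveD (is_deriveM f1 f1) (is_deriveM f2 f2)) _; rewrite /GRing.scale /=; ring.
have dinv : is_derive x 1 (fun x => (n2 x)^-1) (- (2 * (Re (f x) * Re d + Im (f x) * Im d)) / n2 x ^+ 2).
  apply: (is_derive_eq (is_deriveV n20 dn2)).
  by rewrite /GRing.scale /=; ring.
have dconj : cder (fun x => Re (f x) -i* Im (f x)) x (Re d -i* Im d).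
  by split => //; exact: (@is_deriveN _ _ _ (Im \o f)).
apply: cder_eq (cder_ext _ (cderM (cder_real dinv) dconj)) _.
  move=> t; rewrite /n2; case: (f t) => a b /=.
  by apply: complex_ext => /=; ring.
rewrite /n2 in n20 *; case: (f x) f0 n20 => a b f0 n20; case: d {f1 f2 dn2 dinv dconj} => u v /=.
apply: (mulIf (expf_neq0 2 f0)).
rewrite divfK ?expf_neq0 //.
apply: complex_ext; rewrite /= in n20 *; field => //.
Qed.

End complex_derivative.

(** * Mean value inequalities and derivatives along the coordinate axes *)

Section mean_value_inequalities.
Variable R : realType.
Local Notation C := R[i].
Local Notation Re := (@complex.Re R).
Local Notation Im := (@complex.Im R).
Implicit Types (f g : R -> C) (x y a b : R).

Lemma is_derive_le0_nincr (f f' : R -> R) a b : a <= b ->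
  (forall x, a <= x <= b -> is_derive x 1 f (f' x)) ->
  (forall x, a <= x <= b -> f' x <= 0) -> f b <= f a.
Proof.
move=> ab df f'0.
have cf : {within `[a, b], continuous f}.
  apply: derivable_within_continuous => x; rewrite in_itv /= => /df h.
  exact: (@ex_derive _ _ _ _ _ _ _ h).
have df' x : x \in `]a, b[%R -> is_derive x 1 f (f' x).
  by rewrite in_itv /= => /andP[ax xb]; apply: df; rewrite !ltW.
have [c + e] := MVT_segment ab df' cf.
rewrite in_itv /= => /f'0 c0; rewrite -subr_le0 e.
by rewrite mulr_le0_ge0 // subr_ge0.
Qed.

(** Rotate the increment of f onto the positive real axis: the claim becomes monotonicity of
  a real function. *)
Lemma cmvt f f' (G G' : R -> R) a b : a <= b ->
  (forall x, a <= x <= b -> cder f x (f' x)) ->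
  (forall x, a <= x <= b -> is_derive x 1 G (G' x)) ->
  (forall x, a <= x <= b -> normc (f' x) <= G' x) ->
  normc (f b - f a) <= G b - G a.
Proof.
move=> ab df dG le.
have [v0|v0] := eqVneq (f b - f a) 0.
  rewrite v0 normc0 subr_ge0.
  have := @is_derive_le0_nincr (fun x => - G x) (fun x => - G' x) a b ab.
  rewrite lerN2; apply => x xab; first by apply: is_deriveN; exact: dG.
  by rewrite oppr_le0; apply: le_trans (le x xab); exact: normc_ge0.
set v := f b - f a in v0 *.
set u : C := conjc v * ((normc v)^-1)%:C.
have nv : normc v != 0 by rewrite normc_eq0.
have nu : normc u = 1.
  by rewrite normcM normc_conj normcR ger0_norm ?invr_ge0 ?normc_ge0 // mulfV.
have uv : u * v = (normc v)%:C.
  rewrite /u mulrAC mulrC [conjc v * v]mulrC mul_conjc -complexRM.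
  by congr (_ %:C); field.
pose h x := Re (u * f x) - G x.
have : h b <= h a.
  apply: (@is_derive_le0_nincr h (fun x => Re (u * f' x) - G' x)) => // x xab.
    exact: is_deriveB (cderZ u (df x xab)).1 (dG x xab).
  rewrite subr_le0; apply: le_trans (le x xab).
  by apply: le_trans (Re_le_normc _) _; rewrite normcM nu mul1r.
rewrite /h => hh.
have -> : normc v = Re (u * f b) - Re (u * f a).
  by rewrite -Re_sub -mulrBr -/v uv.
lra.
Qed.

Lemma cmvt_abs f f' (M : R) a b :
  (forall x, Num.min a b <= x <= Num.max a b -> cder f x (f' x)) ->
  (forall x, Num.min a b <= x <= Num.max a b -> normc (f' x) <= M) ->
  normc (f b - f a) <= M * `|b - a|.
Proof.
wlog ab : a b / a <= b => [W|].
  case/orP: (le_total a b) => [ab|ba]; first exact: W.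
  move=> h1 h2; rewrite normc_distC distrC; apply: W => // x;
    by rewrite minC maxC => ?; auto.
rewrite min_l // max_r // => h1 h2; rewrite ger0_norm ?subr_ge0 // mulrBr.
apply: (@cmvt f f' (fun x => M * x) (fun=> M)) => // x _.
apply: is_derive_eq (is_deriveZ M (is_derive_id x 1)) _.
by rewrite /GRing.scale /= mulr1.
Qed.

(** Since |f|' <= e |f|, f grows at most like e^(e x); integrating this bound for f' gives
  the estimate. *)
Lemma gronwall_le f (u : R -> C) (e : R) a b : a <= b -> 0 <= e ->
  (forall x, a <= x <= b -> cder f x (u x * f x)) ->
  (forall x, a <= x <= b -> normc (u x) <= e) ->
  normc (f b - f a) <= normc (f a) * (expR (e * (b - a)) - 1).
Proof.
move=> ab e0 df ue.
have dE (k : R) x : is_derive x 1 (fun x => expR (k * (x - a))) (k * expR (k * (x - a))).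
  have h : is_derive x 1 (fun x => k * (x - a)) k.
    apply: is_derive_eq (is_deriveZ k (is_deriveB (is_derive_id x 1) (is_derive_cst a x 1))) _.
    by rewrite subr0 /GRing.scale /= mulr1.
  by rewrite mulrC; apply: (@is_derive_chain R expR).
have grow x : a <= x <= b -> normc (f x) <= normc (f a) * expR (e * (x - a)).
  move=> /andP[ax xb].
  pose N x := Re (f x) ^+ 2 + Im (f x) ^+ 2.
  pose N' x := 2 * Re (u x) * N x.
  have dN y : a <= y <= b -> is_derive y 1 N (N' y).
    move=> /df [h1 h2].
    apply: is_derive_eq (is_deriveD (is_deriveX 2 h1) (is_deriveX 2 h2)) _.
    by rewrite /N' /N /GRing.scale /= expr1 Re_mul Im_mul; ring.
  have : N x * expR ((- 2 * e) * (x - a)) <= N a * expR ((- 2 * e) * (a - a)).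
    apply: (@is_derive_le0_nincr (fun x => N x * expR ((- 2 * e) * (x - a)))
      (fun x => (N' x - 2 * e * N x) * expR ((- 2 * e) * (x - a)))) => // y /andP[ay yx].
      have yab : a <= y <= b by rewrite ay (le_trans yx).
      apply: is_derive_eq (is_deriveM (dN y yab) (dE (- 2 * e) y)) _.
      by rewrite /GRing.scale /=; ring.
    have yab : a <= y <= b by rewrite ay (le_trans yx).
    rewrite mulr_le0_ge0 ?expR_ge0 // /N' -mulrBl mulr_le0_ge0 ?addr_ge0 ?sqr_ge0 //.
    rewrite -mulrBr pmulr_rle0 // subr_le0.
    exact: le_trans (Re_le_normc _) (ue _ yab).
  rewrite subrr mulr0 expR0 mulr1 /N -!normc_sqrE => h.
  rewrite -(@ler_pXn2r _ 2) ?nnegrE ?mulr_ge0 ?normc_ge0 ?expR_ge0 //.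
  rewrite exprMn -expRM_natl.
  rewrite -ler_pdivrMr ?expR_gt0 // -expRN.
  by apply: le_trans h; rewrite ler_wpM2l ?sqr_ge0 // ler_expR; lra.
have := @cmvt f (fun x => u x * f x) (fun x => normc (f a) * expR (e * (x - a)))
   (fun x => normc (f a) * (e * expR (e * (x - a)))) a b ab df.
rewrite subrr mulr0 expR0 -mulrBr; apply.
move=> x xab; rewrite normcM mulrCA ler_pM ?normc_ge0 //; [exact: ue|exact: grow].
Qed.

Lemma gronwall f (u : R -> C) (e : R) a b : 0 <= e ->
  (forall x, Num.min a b <= x <= Num.max a b -> cder f x (u x * f x)) ->
  (forall x, Num.min a b <= x <= Num.max a b -> normc (u x) <= e) ->
  normc (f b - f a) <= normc (f a) * (expR (e * `|b - a|) - 1).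
Proof.
move=> e0; case/orP: (le_total a b) => [ab|ba].
  rewrite min_l // max_r //; by move=> h1 h2; rewrite ger0_norm ?subr_ge0 //; apply: (@gronwall_le f u).
rewrite min_r // max_l // => h1 h2.
have := @gronwall_le (fun x => f (- x)) (fun x => - u (- x)) e (- a) (- b).
rewrite !opprK lerN2 => /(_ ba e0); rewrite ler0_norm ?subr_le0 // opprB.
rewrite [- b + a]addrC; apply => x xab.
  have h : is_derive x 1 -%R (-1 : R) by exact: is_deriveNid.
  apply: cder_eq (@cder_comp _ f -%R x _ _ (h1 (- x) _) h) _; first lra.
  by rewrite rmorphN1 mulrN1 mulNr.
by rewrite normc_opp; apply: h2; lra.
Qed.

End mean_value_inequalities.

Section axis_parallel_derivative.
Variable R : realType.
Local Notation C := R[i].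
Local Notation Re := (@complex.Re R).
Local Notation Im := (@complex.Im R).
Implicit Types (F G : C -> C) (z d e : C).

(** Both partial derivatives, tied by the Cauchy-Riemann equation: all that is needed to
  compare values along paths made of horizontal and vertical segments. *)
Definition holo F z d :=
  cder (fun x => F (x +i* Im z)) (Re z) d /\
  cder (fun y => F (Re z +i* y)) (Im z) ('i * d).

Let eta z : Re z +i* Im z = z. Proof. by case: z. Qed.

Lemma holo_eq F z d e : holo F z d -> d = e -> holo F z e.
Proof. by move=> h <-. Qed.

Lemma holo_ext F G z d : (forall z, F z = G z) -> holo F z d -> holo G z d.
Proof. by move=> /funext ->. Qed.

Lemma holo_cst e z : holo (fun=> e) z 0.
Proof. by split; rewrite ?mulr0; exact: cder_cst. Qed.

Lemma holo_id z : holo id z 1.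
Proof.
split; first by split => /=; [exact: is_derive_id|exact: is_derive_cst].
by rewrite mulr1; split => /=; [exact: is_derive_cst|exact: is_derive_id].
Qed.

Lemma holoD F G z d e : holo F z d -> holo G z e -> holo (fun z => F z + G z) z (d + e).
Proof. by move=> [f1 f2] [g1 g2]; split; rewrite ?mulrDr; exact: cderD. Qed.

Lemma holoM F G z d e : holo F z d -> holo G z e ->
  holo (fun z => F z * G z) z (d * G z + F z * e).
Proof.
move=> [f1 f2] [g1 g2]; split.
  by apply: cder_eq (cderM f1 g1) _; rewrite eta.
by apply: cder_eq (cderM f2 g2) _; rewrite eta; ring.
Qed.

Lemma holoZ (k : C) F z d : holo F z d -> holo (fun z => k * F z) z (k * d).
Proof. by move=> h; apply: holo_eq (holoM (holo_cst k z) h) _; rewrite mul0r add0r. Qed.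

Lemma holoN F z d : holo F z d -> holo (fun z => - F z) z (- d).
Proof.
move=> h; apply: holo_eq (holo_ext _ (holoZ (-1) h)) _; last by rewrite mulN1r.
by move=> t; rewrite mulN1r.
Qed.

Lemma holoB F G z d e : holo F z d -> holo G z e -> holo (fun z => F z - G z) z (d - e).
Proof. by move=> hf hg; exact: holoD hf (holoN hg). Qed.

Lemma holo_cexp F z d : holo F z d -> holo (fun z => cexp (F z)) z (d * cexp (F z)).
Proof.
move=> [f1 f2]; split.
  by apply: cder_eq (cder_cexp f1) _; rewrite eta.
by apply: cder_eq (cder_cexp f2) _; rewrite eta; ring.
Qed.

Lemma holoV F z d : F z != 0 -> holo F z d -> holo (fun z => (F z)^-1) z (- d / F z ^+ 2).
Proof.
move=> F0 [f1 f2]; split.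
  by apply: cder_eq (cderV _ f1) _; rewrite eta.
by apply: cder_eq (cderV _ f2) _; rewrite eta // mulNr mulrA mulrN mulNr.
Qed.

Lemma holo_sum (I : Type) (r : seq I) (F : I -> C -> C) (D : I -> C) z :
  (forall i, holo (F i) z (D i)) ->
  holo (fun z => \sum_(i <- r) F i z) z (\sum_(i <- r) D i).
Proof.
move=> h; split; first exact: cder_sum (fun i => (h i).1).
by rewrite mulr_sumr; exact: cder_sum (fun i => (h i).2).
Qed.

Lemma holo_horizontal F f (M : R) a b y :
  (forall x, Num.min a b <= x <= Num.max a b ->
     holo F (x +i* y) (f (x +i* y)) /\ normc (f (x +i* y)) <= M) ->
  normc (F (b +i* y) - F (a +i* y)) <= M * `|b - a|.
Proof.
move=> h; apply: (@cmvt_abs _ (fun x => F (x +i* y)) (fun x => f (x +i* y))) => x /h [] //.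
by case.
Qed.

Lemma holo_vertical F f (M : R) a b x :
  (forall y, Num.min a b <= y <= Num.max a b ->
     holo F (x +i* y) (f (x +i* y)) /\ normc (f (x +i* y)) <= M) ->
  normc (F (x +i* b) - F (x +i* a)) <= M * `|b - a|.
Proof.
move=> h; apply: (@cmvt_abs _ (fun y => F (x +i* y)) (fun y => 'i * f (x +i* y))) => y /h [] //.
  by case.
by move=> _; rewrite normcM normc_i normr1 mul1r.
Qed.

End axis_parallel_derivative.

(** * Integrals of compactly supported functions *)

Section integral_compact_support.
Variable R : realType.
Local Notation C := R[i].
Local Notation Re := (@complex.Re R).
Local Notation Im := (@complex.Im R).
Local Notation mu := (@lebesgue_measure R).

Definition vanishes_beyond (V : nmodType) (A : R) (f : R -> V) := forall x, A < `|x| -> f x = 0.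

(** Integrals over the line are only ever computed as increments of a primitive; this is where
  Lebesgue integration enters, through the fundamental theorem of calculus. *)
Lemma Rintegral_primitive (f : R -> R) (A : R) : continuous f -> vanishes_beyond A f ->
  exists2 F : R -> R, (forall x : R, is_derive x 1 F (f x)) &
    forall B, A < B -> Rintegral mu setT f = F B - F (- B).
Proof.
move=> cf f0.
have intf (D : set R) : measurable D -> mu.-integrable D (EFin \o f).
  move=> mD; apply: (@integrableS _ _ _ _ setT) => //.
  have -> : EFin \o f = (EFin \o f) \_ `[- A, A].
    apply/funext => x; rewrite patchE; case: ifPn => //.
    rewrite notin_setE /= in_itv /= -ler_norml => /negP; rewrite -ltNge.
    by move=> /f0 ->.
  have h : mu.-integrable `[- A, A] (EFin \o f).
    apply: continuous_compact_integrable; first exact: segment_compact.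
    exact: continuous_subspaceT.
  exact: (integrable_mkcond _ _).1 h.
pose F x := (\int[mu]_(t in `]-oo, x]) f t)%R.
exists F => [x|B AB].
  have [||||d e] := @continuous_FTC1 R f -oo%O x (x + 1).
  - by rewrite ltrDl.
  - exact: intf.
  - by rewrite ltNyr.
  - exact: cf.
  by rewrite derive1E in e; exact: DeriveDef.
have -> : F B = Rintegral mu setT f.
  rewrite /F Rintegral_mkcond; apply: eq_Rintegral => x _; rewrite patchE.
  case: ifPn => //; rewrite notin_setE /= in_itv /= => /negP; rewrite -ltNge => Bx.
  by rewrite f0 // (lt_le_trans (lt_trans AB Bx)) // ler_norm.
have -> : F (- B) = 0; last by rewrite subr0.
rewrite /F Rintegral_mkcond -[RHS](Rintegral_set0 mu f) [RHS]Rintegral_mkcond.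
apply: eq_Rintegral => x _; rewrite !patchE in_set0; case: ifPn => //.
rewrite inE /= in_itv /= => xB; rewrite f0 //.
by apply: (lt_le_trans AB); rewrite -normrN; apply: le_trans (ler_norm _); lra.
Qed.

Definition ccontinuous (f : R -> C) := continuous (Re \o f) /\ continuous (Im \o f).

Lemma cder_continuous (f f' : R -> C) : (forall x, cder f x (f' x)) -> ccontinuous f.
Proof.
move=> h; split=> x; apply: differentiable_continuous; apply/derivable1_diffP.
- exact: (@ex_derive _ _ _ _ _ _ _ (h x).1).
- exact: (@ex_derive _ _ _ _ _ _ _ (h x).2).
Qed.

Lemma cintegral_primitive (f : R -> C) (A : R) : ccontinuous f -> vanishes_beyond A f ->
  exists2 F : R -> C, (forall x, cder F x (f x)) &
    forall B, A < B -> cintegral f = F B - F (- B).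
Proof.
move=> [cr ci] f0.
have [|F1 dF1 e1] := Rintegral_primitive cr (A := A).
  by move=> x /f0 /= ->.
have [|F2 dF2 e2] := Rintegral_primitive ci (A := A).
  by move=> x /f0 /= ->.
exists (fun x => F1 x +i* F2 x); first by move=> x; split.
by move=> B AB; rewrite /cintegral (e1 _ AB) (e2 _ AB).
Qed.

Lemma cder0_cst (F : R -> C) : (forall x, cder F x 0) -> forall x y, F x = F y.
Proof.
move=> h x y; apply/eqP; rewrite -subr_eq0 -normc_eq0 eq_le normc_ge0 andbT.
have := @cmvt_abs _ F (fun=> 0) 0 y x; rewrite mul0r; apply => // ? _.
by rewrite normc0.
Qed.

Lemma cintegral_eq (f F : R -> C) (A B : R) : vanishes_beyond A f -> A < B ->
  ccontinuous f -> (forall x, cder F x (f x)) -> cintegral f = F B - F (- B).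
Proof.
move=> f0 AB cf dF; have [G dG e] := cintegral_primitive cf f0; rewrite (e B AB) {e}.
have h x : cder (fun x => F x - G x) x 0.
  by apply: cder_eq (cderB (dF x) (dG x)) _; rewrite subrr.
apply/eqP; rewrite -subr_eq0; apply/eqP.
transitivity ((F (- B) - G (- B)) - (F B - G B)); first by ring.
by rewrite (cder0_cst h (- B) B) subrr.
Qed.

Lemma ccontinuousM f g : ccontinuous f -> ccontinuous g -> ccontinuous (fun x => f x * g x).
Proof.
move=> [f1 f2] [g1 g2]; split => x.
  have -> : Re \o (fun x => f x * g x) = (Re \o f) * (Re \o g) - (Im \o f) * (Im \o g).
    by apply/funext => t; rewrite /= Re_mul.
  by apply: continuousB; apply: continuousM; [exact: f1|exact: g1|exact: f2|exact: g2].
have -> : Im \o (fun x => f x * g x) = (Re \o f) * (Im \o g) + (Im \o f) * (Re \o g).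
  by apply/funext => t; rewrite /= Im_mul.
by apply: continuousD; apply: continuousM; [exact: f1|exact: g2|exact: f2|exact: g1].
Qed.

Lemma cintegralD f g (A : R) : ccontinuous f -> ccontinuous g ->
  vanishes_beyond A f -> vanishes_beyond A g ->
  cintegral (fun x => f x + g x) = cintegral f + cintegral g.
Proof.
move=> cf cg f0 g0.
have [F dF eF] := cintegral_primitive cf f0.
have [G dG eG] := cintegral_primitive cg g0.
have AA : A < A + 1 by rewrite ltrDl.
have [cf1 cf2] := cf; have [cg1 cg2] := cg.
rewrite (@cintegral_eq _ (fun x => F x + G x) A (A + 1)) // ?eF ?eG //.
- by rewrite (eF (A+1)) // (eG (A+1)) //; ring.
- by move=> x xA; rewrite f0 // g0 // addr0.
- split => x.
    have -> : Re \o (fun x => f x + g x) = (Re \o f) + (Re \o g).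
      by apply/funext => t; rewrite /= Re_add.
    by apply: continuousD; [exact: cf1|exact: cg1].
  have -> : Im \o (fun x => f x + g x) = (Im \o f) + (Im \o g).
    by apply/funext => t; rewrite /= Im_add.
  by apply: continuousD; [exact: cf2|exact: cg2].
- by move=> x; exact: cderD.
Qed.

Lemma ccontinuous_cst (k : C) : ccontinuous (fun=> k).
Proof. by apply: (@cder_continuous _ (fun=> 0)) => x; exact: cder_cst. Qed.

Lemma cintegralZ (k : C) f (A : R) : ccontinuous f -> vanishes_beyond A f ->
  cintegral (fun x => k * f x) = k * cintegral f.
Proof.
move=> cf f0.
have [F dF eF] := cintegral_primitive cf f0.
have AA : A < A + 1 by rewrite ltrDl.
rewrite (@cintegral_eq _ (fun x => k * F x) A (A + 1)) // ?eF //.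
- by rewrite (eF (A+1)) // mulrBr.
- by move=> x xA; rewrite f0 // mulr0.
- by apply: ccontinuousM => //; exact: ccontinuous_cst.
- by move=> x; exact: cderZ.
Qed.

(** A primitive of f' that vanishes at both ends: the source of all integrations by parts. *)
Lemma cintegral_derivative (f f' : R -> C) (A : R) : vanishes_beyond A f ->
  vanishes_beyond A f' -> ccontinuous f' -> (forall x, cder f x (f' x)) -> cintegral f' = 0.
Proof.
move=> f0 f'0 cf' df.
have AA : A < `|A| + 1 by rewrite (le_lt_trans (ler_norm A)) // ltrDl.
rewrite (@cintegral_eq _ f A (`|A| + 1)) // !f0 ?subrr // ?normrN ger0_norm //.
Qed.

Lemma normc_cintegral_le (f : R -> C) (G G' : R -> R) (A B : R) : ccontinuous f ->
  vanishes_beyond A f -> A < B -> 0 <= B ->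
  (forall x : R, `|x| <= B -> is_derive x 1 G (G' x)) ->
  (forall x, `|x| <= B -> normc (f x) <= G' x) ->
  normc (cintegral f) <= G B - G (- B).
Proof.
move=> cf f0 AB B0 dG le.
have [F dF e] := cintegral_primitive cf f0; rewrite (e B AB) {e}.
apply: (@cmvt _ F f G G') => [|x _|x|x]; rewrite -?ler_norml //; first lra.
- exact: dG.
- exact: le.
Qed.

Lemma normc_cintegral_sup (f : R -> C) (M A : R) : 0 <= A -> ccontinuous f ->
  vanishes_beyond A f -> (forall x, normc (f x) <= M) ->
  normc (cintegral f) <= M * (2 * (A + 1)).
Proof.
move=> A0 cf f0 le.
have -> : M * (2 * (A + 1)) = M * (A + 1) - M * (- (A + 1)) by ring.
apply: (@normc_cintegral_le f (fun x => M * x) (fun=> M) A) => //; rewrite ?ltrDl ?addr_ge0 //.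
move=> x _; apply: is_derive_eq (is_deriveZ M (is_derive_id x 1)) _.
by rewrite /GRing.scale /= mulr1.
Qed.

End integral_compact_support.

(** * Smooth functions *)

Section smooth_functions.
Variable R : realType.
Local Notation C := R[i].
Local Notation Re := (@complex.Re R).
Local Notation Im := (@complex.Im R).
Implicit Types (f g h : R -> C) (x y : R).

Definition has_cder f f' := forall x, cder f x (f' x).

Definition cD f : R -> C := fun x => derive1 (Re \o f) x +i* derive1 (Im \o f) x.

Lemma cderivenE n f : cderiven n f = iter n cD f.
Proof.
suff h : Re \o iter n cD f = derive1n n (Re \o f) /\ Im \o iter n cD f = derive1n n (Im \o f).
  apply/funext => x; apply: complex_ext.
    by rewrite /cderiven /= -h.1.
  by rewrite /cderiven /= -h.2.
elim: n => [//|n [IH1 IH2]]; rewrite !derive1nS -IH1 -IH2 !iterS; split; exact/funext.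
Qed.

Lemma has_cder_cD f f' : has_cder f f' -> cD f = f'.
Proof.
move=> h; apply/funext => x; apply: complex_ext; rewrite /cD /= derive1E.
- exact: (@derive_val _ _ _ _ _ _ _ (h x).1).
- exact: (@derive_val _ _ _ _ _ _ _ (h x).2).
Qed.

Lemma smoothE f : smooth f <-> forall n, has_cder (iter n cD f) (iter n.+1 cD f).
Proof.
have eR n : Re \o iter n cD f = derive1n n (Re \o f).
  by rewrite -cderivenE; apply/funext.
have eI n : Im \o iter n cD f = derive1n n (Im \o f).
  by rewrite -cderivenE; apply/funext.
split=> [h n x|h n x].
  have [h1 h2] := h n x; rewrite -eR -eI in h1 h2.
  by split; [move/derivableP: h1|move/derivableP: h2]; rewrite -derive1E.
rewrite -eR -eI; have [h1 h2] := h n x; split.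
  exact: (@ex_derive _ _ _ _ _ _ _ h1).
exact: (@ex_derive _ _ _ _ _ _ _ h2).
Qed.

(** Smoothness with the derivatives left unspecified, hence stable under products and
  compositions by induction on the order. *)
Fixpoint Cn n f : Prop :=
  if n is m.+1 then exists2 f', has_cder f f' & Cn m f' else True.

(** The iterated derivatives demanded by smooth are the only possible ones, since derivatives
  are unique. *)
Lemma smoothP f : smooth f <-> forall n, Cn n f.
Proof.
rewrite smoothE; split => [h n|h n].
  suff : forall m, Cn n (iter m cD f) by move/(_ 0%N).
  by elim: n => [//|n IH] m; exists (iter m.+1 cD f).
elim: n f h => [|n IH] f h.
  by have [f' hf _] := h 1%N; rewrite /= (has_cder_cD hf).
rewrite iterSr (iterSr n.+1); apply: IH => m.
by have [f' hf] := h m.+1; rewrite (has_cder_cD hf).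
Qed.

Lemma smooth_cder f : smooth f -> has_cder f (cD f).
Proof. by move/smoothE/(_ 0%N). Qed.

Lemma smooth_cD f : smooth f -> smooth (cD f).
Proof. by move/smoothE => h; apply/smoothE => n; rewrite -!iterSr. Qed.

Lemma smooth_ccontinuous f : smooth f -> ccontinuous f.
Proof. by move/smooth_cder/cder_continuous. Qed.

Lemma CnS n f : Cn n.+1 f -> Cn n f.
Proof. by elim: n f => [//|n IH] f [f' hf /IH h]; exists f'. Qed.

Lemma CnD n f g : Cn n f -> Cn n g -> Cn n (fun x => f x + g x).
Proof.
elim: n f g => [//|n IH] f g [f' hf Hf] [g' hg Hg].
by exists (fun x => f' x + g' x); [move=> x; exact: cderD|exact: IH].
Qed.

Lemma CnM n f g : Cn n f -> Cn n g -> Cn n (fun x => f x * g x).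
Proof.
elim: n f g => [//|n IH] f g Hf Hg.
move: (CnS Hf) (CnS Hg) => Hf1 Hg1; case: Hf Hg => f' hf Hf [g' hg Hg].
exists (fun x => f' x * g x + f x * g' x); first by move=> x; exact: cderM.
by apply: CnD; exact: IH.
Qed.

Lemma Cn_cst n (k : C) : Cn n (fun=> k).
Proof. by elim: n k => [//|n IH] k; exists (fun=> 0) => // x; exact: cder_cst. Qed.

Lemma Cn_comp_affine n f (a b : R) : Cn n f -> Cn n (fun x => f (a * x + b)).
Proof.
elim: n f => [//|n IH] f [f' hf Hf].
exists (fun x => f' (a * x + b) * a%:C); last by apply: CnM; [exact: IH|exact: Cn_cst].
move=> x; apply: (@cder_comp _ f (fun x => a * x + b)); first exact: hf.
apply: is_derive_eq (is_deriveD (is_deriveZ a (is_derive_id x 1)) (is_derive_cst b x 1)) _.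
by rewrite addr0 /GRing.scale /= mulr1.
Qed.

Lemma Cn_cexp n (w : C) : Cn n (fun x : R => cexp (w * x%:C)).
Proof.
elim: n => [//|n IH]; exists (fun x => w * cexp (w * x%:C)).
  by move=> x; apply: cder_eq (cder_cexp (cderZ w (cder_id x))) _; rewrite mulr1.
by apply: CnM => //; exact: Cn_cst.
Qed.

Lemma Cn_id n : Cn n (fun x : R => x%:C).
Proof. by case: n => [//|n]; exists (fun=> 1); [exact: cder_id|exact: Cn_cst]. Qed.

Lemma smoothD f g : smooth f -> smooth g -> smooth (fun x => f x + g x).
Proof. by move=> /smoothP hf /smoothP hg; apply/smoothP => n; exact: CnD. Qed.

Lemma smoothM f g : smooth f -> smooth g -> smooth (fun x => f x * g x).
Proof. by move=> /smoothP hf /smoothP hg; apply/smoothP => n; exact: CnM. Qed.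

Lemma smooth_cst (k : C) : smooth (fun=> k).
Proof. by apply/smoothP => n; exact: Cn_cst. Qed.

Lemma smooth_id : smooth (fun x : R => x%:C).
Proof. by apply/smoothP => n; exact: Cn_id. Qed.

Lemma smooth_cexp (w : C) : smooth (fun x : R => cexp (w * x%:C)).
Proof. by apply/smoothP => n; exact: Cn_cexp. Qed.

Lemma smooth_comp_affine f (a b : R) : smooth f -> smooth (fun x => f (a * x + b)).
Proof. by move=> /smoothP hf; apply/smoothP => n; exact: Cn_comp_affine. Qed.

Lemma cDD f g : smooth f -> smooth g -> cD (fun x => f x + g x) = fun x => cD f x + cD g x.
Proof. by move=> /smooth_cder hf /smooth_cder hg; apply: has_cder_cD => x; exact: cderD. Qed.

Lemma cDM f g : smooth f -> smooth g ->
  cD (fun x => f x * g x) = fun x => cD f x * g x + f x * cD g x.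
Proof. by move=> /smooth_cder hf /smooth_cder hg; apply: has_cder_cD => x; exact: cderM. Qed.

Definition derivatives_bounded n (w : R -> R) f := forall k x, (k <= n)%N -> normc (iter k cD f x) <= w x.

Lemma derivatives_boundedD n u v f g : smooth f -> smooth g ->
  derivatives_bounded n u f -> derivatives_bounded n v g ->
  derivatives_bounded n (fun x => u x + v x) (fun x => f x + g x).
Proof.
elim: n f g => [|n IH] f g sf sg hf hg k x.
  by rewrite leqn0 => /eqP -> /=; apply: le_trans (normcD _ _) _; apply: lerD; [exact: (hf 0%N)|exact: (hg 0%N)].
case: k => [_|k kn].
  by apply: le_trans (normcD _ _) _; apply: lerD; [exact: (hf 0%N)|exact: (hg 0%N)].
have hcf : derivatives_bounded n u (cD f) by move=> j y jn; rewrite -iterSr; exact: hf.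
have hcg : derivatives_bounded n v (cD g) by move=> j y jn; rewrite -iterSr; exact: hg.
rewrite iterSr cDD //.
exact: (IH (cD f) (cD g) (smooth_cD sf) (smooth_cD sg) hcf hcg k x kn).
Qed.

(** Leibniz rule; 2 ^+ n bounds the sum of the binomial coefficients. *)
Lemma derivatives_boundedM n u v f g : smooth f -> smooth g ->
  derivatives_bounded n u f -> derivatives_bounded n v g ->
  derivatives_bounded n (fun x => 2 ^+ n * (u x * v x)) (fun x => f x * g x).
Proof.
elim: n f g => [|n IH] f g sf sg hf hg k x.
  by rewrite leqn0 => /eqP -> /=; rewrite expr0 mul1r normcM ler_pM ?normc_ge0 ?(hf 0%N) ?(hg 0%N).
have u0 y : 0 <= u y by apply: le_trans (hf 0%N y _); rewrite ?normc_ge0.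
have v0 y : 0 <= v y by apply: le_trans (hg 0%N y _); rewrite ?normc_ge0.
case: k => [_|k kn].
  rewrite /= normcM; apply: (@le_trans _ _ (u x * v x)).
    by rewrite ler_pM ?normc_ge0 ?(hf 0%N) ?(hg 0%N).
  by rewrite ler_peMl ?mulr_ge0 // exprn_ege1 // ler1n.
rewrite iterSr cDM //.
have hf' : derivatives_bounded n u f by move=> j y jn; apply: hf; rewrite leqW.
have hg' : derivatives_bounded n v g by move=> j y jn; apply: hg; rewrite leqW.
have hcf : derivatives_bounded n u (cD f) by move=> j y jn; rewrite -iterSr; apply: hf.
have hcg : derivatives_bounded n v (cD g) by move=> j y jn; rewrite -iterSr; apply: hg.
have sf' := smooth_cD sf; have sg' := smooth_cD sg.
have := derivatives_boundedD (smoothM sf' sg) (smoothM sf sg') (IH _ _ sf' sg hcf hg')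
  (IH _ _ sf sg' hf' hcg).
move=> /(_ k x); rewrite -ltnS => /(_ kn) h; apply: le_trans h _.
by rewrite exprS le_eqVlt; apply/orP; left; apply/eqP; ring.
Qed.

Lemma iter_cDZ n (k : C) f : smooth f ->
  iter n cD (fun x => k * f x) = fun x => k * iter n cD f x.
Proof.
move=> sf; elim: n => [//|n IH]; rewrite iterS IH; apply: has_cder_cD => x.
exact: cderZ ((smoothE f).1 sf n x).
Qed.

Lemma iter_cD_comp_scale n f (a : R) : smooth f ->
  iter n cD (fun x => f (a * x)) = fun x => (a ^+ n)%:C * iter n cD f (a * x).
Proof.
move=> sf; elim: n => [|n IH]; first by apply/funext => x; rewrite expr0 mul1r.
rewrite iterS IH; apply: has_cder_cD => x.
have h : is_derive x 1 (fun x => a * x) a.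
  by apply: is_derive_eq (is_deriveZ a (is_derive_id x 1)) _; rewrite /GRing.scale /= mulr1.
have hf := (smoothE f).1 sf n.
apply: cder_eq (cderZ _ (@cder_comp _ _ (fun x => a * x) x _ _ (hf (a * x)) h)) _.
by rewrite exprSr complexRM mulrA mulrAC -mulrA mulrA.
Qed.

Lemma ccontinuous_bounded f (A : R) : ccontinuous f -> vanishes_beyond A f ->
  exists2 K, 0 <= K & forall x, normc (f x) <= K.
Proof.
move=> [cr ci] f0.
have bd (u : R -> R) : continuous u -> exists2 K, 0 <= K & forall x, `|x| <= A -> `|u x| <= K.
  move=> cu.
  have : compact (u @` `[- A, A]).
    by apply: continuous_compact; [exact: continuous_subspaceT|exact: segment_compact].
  move/compact_bounded => [M [_ hM]].
  exists (`|M| + 1); first by rewrite addr_ge0.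
  move=> x xA; apply: (hM (`|M| + 1)); first by rewrite (le_lt_trans (ler_norm M)) // ltrDl.
  by exists x => //=; rewrite in_itv /= -ler_norml.
have [K1 K10 h1] := bd _ cr; have [K2 K20 h2] := bd _ ci.
exists (K1 + K2); first by rewrite addr_ge0.
move=> x; have [xA|/f0 ->] := leP `|x| A; last by rewrite normc0 addr_ge0.
apply: le_trans (normc_le_ReIm _) _.
by rewrite lerD ?(h1 x) ?(h2 x).
Qed.

Lemma vanishes_cD f A : smooth f -> vanishes_beyond A f -> vanishes_beyond A (cD f).
Proof.
move=> sf f0 x xA.
apply: (cder_unique (smooth_cder sf x)).
have h0 : \forall y \near x, 0 = f y.
  near=> y; rewrite f0 //; near: y.
  have : continuous (fun y : R => `|y|) by exact: norm_continuous.
  move/(_ x) => /cvgr_gt; apply.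
  exact: xA.
split; rewrite /=.
  apply: (@near_eq_is_derive _ _ _ (cst 0)).
  by near=> y; rewrite /= -(near h0 y).
apply: (@near_eq_is_derive _ _ _ (cst 0)).
by near=> y; rewrite /= -(near h0 y).
Unshelve. all: by end_near. Qed.

(** Unlike test_function, this records the radius of the support, on which all estimates
  depend. *)
Definition test_supported (A : R) f := smooth f /\ vanishes_beyond A f.

Lemma test_supported_test (A : R) f : test_supported A f -> test_function f.
Proof.
move=> [sf f0]; split=> //.
apply: (@subclosed_compact _ _ `[- A, A]); [exact: closed_closure|exact: segment_compact|].
rewrite closureE; apply: smallest_sub; first exact: itv_closed.
move=> x /= /eqP fx; rewrite in_itv /= -ler_norml leNgt; apply/negP => /f0.
exact: fx.
Qed.

Lemma test_supported_cD A f : test_supported A f -> test_supported A (cD f).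
Proof. by move=> [sf f0]; split; [exact: smooth_cD|exact: vanishes_cD]. Qed.

Lemma test_supportedM A f g : test_supported A f -> smooth g ->
  test_supported A (fun x => f x * g x).
Proof.
by move=> [sf f0] sg; split; [exact: smoothM|move=> x /f0 ->; rewrite mul0r].
Qed.

End smooth_functions.

(** * A bump function *)

Section bump_function.
Variable R : realType.
Local Notation C := R[i].

(** A quadratic error bound in a neighbourhood of fixed size replaces limit computations. *)
Lemma is_derive_quadratic (f : R -> R) (x d K : R) :
  (forall h, `|h| <= 1 -> `|f (h + x) - f x - h * d| <= K * h ^+ 2) -> is_derive x 1 f d.
Proof.
move=> H.
have H0 : 0 <= K.
  have := H 1; rewrite normr1 lexx => /(_ isT); rewrite expr1n mulr1.
  by apply: le_trans; exact: normr_ge0.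
have cv : (fun h => h^-1 *: ((f \o shift x) (h *: (1 : R)) - f x)) @ 0^' --> d.
  apply/cvgrPdist_lt => e e0; near=> h.
  have h0 : h != 0 by near: h; exact: nbhs_dnbhs_neq.
  have hs : `|h| < Num.min 1 (e / (K + 1)).
    near: h; apply: dnbhs0_lt; rewrite lt_min ltr01 divr_gt0 //.
    by rewrite ltr_wpDl.
  move: hs; rewrite lt_min => /andP[h1 he].
  have -> : d - h^-1 *: ((f \o shift x) (h *: (1 : R)) - f x) = - (h^-1 * (f (h + x) - f x - h * d)).
    by rewrite /GRing.scale /= mulr1; field.
  rewrite normrN normrM normfV.
  apply: (@le_lt_trans _ _ (`|h|^-1 * (K * h ^+ 2))).
    by rewrite ler_wpM2l ?invr_ge0 //; apply: H; exact: ltW.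
  have -> : `|h|^-1 * (K * h ^+ 2) = K * `|h|.
    by rewrite -real_normK ?num_real //; field; rewrite normr_eq0.
  apply: (@le_lt_trans _ _ ((K + 1) * `|h|)); first by rewrite ler_wpM2r // lerDl.
  by rewrite mulrC -ltr_pdivlMr // ltr_wpDl.
split; first exact: cvgP cv.
by apply: cvg_lim => //; exact: Rhausdorff.
Unshelve. all: by end_near. Qed.

Lemma cder_quadratic (f : R -> C) (x : R) (d : C) (K : R) :
  (forall h, `|h| <= 1 -> normc (f (h + x) - f x - h%:C * d) <= K * h ^+ 2) -> cder f x d.
Proof.
move=> H; split; apply: (@is_derive_quadratic _ _ _ K) => h /H; apply: le_trans.
- apply: le_trans (ler_Re_normc _); rewrite /= !(Re_sub, Re_mul) /=.
  by rewrite mul0r subr0.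
- apply: le_trans (ler_Im_normc _); rewrite /= !(Im_sub, Im_mul) /=.
  by rewrite mul0r addr0.
Qed.

Lemma expR_ge_powV (u : R) (m : nat) : 0 <= u -> (u / m.+1%:R) ^+ m.+1 <= expR u.
Proof.
move=> u0; have -> : expR u = expR (u / m.+1%:R) ^+ m.+1.
  by rewrite -expRM_natl -mulr_natr mulrC -mulrA mulVf ?mulr1 // pnatr_eq0.
rewrite ler_pXn2r ?nnegrE ?divr_ge0 ?expR_ge0 //.
by apply: le_trans (expR_ge1Dx _); rewrite lerDr.
Qed.

(** The family s^(-k) e^(-1/s) on s > 0, extended by 0, is closed under differentiation, up to
  linear combinations: this makes e^(-1/s) smooth by induction. *)
Definition exp_inv (k : nat) (s : R) : R :=
  if 0 < s then s^-1 ^+ k * expR (- s^-1) else 0.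

Lemma exp_inv_ge0 k s : 0 <= exp_inv k s.
Proof.
rewrite /exp_inv; case: ifP => // s0.
by rewrite mulr_ge0 ?expR_ge0 // exprn_ge0 // invr_ge0 ltW.
Qed.

(** At 0 the exponential beats every power of 1/s; the quadratic bound gives the derivative 0
  there. *)
Lemma exp_inv_quadratic k s : exp_inv k s <= k.+2%:R ^+ k.+2 * s ^+ 2.
Proof.
rewrite /exp_inv; case: ifP => s0; last by rewrite mulr_ge0 ?sqr_ge0 ?exprn_ge0 ?ler0n.
have := @expR_ge_powV s^-1 k.+1 _; rewrite invr_ge0 ltW // => /(_ isT) h.
rewrite expRN ler_pdivrMr ?expR_gt0 //.
have p : 0 <= k.+2%:R ^+ k.+2 * s ^+ 2 by rewrite mulr_ge0 ?sqr_ge0 ?exprn_ge0 ?ler0n.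
apply: le_trans (ler_wpM2l p h).
have e1 : k.+2%:R ^+ k.+2 * (k.+2%:R^-1) ^+ k.+2 = 1 :> R.
  by rewrite -exprMn mulfV ?expr1n ?pnatr_eq0.
have e2 : s ^+ 2 * s^-1 ^+ 2 = 1 by rewrite -exprMn mulfV ?expr1n ?gt_eqF.
have e3 : s^-1 ^+ k.+2 = s^-1 ^+ k * s^-1 ^+ 2 by rewrite -exprD addn2.
rewrite exprMn e3.
set M := k.+2%:R ^+ k.+2 in e1 *; set v := _^-1 ^+ k.+2 in e1 *.
have -> : M * s ^+ 2 * (s^-1 ^+ k * s^-1 ^+ 2 * v) = (M * v) * (s ^+ 2 * s^-1 ^+ 2) * s^-1 ^+ k by ring.
by rewrite e1 e2 !mul1r.
Qed.

Lemma is_derive_exp_inv k (s : R) :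
  is_derive s 1 (exp_inv k) (- k%:R * exp_inv k.+1 s + exp_inv k.+2 s).
Proof.
have [s0|s0|s0] := ltgtP 0 s.
- apply: (@near_eq_is_derive _ _ _ ((fun s : R => s^-1 ^+ k * expR (- s^-1)) : R -> R)).
    near=> t; rewrite /exp_inv ifT //.
    by near: t; exact: lt_nbhsr.
  have dV : is_derive s 1 (fun s : R => s^-1) (- s ^- 2).
    apply: is_derive_eq (is_deriveV (lt0r_neq0 s0) (is_derive_id s 1)) _.
    by rewrite /GRing.scale /= mulr1.
  have dE : is_derive s 1 (fun s => expR (- s^-1)) (expR (- s^-1) * s ^- 2).
    apply: (@is_derive_chain R expR (fun s => - s^-1)).
    by apply: is_derive_eq (is_deriveN dV) _; rewrite opprK.
  have -> : (fun s : R => s^-1 ^+ k * expR (- s^-1)) = ((fun s : R => s^-1) ^+ k) * (fun s => expR (- s^-1)).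
    by rewrite exprfctE.
  apply: is_derive_eq (is_deriveM (is_deriveX k dV) dE) _.
  rewrite /exp_inv s0 /GRing.scale /=.
  rewrite exprfctE -!exprVn.
  case: k => [|k]; first by rewrite !expr0; ring.
  by rewrite /= !exprS; ring.
- apply: (@near_eq_is_derive _ _ _ (cst 0)).
    near=> t; rewrite /exp_inv ifN // -leNgt ltW //.
    by near: t; exact: lt_nbhsl.
  by rewrite /exp_inv ltNge (ltW s0) /= mulr0 addr0; exact: is_derive_cst.
- rewrite -s0 /exp_inv ltxx mulr0 addr0.
  apply: (@is_derive_quadratic _ _ _ (k.+2%:R ^+ k.+2)) => h _.
  rewrite addr0 ltxx subr0 mulr0 subr0 ger0_norm.
    exact: exp_inv_quadratic.
  exact: exp_inv_ge0.
Unshelve. all: by end_near. Qed.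

Lemma Cn_exp_inv n k : Cn n (fun s => (exp_inv k s)%:C).
Proof.
elim: n k => [//|n IH] k.
exists (fun s => (- k%:R)%:C * (exp_inv k.+1 s)%:C + (exp_inv k.+2 s)%:C).
  by move=> s; rewrite -complexRM -complexRD; apply: cder_real; exact: is_derive_exp_inv.
by apply: CnD => //; apply: CnM => //; exact: Cn_cst.
Qed.

Lemma smooth_exp_inv k : smooth (fun s => (exp_inv k s)%:C).
Proof. by apply/smoothP => n; exact: Cn_exp_inv. Qed.

(** Normalized to take the value 1 at 0. *)
Definition bumpf (s : R) : R := expR 2 * (exp_inv 0 (1 + s) * exp_inv 0 (1 - s)).

Lemma bump_ge0 s : 0 <= bumpf s.
Proof. by rewrite /bumpf !mulr_ge0 ?expR_ge0 ?exp_inv_ge0. Qed.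

Lemma bump_inE s : `|s| < 1 -> bumpf s = expR (2 - 2 / (1 - s ^+ 2)).
Proof.
rewrite ltr_norml => /andP[s1 s2]; rewrite /bumpf /exp_inv.
have p1 : 0 < 1 + s by lra.
have p2 : 0 < 1 - s by lra.
rewrite p1 p2 !expr0 !mul1r -!expRD; congr expR.
have p3 : 1 - s ^+ 2 != 0.
  have -> : 1 - s ^+ 2 = (1 - s) * (1 + s) by ring.
  by rewrite mulf_neq0 ?gt_eqF.
by field; rewrite p3 !gt_eqF.
Qed.

Lemma bump_out s : 1 <= `|s| -> bumpf s = 0.
Proof.
rewrite /bumpf /exp_inv lter_normr => /orP[s1|s1].
  by rewrite [0 < 1 - s]ltNge subr_le0 s1 /= !mulr0.
by rewrite [0 < 1 + s]ltNge -lerBrDl sub0r lerNr s1 /= mul0r mulr0.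
Qed.

Lemma bump0 : bumpf 0 = 1.
Proof. by rewrite bump_inE ?normr0 // expr0n /= subr0 divr1 subrr expR0. Qed.

Lemma bump_le1 s : bumpf s <= 1.
Proof.
have [s1|s1] := ltP `|s| 1; last by rewrite bump_out.
have p : 0 < 1 - s ^+ 2.
  by rewrite subr_gt0 -real_normK ?num_real // expr_lt1.
rewrite bump_inE // -[leRHS]expR0 ler_expR subr_le0 ler_pdivlMr //.
by have := sqr_ge0 s; lra.
Qed.

(** On this interval the exponent 2 - 2 / (1 - s^2) is at least -2/3. *)
Lemma bump_ge s : `|s| <= 2^-1 -> 3^-1 <= bumpf s.
Proof.
move=> sh; have s1 : `|s| < 1 by apply: le_lt_trans sh _; lra.
have s2 : s ^+ 2 <= 4^-1.
  rewrite -real_normK ?num_real //; have -> : 4^-1 = 2^-1 ^+ 2 :> R by field.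
  by rewrite ler_pXn2r ?nnegrE.
rewrite bump_inE //.
apply: le_trans (expR_ge1Dx _).
have p : 0 < 1 - s ^+ 2 by lra.
have : 2 / (1 - s ^+ 2) <= 8 / 3 by rewrite ler_pdivrMr //; lra.
lra.
Qed.

Lemma test_supported_bumpf : test_supported 1 (fun s => (bumpf s)%:C : C).
Proof.
split; last by move=> s /ltW /bump_out ->.
have -> : (fun s => (bumpf s)%:C) = (fun s => (expR 2)%:C *
   ((exp_inv 0 (1 * s + 1))%:C * (exp_inv 0 ((-1) * s + 1))%:C)) :> (R -> C).
  by apply/funext => s; rewrite /bumpf !complexRM mul1r mulN1r addrC [- s + 1]addrC.
apply: smoothM; first exact: smooth_cst.
by apply: smoothM; apply: (@smooth_comp_affine R (fun s => (exp_inv 0 s)%:C)); exact: smooth_exp_inv.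
Qed.

Lemma test_supported_bounded n (A : R) (f : R -> C) : test_supported A f ->
  exists2 K, 0 <= K & derivatives_bounded n (fun=> K) f.
Proof.
elim: n f => [|n IH] f tf.
  have [K K0 h] := ccontinuous_bounded (smooth_ccontinuous tf.1) tf.2.
  by exists K => // k x; rewrite leqn0 => /eqP ->.
have [K K0 h] := ccontinuous_bounded (smooth_ccontinuous tf.1) tf.2.
have [K' K'0 h'] := IH _ (test_supported_cD tf).
exists (K + K'); first by rewrite addr_ge0.
move=> [|k] x kn; first by apply: le_trans (h x) _; rewrite lerDl.
by rewrite iterSr; apply: le_trans (h' k x kn) _; rewrite lerDr.
Qed.

Lemma bump_lipschitz : exists2 K : R, 0 <= K & forall s, `|1 - bumpf s| <= K * `|s|.
Proof.
have tb := test_supported_bumpf.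
have [K K0 h] := test_supported_bounded 1 tb.
exists K => // s.
have := @cmvt_abs R (fun s => (bumpf s)%:C) (cD (fun s => (bumpf s)%:C)) K s 0.
rewrite bump0 sub0r normrN -rmorphB normcR; apply => x _.
  exact: (smooth_cder tb.1).
exact: (h 1%N).
Qed.

End bump_function.

(** * Fourier transforms of test functions *)

Lemma mulf_cross_cancel (F : fieldType) (u v w x y : F) : w != 0 -> v != 0 ->
  y * u / (w * v) * (w * x) = y * (u / v * x).
Proof. by move=> w0 v0; field; rewrite w0 v0. Qed.

Section exponential_taylor.
Variable R : realType.
Local Notation C := R[i].

(** The remainder of order n+1 has derivative z times the remainder of order n along the segment
  from 0 to z, so the bound follows by induction from the mean value inequality. *)
Lemma cexp_taylor (z : C) (n : nat) :
  normc (cexp z - \sum_(k < n) z ^+ k / k`!%:R) <= normc z ^+ n / n`!%:R * expR (normc z).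
Proof.
pose r n (t : R) : C := cexp (z * t%:C) - \sum_(k < n) (z ^+ k / k`!%:R) * (t ^+ k)%:C.
have dr m t : cder (r m.+1) t (z * r m t).
  have d1 : cder (fun t => cexp (z * t%:C)) t (z * cexp (z * t%:C)).
    by apply: cder_eq (cder_cexp (cderZ z (cder_id t))) _; rewrite mulr1.
  have d2 (k : 'I_m.+1) : cder (fun t => (z ^+ k / k`!%:R) * (t ^+ k)%:C) t
      ((z ^+ k / k`!%:R) * (k%:R * t ^+ k.-1)%:C).
    apply: cderZ; apply: cder_real.
    have := is_deriveX k (is_derive_id t (1 : R)).
    by rewrite exprfctE /GRing.scale /= mulr1.
  apply: cder_eq (cderB d1 (cder_sum (index_enum 'I_m.+1) d2)) _.
  rewrite /r mulrBr; congr (_ - _).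
  rewrite big_ord_recl /= mul0r mulr0 add0r mulr_sumr; apply: eq_bigr => k _ /=.
  rewrite /bump /= add1n add0n /= factS natrM exprS complexRM rmorph_nat.
  have a0 : k.+1%:R != 0 :> C by rewrite pnatr_eq0.
  have b0 : k`!%:R != 0 :> C by rewrite pnatr_eq0 -lt0n fact_gt0.
  exact: mulf_cross_cancel.
have key m t : 0 <= t -> t <= 1 ->
    normc (r m t) <= (expR (normc z) * (normc z ^+ m / m`!%:R)) * t ^+ m.
  elim: m t => [|m IH] t t0 t1.
    rewrite /r big_ord0 subr0 !expr0 fact0 divr1 !mulr1 normc_cexp ler_expR.
    apply: le_trans (Re_le_normc _) _; rewrite normcM normcR ger0_norm //.
    by rewrite ler_piMr // normc_ge0.
  have r0 : r m.+1 0 = 0.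
    rewrite /r mulr0 cexp0 big_ord_recl /= big1 ?addr0; last first.
      by move=> i _; rewrite /= expr0n /= mulr0.
    by rewrite expr0 fact0 divr1 mul1r expr0 subrr.
  rewrite -[r _ t]subr0 -r0.
  pose K : R := expR (normc z) * (normc z ^+ m.+1 / m.+1`!%:R).
  have -> : expR (normc z) * (normc z ^+ m.+1 / m.+1`!%:R) * t ^+ m.+1 =
     K * t ^+ m.+1 - K * 0 ^+ m.+1 by rewrite expr0n /= mulr0 subr0.
  have dG (s : R) : 0 <= s <= t -> is_derive s 1 (fun t => K * t ^+ m.+1) (K * (m.+1%:R * s ^+ m)).
    move=> _; have := is_deriveX m.+1 (is_derive_id s (1 : R)).
    rewrite exprfctE /GRing.scale /= mulr1 => h.
    exact: (is_deriveZ K h).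
  apply: (cmvt t0 (fun s _ => dr m s) dG) => s /andP[s0 st].
  rewrite normcM.
  apply: le_trans (ler_wpM2l (normc_ge0 z) (IH s s0 (le_trans st t1))) _.
  rewrite /K factS natrM exprS le_eqVlt; apply/orP; left; apply/eqP.
  rewrite -[RHS]mulrA mulf_cross_cancel ?pnatr_eq0 -?lt0n ?fact_gt0 //.
  by rewrite -mulrA mulrCA.
have := key n 1 ler01 (lexx 1); rewrite /r !mulr1 expr1n mulr1 [expR _ * _]mulrC.
by under eq_bigr do rewrite expr1n mulr1.
Qed.

Lemma cexp_sub1 (z : C) : normc (cexp z - 1) <= normc z * expR (normc z).
Proof.
have := cexp_taylor z 1; rewrite big_ord1 expr0 expr1 fact0 divr1.
by rewrite /factorial /= divr1.
Qed.

Lemma cexp_sub1_linear (z : C) :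
  normc (cexp z - 1 - z) <= normc z ^+ 2 / 2 * expR (normc z).
Proof.
have := cexp_taylor z 2.
by rewrite big_ord_recl big_ord1 /= expr0 expr1 !divr1 opprD addrA.
Qed.

Lemma cexp_sub1_imaginary (x : R) : normc (cexp (0 +i* x) - 1) <= `|x|.
Proof.
have := @cmvt_abs R (fun t => cexp (('i * x%:C) * t%:C)) (fun t => ('i * x%:C) * cexp (('i * x%:C) * t%:C)) `|x| 0 1.
rewrite mulr0 cexp0 mulr1 subr0 normr1 mulr1.
have -> : 'i * x%:C = 0 +i* x by apply: complex_ext => /=; ring.
apply => t _.
  by apply: cder_eq (cder_cexp (cderZ _ (cder_id t))) _; rewrite mulr1.
by rewrite normcM normc_i normc_cexp /= mul0r mulr0 subr0 expR0 mulr1.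
Qed.

End exponential_taylor.

Section fourier_of_test_functions.
Variable R : realType.
Local Notation C := R[i].
Implicit Types f g : R -> C.

Lemma fourier_kernelE (t x : R) : cexp (0 -i* (2 * pi * t * x)) = cexp ((0 -i* (2 * pi * t)) * x%:C) :> C.
Proof. by congr cexp; apply: complex_ext => /=; ring. Qed.

Lemma normc_fourier_kernel (t x : R) : normc (cexp (0 -i* (2 * pi * t * x)) : C) = 1.
Proof. by rewrite normc_cexp expR0. Qed.

Lemma smooth_fourier_kernel (t : R) : smooth (fun x => cexp (0 -i* (2 * pi * t * x)) : C).
Proof.
have -> : (fun x => cexp (0 -i* (2 * pi * t * x))) = (fun x => cexp ((0 -i* (2 * pi * t)) * x%:C)) :> (R -> C).
  by apply/funext => x; exact: fourier_kernelE.
exact: smooth_cexp.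
Qed.

Lemma test_supported_fourier_integrand A f t : test_supported A f ->
  test_supported A (fun x => cexp (0 -i* (2 * pi * t * x)) * f x).
Proof.
move=> [sf f0]; split; first exact: smoothM (smooth_fourier_kernel t) sf.
by move=> x /f0 ->; rewrite mulr0.
Qed.

Lemma normc_fourier_le A f (M : R) t : 0 <= A -> test_supported A f ->
  (forall x, normc (f x) <= M) -> normc (fourier f t) <= M * (2 * (A + 1)).
Proof.
move=> A0 tf fM; have tg := test_supported_fourier_integrand t tf.
apply: normc_cintegral_sup A0 (smooth_ccontinuous tg.1) tg.2 _ => x.
by rewrite normcM normc_fourier_kernel mul1r.
Qed.

(** Integration by parts against the exponential kernel. *)
Lemma fourier_cD A f t : test_supported A f ->
  fourier (cD f) t = (0 +i* (2 * pi * t)) * fourier f t.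
Proof.
move=> tf; have tg := test_supported_fourier_integrand t tf.
have tg' := test_supported_fourier_integrand t (test_supported_cD tf).
have := cintegral_derivative tg.2 (test_supported_cD tg).2
  (smooth_ccontinuous (test_supported_cD tg).1) (smooth_cder tg.1).
have -> : cD (fun x => cexp (0 -i* (2 * pi * t * x)) * f x) =
    (fun x => (0 -i* (2 * pi * t)) * (cexp (0 -i* (2 * pi * t * x)) * f x) +
       cexp (0 -i* (2 * pi * t * x)) * cD f x).
  apply: has_cder_cD => x.
  have d : cder (fun x => cexp (0 -i* (2 * pi * t * x)) : C) x ((0 -i* (2 * pi * t)) * cexp (0 -i* (2 * pi * t * x))).
    rewrite fourier_kernelE.
    apply: cder_eq (cder_ext _ (cder_cexp (cderZ (0 -i* (2 * pi * t)) (cder_id x)))) _.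
      by move=> y; rewrite fourier_kernelE.
    by rewrite mulr1.
  by apply: cder_eq (cderM d (smooth_cder tf.1 x)) _; rewrite -mulrA.
rewrite (cintegralD (A := A)).
- rewrite (cintegralZ _ (smooth_ccontinuous tg.1) tg.2) -/(fourier f t) -/(fourier (cD f) t).
  move=> /eqP; rewrite addrC addr_eq0 => /eqP ->; rewrite -mulNr; congr (_ * _).
  by apply: complex_ext; rewrite /= ?oppr0 ?opprK.
- by apply: ccontinuousM; [exact: ccontinuous_cst|exact: (smooth_ccontinuous tg.1)].
- exact: (smooth_ccontinuous tg'.1).
- by move=> x xA; rewrite tg.2 // mulr0.
- exact: tg'.2.
Qed.

Definition times_freq f : R -> C := fun x => f x * (0 -i* (2 * pi * x)).

Lemma test_supported_times_freq A f : test_supported A f -> test_supported A (times_freq f).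
Proof.
move=> tf; apply: test_supportedM tf _.
have -> : (fun x => 0 -i* (2 * pi * x)) = (fun x => (0 -i* (2 * pi)) * x%:C) :> (R -> C).
  by apply/funext => x; apply: complex_ext => /=; ring.
by apply: smoothM; [exact: smooth_cst|exact: smooth_id].
Qed.

(** Differentiation under the integral sign, from the quadratic Taylor bound of the kernel. *)
Lemma has_cder_fourier A f : 0 <= A -> test_supported A f ->
  has_cder (fourier f) (fourier (times_freq f)).
Proof.
move=> A0 tf t.
have ttf := test_supported_times_freq tf.
have [M M0 fM] := ccontinuous_bounded (smooth_ccontinuous tf.1) tf.2.
pose q := 2 * pi * A : R.
have q0 : 0 <= q by rewrite !mulr_ge0 ?pi_ge0.
apply: (@cder_quadratic _ _ _ _ ((q ^+ 2 / 2 * expR q * M) * (2 * (A + 1)))) => h h1.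
pose k (u x : R) : C := cexp (0 -i* (2 * pi * u * x)).
have -> : fourier f (h + t) - fourier f t - h%:C * fourier (times_freq f) t =
    cintegral (fun x => (k (h + t) x * f x + (-1) * (k t x * f x)) + (- h%:C) * (k t x * times_freq f x)).
  have [s1 v1] := test_supported_fourier_integrand (h + t) tf.
  have [s2 v2] := test_supported_fourier_integrand t tf.
  have [s3 v3] := test_supported_fourier_integrand t ttf.
  have c1 := smooth_ccontinuous s1; have c2 := smooth_ccontinuous s2; have c3 := smooth_ccontinuous s3.
  have s2' := smoothM (smooth_cst (-1)) s2; have s3' := smoothM (smooth_cst (- h%:C)) s3.
  rewrite (cintegralD (A := A) (smooth_ccontinuous (smoothD s1 s2')) (smooth_ccontinuous s3')).
  - rewrite (cintegralD (A := A) c1 (smooth_ccontinuous s2') v1).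
      rewrite (cintegralZ _ c2 v2) (cintegralZ _ c3 v3) /fourier /k; ring.
    by move=> x xA; rewrite v2 // mulr0.
  - by move=> x xA; rewrite v1 // v2 // mulr0 addr0.
  - by move=> x xA; rewrite v3 // mulr0.
have eF x : (k (h + t) x * f x + (-1) * (k t x * f x)) + (- h%:C) * (k t x * times_freq f x)
   = k t x * (cexp (0 -i* (2 * pi * h * x)) - 1 - (0 -i* (2 * pi * h * x))) * f x.
  have -> : k (h + t) x = k t x * cexp (0 -i* (2 * pi * h * x)).
    by rewrite /k -cexpD; congr cexp; apply: complex_ext => /=; ring.
  rewrite /times_freq.
  have -> : (0 -i* (2 * pi * h * x)) = h%:C * (0 -i* (2 * pi * x)) :> C.
    by apply: complex_ext => /=; ring.
  ring.
rewrite (_ : (fun x => _) = (fun x => k t x * (cexp (0 -i* (2 * pi * h * x)) - 1 - (0 -i* (2 * pi * h * x))) * f x)); last exact/funext.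
have v : vanishes_beyond A (fun x => k t x * (cexp (0 -i* (2 * pi * h * x)) - 1 - (0 -i* (2 * pi * h * x))) * f x).
  by move=> x /tf.2 ->; rewrite mulr0.
have -> : (q ^+ 2 / 2 * expR q * M) * (2 * (A + 1)) * h ^+ 2 =
   (q ^+ 2 / 2 * expR q * M * h ^+ 2) * (2 * (A + 1)) by ring.
apply: normc_cintegral_sup A0 _ v _.
  apply: ccontinuousM (smooth_ccontinuous tf.1).
  apply: ccontinuousM; first exact: (smooth_ccontinuous (smooth_fourier_kernel t)).
  apply: smooth_ccontinuous.
  have -> : (fun x => cexp (0 -i* (2 * pi * h * x)) - 1 - (0 -i* (2 * pi * h * x))) =
     (fun x => (cexp (0 -i* (2 * pi * h * x)) + (-1)) + (0 +i* (2 * pi * h)) * x%:C) :> (R -> C).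
    by apply/funext => x; congr (_ + _); apply: complex_ext => /=; ring.
  apply: smoothD; first by apply: smoothD; [exact: smooth_fourier_kernel|exact: smooth_cst].
  by apply: smoothM; [exact: smooth_cst|exact: smooth_id].
move=> x; have [xA|xA] := leP `|x| A; last first.
  rewrite tf.2 // mulr0 normc0.
  apply: mulr_ge0; last exact: sqr_ge0.
  apply: mulr_ge0 => //; apply: mulr_ge0; last exact: expR_ge0.
  by apply: mulr_ge0; [exact: sqr_ge0|rewrite invr_ge0].
rewrite normcM [normc (k t x * _)]normcM normc_fourier_kernel mul1r.
have nz : normc (0 -i* (2 * pi * h * x) : C) <= q * `|h|.
  rewrite normc_i normrN !normrM ger0_norm // (ger0_norm (pi_ge0 _)) /q.
  by rewrite -!mulrA [_ * `|h|]mulrC !ler_wpM2l ?pi_ge0.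
have nz1 : normc (0 -i* (2 * pi * h * x) : C) <= q.
  by apply: le_trans nz _; rewrite ler_piMr.
have tay := cexp_sub1_linear (0 -i* (2 * pi * h * x) : C).
have -> : q ^+ 2 / 2 * expR q * M * h ^+ 2 = ((q * `|h|) ^+ 2 / 2 * expR q) * M.
  by rewrite [(q * _) ^+ 2]exprMn real_normK ?num_real //; ring.
rewrite ler_pM ?normc_ge0 //; apply: le_trans tay _.
rewrite ler_pM ?expR_ge0 ?mulr_ge0 ?invr_ge0 ?exprn_ge0 ?normc_ge0 ?ler_expR //.
have qh0 : 0 <= q * `|h| := mulr_ge0 q0 (normr_ge0 h).
rewrite ler_wpM2r ?invr_ge0 // ler_pXn2r // nnegrE //; exact: normc_ge0.
Qed.

Lemma iter_cD_fourier A f n : 0 <= A -> test_supported A f ->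
  iter n (@cD R) (fourier f) = fourier (iter n times_freq f) /\ test_supported A (iter n times_freq f).
Proof.
move=> A0 tf; elim: n => [//|n [IH tn]]; split; last exact: test_supported_times_freq.
by rewrite iterS IH (has_cder_cD (has_cder_fourier A0 tn)).
Qed.

Lemma smooth_fourier A f : 0 <= A -> test_supported A f -> smooth (fourier f).
Proof.
move=> A0 tf; apply/smoothE => n.
rewrite iterS (iter_cD_fourier n A0 tf).1.
have h := has_cder_fourier A0 (iter_cD_fourier n A0 tf).2.
by rewrite (has_cder_cD h).
Qed.

(** Each derivative of f contributes one factor t to its transform. *)
Lemma fourier_decay A f m : 0 <= A -> test_supported A f ->
  exists2 K, 0 <= K & forall t, `|t| ^+ m * normc (fourier f t) <= K.
Proof.
move=> A0; elim: m f => [|m IH] f tf.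
  have [M M0 fM] := ccontinuous_bounded (smooth_ccontinuous tf.1) tf.2.
  exists (M * (2 * (A + 1))); first by rewrite !mulr_ge0 ?addr_ge0.
  by move=> t; rewrite expr0 mul1r; exact: normc_fourier_le.
have [K K0 h] := IH _ (test_supported_cD tf).
have p0 : 0 < 2 * pi :> R by rewrite mulr_gt0 ?pi_gt0.
exists (K / (2 * pi)); first by rewrite divr_ge0 // ltW.
move=> t; have := h t; rewrite (fourier_cD _ tf) normcM normc_i normrM (ger0_norm (ltW p0)).
rewrite ler_pdivlMr // exprSr => hh; apply: le_trans hh.
by rewrite le_eqVlt; apply/orP; left; apply/eqP; ring.
Qed.

Lemma fourier_derivatives_decay A f n m : 0 <= A -> test_supported A f ->
  exists2 K, 0 <= K & derivatives_bounded n (fun t => K / (1 + `|t| ^+ m)) (fourier f).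
Proof.
move=> A0 tf.
have one g : test_supported A g -> exists2 K, 0 <= K &
    forall t, normc (fourier g t) <= K / (1 + `|t| ^+ m).
  move=> tg; have [K K0 h] := fourier_decay m A0 tg; have [K' K'0 h'] := fourier_decay 0 A0 tg.
  exists (K + K'); first by rewrite addr_ge0.
  move=> t; rewrite ler_pdivlMr ?ltr_wpDr ?exprn_ge0 // mulrDr mulr1 addrC.
  by rewrite lerD // ?[_ * `|t| ^+ m]mulrC //; have := h' t; rewrite expr0 mul1r.
elim: n => [|n [K K0 IH]].
  have [K K0 h] := one f tf; exists K => // k x; rewrite leqn0 => /eqP ->; exact: h.
have [K' K'0 h] := one _ (iter_cD_fourier n.+1 A0 tf).2.
exists (K + K'); first by rewrite addr_ge0.
move=> k x; rewrite mulrDl leq_eqVlt => /orP[/eqP ->|kn].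
  rewrite (iter_cD_fourier n.+1 A0 tf).1; apply: le_trans (h x) _.
  by rewrite lerDr divr_ge0 // addr_ge0 // exprn_ge0.
apply: le_trans (IH k x kn) _.
by rewrite lerDl divr_ge0 // addr_ge0 // exprn_ge0.
Qed.

End fourier_of_test_functions.

(** * Point sets and polynomial growth of tempered measures *)

Lemma ler_exp_1D (R : realDomainType) (a : R) (m n : nat) : 0 <= a -> (m <= n)%N -> a ^+ m <= 1 + a ^+ n.
Proof.
move=> a0 mn; have [a1|/ltW a1] := leP a 1.
  by rewrite (le_trans (exprn_ile1 _ a0 a1)) // lerDl exprn_ge0.
by rewrite (le_trans (ler_weXn2l a1 mn)) // lerDr.
Qed.

Section truncated_point_sets.
Variable R : realType.
Local Notation C := R[i].
Implicit Types (S : set R) (A B : R).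

(** The points of S in [-A, A]: infinite sums over S are handled through these partial sums. *)
Definition pts S A : seq R := finmap.enum_fset (fset_set (S `&` `[- A, A])).

Lemma uniq_pts S A : uniq (pts S A).
Proof. exact: finmap.fset_uniq. Qed.

Lemma mem_pts S A x : locally_finite S -> (x \in pts S A) <-> (S x /\ `|x| <= A).
Proof.
move=> lf; rewrite /pts in_fset_set; last exact: lf.
by rewrite inE /= in_itv /= -ler_norml.
Qed.

Lemma big_pts_split (V : nmodType) S A B (F : R -> V) : locally_finite S -> A <= B ->
  \sum_(x <- pts S B) F x = \sum_(x <- pts S A) F x + \sum_(x <- pts S B | A < `|x|) F x.
Proof.
move=> lf AB; rewrite (bigID (fun x => `|x| <= A)) /=; congr (_ + _).
  rewrite -big_filter; apply: perm_big; apply: uniq_perm.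
  - by rewrite filter_uniq // uniq_pts.
  - exact: uniq_pts.
  - move=> x; rewrite mem_filter; apply/andP/idP => [[xA /(mem_pts _ _ lf)[Sx _]]|].
      exact/mem_pts.
    by move=> /(mem_pts _ _ lf)[Sx xA]; split => //; apply/mem_pts => //; split => //; exact: le_trans xA AB.
by apply: eq_bigl => x; rewrite ltNge.
Qed.

Lemma integral_atomicE (c : R -> C) (f : R -> C) A : locally_finite (atoms c) ->
  vanishes_beyond A f -> integral_atomic c f = \sum_(x <- pts (atoms c) A) c x * f x.
Proof.
move=> lf f0; rewrite /integral_atomic /pts.
rewrite -(@fsbig_widen _ _ _ _ (atoms c `&` `[- A, A]) (atoms c)) /=.
- by rewrite fsbig_finite //; exact: lf.
- by move=> x [].
- move=> x /= [cx nx]; rewrite f0 ?mulr0 // ltNge; apply/negP => xA; apply: nx.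
  by split => //=; rewrite in_itv /= -ler_norml.
Qed.

Lemma atoms_unit_masses S : atoms (@unit_masses R S) = S.
Proof.
apply/seteqP; split => x; rewrite /atoms /unit_masses /= indicE.
  have [xS _|xS] := boolP (x \in S); first by move: xS; rewrite inE.
  by rewrite eqxx.
by move=> Sx; rewrite mem_set //= eq_complex /= oner_eq0.
Qed.

Lemma unit_masses_in S x : S x -> unit_masses S x = 1.
Proof. by move=> Sx; rewrite /unit_masses indicE mem_set. Qed.

End truncated_point_sets.

Section tempered_growth.
Variable R : realType.
Local Notation C := R[i].

Lemma schwartz_seminorm_le (m n : nat) (f : R -> C) (B : R) :
  (forall x, `|x| ^+ m * normc (iter n (@cD R) f x) <= B) -> (schwartz_seminorm m n f <= B%:E)%E.
Proof.
move=> h; apply: ge_ereal_sup => _ [x _ <-]; rewrite lee_fin.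
by rewrite normcM normcX normcR cderivenE.
Qed.

Lemma test_supported_schwartz A (f : R -> C) : test_supported A f -> schwartz f.
Proof.
move=> tf; split; first exact: tf.1.
move=> m n; have [K K0 hK] := test_supported_bounded n tf.
apply: (@le_lt_trans _ _ (`|A| ^+ m * K)%:E); last exact: ltry.
apply: schwartz_seminorm_le => x.
have [xA|xA] := leP `|x| `|A|; first by rewrite ler_pM ?exprn_ge0 ?normc_ge0 ?hK // lerXn2r ?nnegrE.
have -> : iter n (@cD R) f x = 0.
  have [_ v] : test_supported A (iter n (@cD R) f).
    by elim: (n) => [//|k IH]; exact: test_supported_cD.
  by apply: v; exact: le_lt_trans (ler_norm _) xA.
by rewrite normc0 mulr0 mulr_ge0 ?exprn_ge0.
Qed.

Lemma fourier_schwartz A (f : R -> C) : 0 <= A -> test_supported A f -> schwartz (fourier f).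
Proof.
move=> A0 tf; split; first exact: smooth_fourier A0 tf.
move=> m n; have [K K0 hK] := fourier_derivatives_decay n m A0 tf.
apply: (@le_lt_trans _ _ K%:E); last exact: ltry.
apply: schwartz_seminorm_le => x; have := hK n x (leqnn n).
rewrite ler_pdivlMr ?ltr_wpDr ?exprn_ge0 // mulrDr mulr1 mulrC => h.
by apply: le_trans h; rewrite mulrC lerDr normc_ge0.
Qed.

Lemma tempered_distribution0 (T : (R -> C) -> C) : tempered_distribution T -> T (fun=> 0) = 0.
Proof.
move=> [lin _]; have s0 : schwartz (fun=> 0 : C).
  by apply: (@test_supported_schwartz 0); split; [exact: smooth_cst|].
have := lin 1 _ _ s0 s0; rewrite !mul1r.
rewrite (_ : (fun x : R => 0 + 0) = (fun=> 0 : C)); last first.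
  by apply/funext => x; rewrite addr0.
by move=> /eqP; rewrite -subr_eq0 opprD addrA subrr add0r oppr_eq0 => /eqP.
Qed.

(** A positive measure is bounded by testing it against dilates of a bump that is at least 1/3
  on [-N, N]: their Schwartz seminorms grow polynomially in the dilation factor. *)
Lemma tempered_growth (T : (R -> C) -> C) (c : R -> C) : tempered_distribution T ->
  agrees_with_measure T c -> locally_finite (atoms c) -> (forall x, c x = (normc (c x))%:C) ->
  exists (K : R) (M : nat), 0 <= K /\
    forall N : nat, \sum_(x <- pts (atoms c) N%:R) normc (c x) <= K * N.+1%:R ^+ M.
Proof.
move=> TT aT lf cnn.
have [_ /(_ (fun=> 0)) ct] := TT.
have s0 : schwartz (fun=> 0 : C).
  by apply: (@test_supported_schwartz 0); split; [exact: smooth_cst|].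
have [N0 [d d0 hd]] := ct s0 1 ltr01.
have [B B0 hB] := test_supported_bounded N0 (@test_supported_bumpf R).
exists (6 * (B + 1) * 2 ^+ N0 / d), N0; split.
  by rewrite divr_ge0 ?(ltW d0) // !mulr_ge0 ?addr_ge0 ?exprn_ge0.
move=> N; have [r rE] : exists r : R, r = 2 * N.+1%:R by eexists.
have r1 : 1 <= r by rewrite rE -natrM ler1n.
have r0 : 0 < r := lt_le_trans ltr01 r1.
(* This scaling brings the dilated bump into the neighbourhood of 0 on which |T| < 1. *)
have [k kE] : exists k : R, k = d / (2 * (B + 1) * r ^+ N0) by eexists.
have k0 : 0 < k.
  by rewrite kE divr_gt0 // !mulr_gt0 ?exprn_gt0 // ltr_wpDl.
pose b (s : R) : C := (bumpf s)%:C.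
have sb : smooth b by have [] := @test_supported_bumpf R.
pose g (x : R) : C := k%:C * b (r^-1 * x).
have ssc : smooth (fun x => b (r^-1 * x)).
  have -> : (fun x => b (r^-1 * x)) = (fun x => b (r^-1 * x + 0)).
    by apply/funext => x; rewrite addr0.
  exact: smooth_comp_affine.
have tg : test_supported r g.
  split; first by apply: smoothM ssc; exact: smooth_cst.
  move=> x xr; rewrite /g /b bump_out ?mulr0 // normrM gtr0_norm ?invr_gt0 //.
  by rewrite mulrC ler_pdivlMr // mul1r ltW.
have nT : normc (T g) < 1.
  rewrite -[T g]subr0 -(tempered_distribution0 TT); apply: hd.
    exact: test_supported_schwartz tg.
  move=> m n mN nN; apply: (@le_lt_trans _ _ (d / 2)%:E); last by rewrite lte_fin; lra.
  apply: schwartz_seminorm_le => x.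
  rewrite (_ : (fun x => g x - 0) = g); last by apply/funext => y; rewrite subr0.
  have -> : iter n (@cD R) g x = (k * r^-1 ^+ n)%:C * iter n (@cD R) b (r^-1 * x).
    by rewrite /g (iter_cDZ _ _ ssc) (iter_cD_comp_scale n r^-1 sb) complexRM mulrA.
  have -> : d / 2 = k * r ^+ N0 * (B + 1).
    by rewrite kE; field; rewrite ?expf_neq0 ?gt_eqF // ltr_wpDl.
  have kr : 0 <= k * r^-1 ^+ n by rewrite mulr_ge0 ?exprn_ge0 ?invr_ge0 ?(ltW k0) ?(ltW r0).
  rewrite normcM normcR (ger0_norm kr).
  have [xr|xr] := leP `|x| r; last first.
    have -> : iter n (@cD R) b (r^-1 * x) = 0.
      have [_ v] : test_supported 1 (iter n (@cD R) b).
        by elim: (n) => [|j IH]; [exact: test_supported_bumpf|exact: test_supported_cD].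
      apply: v; rewrite normrM gtr0_norm ?invr_gt0 // mulrC ltr_pdivlMr // mul1r //.
    by rewrite normc0 !mulr0 !mulr_ge0 ?addr_ge0 ?exprn_ge0 ?(ltW k0) ?(ltW r0).
  rewrite mulrA; apply: ler_pM; rewrite ?normc_ge0 //.
  - by rewrite !mulr_ge0 ?exprn_ge0 ?invr_ge0 // ltW.
  - rewrite mulrCA ler_wpM2l ?(ltW k0) //.
    apply: (@le_trans _ _ (`|x| ^+ m)).
      by rewrite ler_piMr ?exprn_ge0 // exprn_ile1 ?invr_ge0 ?(ltW r0) // invf_le1.
    apply: (@le_trans _ _ (r ^+ m)); first by rewrite lerXn2r ?nnegrE // ltW.
    exact: ler_weXn2l.
  - by apply: le_trans (hB n _ nN) _; rewrite lerDl.
have eT : T g = (\sum_(x <- pts (atoms c) r) normc (c x) * (k * bumpf (r^-1 * x)))%:C.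
  rewrite aT; last exact: test_supported_test tg.
  rewrite (integral_atomicE lf tg.2) rmorph_sum /=; apply: eq_bigr => x _.
  by rewrite cnn /g /b -!complexRM normcR ger0_norm ?normc_ge0.
have nn (x : R) : 0 <= normc (c x) * (k * bumpf (r^-1 * x)).
  by apply: mulr_ge0; [exact: normc_ge0|apply: mulr_ge0; [exact: ltW|exact: bump_ge0]].
have : \sum_(x <- pts (atoms c) N%:R) normc (c x) * (k / 3) <= 1.
  apply: le_trans (ltW nT); rewrite eT normcR ger0_norm; last by apply: sumr_ge0.
  have Nr : N%:R <= r by rewrite rE -natrM ler_nat mul2n -addnn; lia.
  rewrite (big_pts_split _ lf Nr) -[leLHS]addr0 lerD //; last exact: sumr_ge0.
  rewrite big_seq [leRHS]big_seq; apply: ler_sum => x /(mem_pts _ _ lf)[_ xN].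
  rewrite ler_wpM2l ?normc_ge0 // ler_wpM2l ?(ltW k0) // bump_ge //.
  rewrite normrM gtr0_norm ?invr_gt0 // mulrC ler_pdivrMr // rE mulKf //.
  by apply: le_trans xN _; rewrite ler_nat.
rewrite -mulr_suml -ler_pdivlMr ?divr_gt0 // div1r => h; apply: le_trans h _.
rewrite le_eqVlt; apply/orP; left; apply/eqP.
rewrite kE rE exprMn; field; rewrite !expf_neq0 ?gt_eqF //=; last by rewrite ltr_wpDl.
Qed.

End tempered_growth.

(** * The summation formula *)

Section poisson_summation.
Variable R : realType.
Local Notation C := R[i].
Implicit Types (S : set R).

Lemma complexRB1 (x : R) : x%:C - 1 = (x - 1)%:C :> C.
Proof. by apply: complex_ext => //=; rewrite subr0. Qed.

Lemma ex_nat_ge (x : R) : exists n : nat, forall N, (n <= N)%N -> x <= N%:R.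
Proof.
exists (Num.bound `|x|) => N nN; apply: le_trans (ler_norm x) _.
by apply: le_trans (ltW (archi_boundP (normr_ge0 x))) _; rewrite ler_nat.
Qed.

(** Comparison with the telescoping sequence 1 - 1/N. *)
Lemma inverse_square_increments (u : nat -> R) (K : R) : 0 <= K ->
  (forall N, u N.+2 <= u N.+1 + K / N.+1%:R ^+ 2) -> forall N, u N.+1 <= u 1%N + 2 * K.
Proof.
move=> K0 h N.
suff : u N.+1 <= u 1%N + 2 * K * (1 - N.+1%:R^-1).
  move=> /le_trans; apply; rewrite lerD2l; apply: ler_piMr; first by rewrite mulr_ge0.
  by rewrite lerBlDr lerDl invr_ge0.
elim: N => [|N IH]; first by rewrite invr1 subrr mulr0 addr0.
apply: le_trans (h N) _; apply: le_trans (lerD IH (lexx _)) _.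
rewrite -addrA lerD2l -subr_ge0.
have p : 0 < N.+1%:R :> R by rewrite ltr0n.
have -> : N.+2%:R = N.+1%:R + 1 :> R by rewrite -natr1.
set x : R := N.+1%:R in p *.
have x1 : 1 <= x by rewrite /x ler1n.
have -> : 2 * K * (1 - (x + 1)^-1) - (2 * K * (1 - x^-1) + K / x ^+ 2) =
  K * ((x - 1) / (x ^+ 2 * (x + 1))).
  by field; rewrite !gt_eqF // ltr_wpDr.
by rewrite mulr_ge0 // divr_ge0 ?subr_ge0 // mulr_ge0 ?exprn_ge0 // addr_ge0 // ltW.
Qed.

Lemma bounded_from_one (u : nat -> R) (K : R) : (forall N, u N <= u N.+1) ->
  (forall N, u N.+1 <= K) -> forall N, u N <= K.
Proof. by move=> m h [|N] //; exact: le_trans (m 0%N) (h 0%N). Qed.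

Lemma big_pts_nondecreasing S (F : R -> R) : locally_finite S -> (forall x, 0 <= F x) ->
  forall N, \sum_(x <- pts S N%:R) F x <= \sum_(x <- pts S N.+1%:R) F x.
Proof.
move=> lf F0 N; rewrite (@big_pts_split _ _ S N%:R N.+1%:R) ?ler_nat //.
by rewrite lerDl sumr_ge0.
Qed.

Lemma big_pts_weight_bounded S (c : R -> R) (K : R) (M : nat) : locally_finite S ->
  (forall x, 0 <= c x) -> 0 <= K ->
  (forall N : nat, \sum_(x <- pts S N%:R) c x <= K * N.+1%:R ^+ M) ->
  exists2 K', 0 <= K' & forall N : nat, \sum_(x <- pts S N%:R) c x / (1 + `|x| ^+ M.+2) <= K'.
Proof.
move=> lf c0 K0 gr.
pose u N := \sum_(x <- pts S N%:R) c x / (1 + `|x| ^+ M.+2).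
have wp x : 0 < 1 + `|x| ^+ M.+2 :> R by rewrite ltr_wpDr ?exprn_ge0.
have u0 N : 0 <= u N by apply: sumr_ge0 => x _; rewrite divr_ge0 // ltW.
have K30 : 0 <= K * 3 ^+ M by rewrite mulr_ge0 ?exprn_ge0.
exists (u 1%N + 2 * (K * 3 ^+ M)); first by rewrite addr_ge0 // mulr_ge0.
apply: (@bounded_from_one u).
  by apply: big_pts_nondecreasing => // x; rewrite divr_ge0 // ltW.
apply: inverse_square_increments => // N.
rewrite /u (@big_pts_split _ _ S N.+1%:R N.+2%:R) ?ler_nat // lerD2l.
have p : 0 < N.+1%:R :> R by rewrite ltr0n.
apply: (@le_trans _ _ (\sum_(x <- pts S N.+2%:R | N.+1%:R < `|x|) c x * (N.+1%:R ^+ M.+2)^-1)).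
  apply: ler_sum => x xN; rewrite ler_wpM2l // lef_pV2 ?posrE ?exprn_gt0 //.
  apply: (@le_trans _ _ (`|x| ^+ M.+2)); last by rewrite lerDr.
  by rewrite lerXn2r ?nnegrE ?(ltW p) ?(ltW xN) ?normr_ge0.
rewrite -mulr_suml ler_pdivrMr ?exprn_gt0 //.
apply: (@le_trans _ _ (K * N.+3%:R ^+ M)).
  apply: le_trans (gr N.+2); rewrite [leRHS](bigID (fun x => N.+1%:R < `|x|)) /=.
  by rewrite lerDl sumr_ge0.
have -> : M.+2 = (2 + M)%N by [].
rewrite exprD mulrA divfK ?expf_neq0 ?gt_eqF // -mulrA ler_wpM2l // -exprMn lerXn2r ?nnegrE ?mulr_ge0 //.
by rewrite -natrM ler_nat; lia.
Qed.

(** As r grows, the cut-off bump(x/r) tends to 1 with all its derivatives, at rate 1/r, if a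
  linear weight in x is allowed. *)
Lemma cutoff_derivatives_bounded n : exists2 K : R, 0 <= K & forall r : R, 1 <= r ->
  derivatives_bounded n (fun x => K * (1 + `|x|) / r) (fun x => (bumpf (r^-1 * x))%:C - 1).
Proof.
have [L L0 hL] := @bump_lipschitz R.
have [B B0 hB] := test_supported_bounded n (@test_supported_bumpf R).
exists (L + B); first by rewrite addr_ge0.
move=> r r1 k x kn; have r0 : 0 < r := lt_le_trans ltr01 r1.
have sb : smooth (fun s : R => (bumpf s)%:C) by have [] := @test_supported_bumpf R.
have ssc : smooth (fun x => (bumpf (r^-1 * x))%:C).
  have -> : (fun x => (bumpf (r^-1 * x))%:C) = (fun x => (bumpf (r^-1 * x + 0))%:C).
    by apply/funext => y; rewrite addr0.
  exact: (@smooth_comp_affine R (fun s => (bumpf s)%:C)).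
case: k kn => [_|k kn].
  rewrite -[iter _ _ _ _]/((bumpf (r^-1 * x))%:C - 1) complexRB1 normcR distrC; apply: le_trans (hL _) _.
  rewrite normrM gtr0_norm ?invr_gt0 // mulrA mulrAC ler_wpM2r ?invr_ge0 ?(ltW r0) //.
  by apply: ler_pM => //; [rewrite lerDl|rewrite lerDr].
have -> : iter k.+1 (@cD R) (fun x => (bumpf (r^-1 * x))%:C - 1) = iter k.+1 (@cD R) (fun x => (bumpf (r^-1 * x))%:C).
  rewrite !iterSr; congr iter; apply: has_cder_cD => y.
  by apply: cder_eq (cderB (smooth_cder ssc y) (cder_cst 1 y)) _; rewrite subr0.
rewrite (iter_cD_comp_scale k.+1 (r^-1) sb) normcM normcR.
rewrite ger0_norm; last by rewrite exprn_ge0 ?invr_ge0 ?(ltW r0).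
rewrite mulrC ler_pM ?normc_ge0 ?exprn_ge0 ?invr_ge0 ?(ltW r0) //.
  apply: le_trans (hB _ _ kn) _; apply: (@le_trans _ _ (L + B)); first by rewrite lerDr.
  by rewrite ler_peMr ?addr_ge0 // lerDl.
by rewrite exprS ler_piMr ?invr_ge0 ?(ltW r0) // exprn_ile1 ?invr_ge0 ?(ltW r0) // invf_le1.
Qed.

(** The distribution sees the point masses only through compactly supported functions.  The
  transform of a test function is the limit, in the Schwartz topology, of its products with wide
  cut-offs, for which the distribution is a finite sum; polynomial growth of S controls the tails. *)
Lemma poisson_summation S (T : (R -> C) -> C) (a f : R -> C) (A K : R) (M : nat) :
  locally_finite S -> tempered_distribution T -> agrees_with_measure T (unit_masses S) ->
  agrees_with_measure (fourier_distribution T) a -> 0 <= K ->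
  (forall N : nat, \sum_(x <- pts S N%:R) 1 <= K * N.+1%:R ^+ M) ->
  0 <= A -> test_supported A f ->
  forall e : R, 0 < e -> exists N0, forall N, (N0 <= N)%N ->
    normc (\sum_(l <- pts S N%:R) fourier f l - integral_atomic a f) <= e.
Proof.
move=> lf TT TS Ta K0 gr A0 tf e e0.
have [K1 K10 w1] := @big_pts_weight_bounded S (fun=> 1) K M lf (fun=> ler01) K0 gr.
rewrite -(Ta _ (test_supported_test tf)) /fourier_distribution.
have sF := fourier_schwartz A0 tf.
have [_ /(_ _ sF (e / 2))] := TT; rewrite divr_gt0 // => /(_ isT) [N0 [d d0 hd]].
have [Kc Kc0 hc] := cutoff_derivatives_bounded N0.
have [K2 K20 h2] := fourier_derivatives_decay N0 N0.+1 A0 tf.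
have [L L0 hL] := @bump_lipschitz R.
have [K3 K30 h3] := fourier_derivatives_decay 0 M.+3 A0 tf.
(* Q1/r bounds the Schwartz seminorms of the error of the cut-off at radius r, and Q2/r the
   effect of the cut-off on the sum. *)
have [Q1 Q1E] : exists Q1 : R, Q1 = 2 ^+ N0 * Kc * K2 * 2 by eexists.
have [Q2 Q2E] : exists Q2 : R, Q2 = L * K3 * 2 * K1 by eexists.
have Q10 : 0 <= Q1 by rewrite Q1E !mulr_ge0 // exprn_ge0.
have Q20 : 0 <= Q2 by rewrite Q2E !mulr_ge0.
have [N1 hN1] := ex_nat_ge (Q1 * 2 / d + Q2 * 2 / e + 1).
exists N1 => N /hN1 rN.
have r1 : 1 <= N%:R :> R.
  by apply: le_trans rN; rewrite lerDr addr_ge0 // divr_ge0 ?mulr_ge0 // ltW.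
move: rN r1; have [r rE] : exists r : R, r = N%:R by eexists.
rewrite -rE => rN r1; have r0 : 0 < r := lt_le_trans ltr01 r1.
have rd : Q1 * 2 / d <= r.
  by apply: le_trans rN; rewrite -addrA lerDl addr_ge0 // divr_ge0 ?mulr_ge0 // ltW.
have re : Q2 * 2 / e <= r.
  by apply: le_trans rN; rewrite addrAC lerDr addr_ge0 // divr_ge0 ?mulr_ge0 // ltW.
pose b (x : R) : C := (bumpf (r^-1 * x))%:C.
have ssc : smooth b.
  have -> : b = (fun x => (bumpf (r^-1 * x + 0))%:C).
    by apply/funext => y; rewrite addr0.
  by apply: (@smooth_comp_affine R (fun s => (bumpf s)%:C)); have [] := @test_supported_bumpf R.
pose g x : C := b x * fourier f x.
have tg : test_supported r g.
  apply: test_supportedM sF.1; split => // x xr.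
  rewrite /b bump_out // normrM gtr0_norm ?invr_gt0 //.
  by rewrite mulrC ler_pdivlMr // mul1r ltW.
have close : normc (T g - T (fourier f)) < e / 2.
  apply: hd; first exact: test_supported_schwartz tg.
  move=> m n mN nN; apply: (@le_lt_trans _ _ (Q1 / r)%:E); last first.
    rewrite lte_fin ltr_pdivrMr //; apply: (@lt_le_trans _ _ (d * (Q1 * 2 / d + 1))).
      rewrite mulrDr mulr1 mulrCA divff ?gt_eqF // mulr1; lra.
    rewrite ler_wpM2l ?(ltW d0) //; apply: le_trans rN.
    by rewrite lerD2r lerDl divr_ge0 ?mulr_ge0 // ltW.
  apply: schwartz_seminorm_le => x.
  have -> : (fun x => g x - fourier f x) = (fun x => (b x - 1) * fourier f x).
    by apply/funext => y; rewrite mulrBl mul1r.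
  have sb1 : smooth (fun x => b x - 1) by apply: smoothD ssc (smooth_cst (-1)).
  have := derivatives_boundedM sb1 sF.1 (hc r r1) h2.
  move=> /(_ n x nN) h.
  apply: le_trans (ler_wpM2l (exprn_ge0 m (normr_ge0 x)) h) _.
  have wp : 0 < 1 + `|x| ^+ N0.+1 :> R by rewrite ltr_wpDr ?exprn_ge0.
  have -> : `|x| ^+ m * (2 ^+ N0 * (Kc * (1 + `|x|) / r * (K2 / (1 + `|x| ^+ N0.+1)))) =
     (2 ^+ N0 * Kc * K2) * (`|x| ^+ m * (1 + `|x|)) / (1 + `|x| ^+ N0.+1) / r.
    by field; rewrite !gt_eqF.
  rewrite ler_wpM2r ?invr_ge0 ?(ltW r0) // ler_pdivrMr // Q1E -[leRHS]mulrA.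
  rewrite ler_wpM2l ?mulr_ge0 ?exprn_ge0 // mulrDr mulr1 -exprSr mulr2n mulrDl !mul1r.
  by rewrite lerD // ler_exp_1D // leqW.
have eT : T g = \sum_(l <- pts S r) b l * fourier f l.
  rewrite TS; last exact: test_supported_test tg.
  rewrite (@integral_atomicE _ _ _ r) ?atoms_unit_masses //; last exact: tg.2.
  rewrite big_seq [RHS]big_seq; apply: eq_bigr => l /(mem_pts _ _ lf)[Sl _].
  by rewrite unit_masses_in // mul1r.
have near_sum : normc (\sum_(l <- pts S r) fourier f l - T g) <= e / 2.
  rewrite eT -sumrB; apply: le_trans (normc_sum _ _ _) _.
  apply: (@le_trans _ _ (\sum_(l <- pts S r) (L * K3 * 2 / r) * (1 / (1 + `|l| ^+ M.+2)))).
    apply: ler_sum => l _.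
    have -> : fourier f l - b l * fourier f l = ((1 - bumpf (r^-1 * l))%:C) * fourier f l.
      by rewrite rmorphB /b; ring.
    rewrite normcM normcR.
    apply: (@le_trans _ _ ((L * `|r^-1 * l|) * (K3 / (1 + `|l| ^+ M.+3)))).
      by apply: (ler_pM (normr_ge0 _) (normc_ge0 _) (hL _)); exact: (h3 0%N).
    have wp k : 0 < 1 + `|l| ^+ k :> R by rewrite ltr_wpDr ?exprn_ge0.
    rewrite normrM gtr0_norm ?invr_gt0 //.
    have -> : L * (r^-1 * `|l|) * (K3 / (1 + `|l| ^+ M.+3)) = (L * K3 / r) * (`|l| / (1 + `|l| ^+ M.+3)).
      by field; rewrite !gt_eqF.
    have -> : L * K3 * 2 / r * (1 / (1 + `|l| ^+ M.+2)) = (L * K3 / r) * (2 / (1 + `|l| ^+ M.+2)).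
      by field; rewrite !gt_eqF.
    rewrite ler_wpM2l ?mulr_ge0 ?invr_ge0 ?(ltW r0) //.
    rewrite ler_pdivrMr // mulrAC ler_pdivlMr // mulrDr mulr1 -exprS mulr2n mulrDl !mul1r.
    apply: lerD; last by rewrite lerDr.
    by have := @ler_exp_1D _ _ 1 M.+3 (normr_ge0 l) isT; rewrite expr1.
  rewrite -mulr_sumr rE; apply: le_trans (ler_wpM2l _ (w1 N)) _.
    by rewrite -rE mulr_ge0 ?invr_ge0 ?(ltW r0) // !mulr_ge0.
  move: re; rewrite ler_pdivrMr // => re; rewrite -rE mulrAC -Q2E ler_pdivrMr //; move: re; clear; lra.
have -> : \sum_(l <- pts S r) fourier f l - T (fourier f) =
  (\sum_(l <- pts S r) fourier f l - T g) + (T g - T (fourier f)) by ring.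
by apply: le_trans (normcD _ _) _; move: (ltW close) near_sum; clear; lra.
Qed.

End poisson_summation.

(** * A mean square bound for the points of the measure *)

Local Opaque cexp.

Section density.
Variable R : realType.
Local Notation C := R[i].
Local Notation Re := (@complex.Re R).
Local Notation Im := (@complex.Im R).
Implicit Types (S : set R) (f : R -> C).

Lemma normc_cintegral_le_const f (M A B : R) : 0 <= A -> A < B -> ccontinuous f ->
  vanishes_beyond A f -> (forall x, normc (f x) <= M) ->
  normc (cintegral f) <= M * (2 * B).
Proof.
move=> A0 AB cf f0 le.
have dG (x : R) : `|x| <= B -> is_derive x 1 (fun x => M * x) M.
  move=> _; apply: is_derive_eq (is_deriveZ M (is_derive_id x 1)) _.
  by rewrite /GRing.scale /= mulr1.
have := normc_cintegral_le cf f0 AB (ltW (le_lt_trans A0 AB)) dG (fun x _ => le x).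
by move=> /le_trans; apply; rewrite le_eqVlt; apply/orP; left; apply/eqP; ring.
Qed.

Lemma cintegral_shift (u A : R) f : smooth f -> vanishes_beyond A f ->
  cintegral (fun s => f (s + u)) = cintegral f.
Proof.
move=> sf f0; have cf := smooth_ccontinuous sf.
have [F dF eF] := cintegral_primitive cf f0.
have dFu x : cder (fun s => F (s + u)) x (f (x + u)).
  have h : is_derive x 1 (fun s : R => s + u) (1 : R).
    by apply: is_derive_eq (is_deriveD (is_derive_id x 1) (is_derive_cst u x 1)) _; rewrite addr0.
  by apply: cder_eq (@cder_comp _ F (fun s => s + u) x _ _ (dF (x + u)) h) _; rewrite mulr1.
have Au : A + `|u| < `|A| + `|u| + 1.
  by have := ler_norm A; lra.
have cfu : ccontinuous (fun s => f (s + u)).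
  have -> : (fun s => f (s + u)) = (fun s => f (1 * s + u)) by apply/funext => s; rewrite mul1r.
  by apply: smooth_ccontinuous; exact: smooth_comp_affine.
have fu0 : vanishes_beyond (A + `|u|) (fun s => f (s + u)).
  move=> x xA; apply: f0; have := ler_normD (x + u) (- u).
  by rewrite addrK normrN; lra.
rewrite (cintegral_eq fu0 Au cfu dFu).
have AA : A < `|A| + 1 by have := ler_norm A; lra.
rewrite (eF _ AA).
have dF0 a b : a <= b -> (forall x, a <= x <= b -> f x = 0) -> F a = F b.
  move=> ab z; apply/eqP; rewrite -subr_eq0 -normc_eq0 eq_le normc_ge0 andbT.
  have := @cmvt_abs _ F f 0 b a; rewrite mul0r; apply => x.
    by move=> _; exact: dF.
  by rewrite min_r // max_l // => /z ->; rewrite normc0.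
have nA := ler_norm A; have nu := ler_norm u; have nu' := ler_norm (- u); rewrite normrN in nu'.
congr (_ - _).
  symmetry; apply: dF0; first lra.
  move=> x /andP[x1 x2]; apply: f0; apply: lt_le_trans (ler_norm x); lra.
apply: dF0; first lra.
move=> x /andP[x1 x2]; apply: f0; rewrite -normrN; apply: lt_le_trans (ler_norm (- x)); lra.
Qed.

Lemma fourier_shift (u A : R) f t : test_supported A f ->
  fourier (fun s => f (s + u)) t = cexp (0 +i* (2 * pi * t * u)) * fourier f t.
Proof.
move=> tf; have tg := test_supported_fourier_integrand t tf.
rewrite -(cintegralZ _ (smooth_ccontinuous tg.1) tg.2).
rewrite -(@cintegral_shift u A (fun x => cexp (0 +i* (2 * pi * t * u)) * _)).
- congr cintegral; apply/funext => s; rewrite mulrA -cexpD; congr (cexp _ * _).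
  by apply: complex_ext => /=; ring.
- by apply: smoothM tg.1; exact: smooth_cst.
- by move=> x xA; rewrite tg.2 // mulr0.
Qed.

Lemma cintegral_sum (I : Type) (r : seq I) (F : I -> R -> C) (A : R) :
  (forall i, test_supported A (F i)) ->
  cintegral (fun u => \sum_(i <- r) F i u) = \sum_(i <- r) cintegral (F i).
Proof.
move=> tF.
suff [_ ->] : test_supported A (fun u => \sum_(i <- r) F i u) /\
   cintegral (fun u => \sum_(i <- r) F i u) = \sum_(i <- r) cintegral (F i) by [].
elim: r => [|i r [[s v] IH]].
  rewrite big_nil; have -> : (fun u => \sum_(i <- [::]) F i u) = (fun=> 0).
    by apply/funext => u; rewrite big_nil.
  split; first by split; [exact: smooth_cst|].
  have cc : ccontinuous (fun=> 0 : C) by exact: ccontinuous_cst.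
  have := @cintegralZ R 0 (fun=> 0) 0 cc (fun _ _ => erefl); by rewrite !mul0r.
have -> : (fun u => \sum_(i <- i :: r) F i u) = (fun u => F i u + \sum_(i <- r) F i u).
  by apply/funext => u; rewrite big_cons.
have [si vi] := tF i.
split.
  by split; [exact: smoothD|move=> x xA; rewrite vi // v // addr0].
rewrite (cintegralD (A := A)) ?IH ?big_cons //; exact: smooth_ccontinuous.
Qed.

Lemma conjc_mul (z w : C) : conjc (z * w) = conjc z * conjc w.
Proof. exact: rmorphM. Qed.

Lemma Im_conjc (z : C) : Im (conjc z) = - Im z. Proof. by case: z. Qed.

Lemma cintegral_conjc f (A : R) : ccontinuous f -> vanishes_beyond A f ->
  cintegral (fun x => conjc (f x)) = conjc (cintegral f).
Proof.
move=> cf f0; have [F dF eF] := cintegral_primitive cf f0.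
have AA : A < A + 1 by rewrite ltrDl.
rewrite (eF _ AA) (@cintegral_eq _ _ (fun x => conjc (F x)) A (A + 1)) //.
- by rewrite rmorphB.
- by move=> x /f0 ->; rewrite rmorph0.
- have [c1 c2] := cf; split => x.
    have -> : Re \o (fun x => conjc (f x)) = Re \o f by apply/funext => y /=; case: (f y).
    exact: c1.
  have -> : Im \o (fun x => conjc (f x)) = - (Im \o f) by apply/funext => y; exact: Im_conjc.
  by apply: continuousN; exact: c2.
- move=> x; have [d1 d2] := dF x; split.
    have -> : Re \o (fun x => conjc (F x)) = Re \o F by apply/funext => y /=; case: (F y).
    by move: d1; case: (f x).
  have -> : Im \o (fun x => conjc (F x)) = - (Im \o F) by apply/funext => y; exact: Im_conjc.
  rewrite Im_conjc.
  exact: is_deriveN.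
Qed.

Lemma nondecreasing_cauchy (u : nat -> R) (K : R) : (forall N, u N <= u N.+1) ->
  (forall N, u N <= K) -> exists2 l : R, (forall N, u N <= l) &
  forall e, 0 < e -> exists N0, forall N, (N0 <= N)%N -> l - u N <= e.
Proof.
move=> m b; have nd : nondecreasing_seq u by apply/nondecreasing_seqP.
have ub : has_ubound (range u) by exists K => _ [n _ <-].
have cu := nondecreasing_is_cvgn nd ub.
exists (limn u); first exact: nondecreasing_cvgn_le.
move=> e e0; have /cvgrPdist_le /(_ e e0) [N0 _ h] := cu.
by exists N0 => N /h /=; apply: le_trans; exact: ler_norm.
Qed.

(** Positivity argument.  Write f for g modulated by the frequency x.  Applied to the translate of
  f by u, the summation formula bounds, uniformly in x and u, the exponential sum with
  coefficients f^(l): only the atoms of a in [-2A, 2A] occur on the spectral side, whatever x.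
  Averaging this exponential sum against the conjugate of f produces the sum of the squares
  |f^(l)|^2. *)
Lemma sum_square_fourier_bounded S (T : (R -> C) -> C) (a : R -> C) (g : R -> R) (A K : R) (M : nat) :
  locally_finite S -> locally_finite (atoms a) ->
  tempered_distribution T -> agrees_with_measure T (unit_masses S) ->
  agrees_with_measure (fourier_distribution T) a -> 0 <= K ->
  (forall N : nat, \sum_(x <- pts S N%:R) 1 <= K * N.+1%:R ^+ M) ->
  0 <= A -> test_supported A (fun s => (g s)%:C) -> (forall s, 0 <= g s <= 1) ->
  exists2 B : R, 0 <= B & forall x (N : nat),
    \sum_(l <- pts S N%:R) normc (fourier (fun s => (g s)%:C) (l - x)) ^+ 2 <= B.
Proof.
move=> lf lfa TT TS Ta K0 gr A0 tg g01.
pose C0 := \sum_(s <- pts (atoms a) (2 * A)) normc (a s).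
have C00 : 0 <= C0 by apply: sumr_ge0 => s _; exact: normc_ge0.
exists ((C0 + 2) * (2 * (A + 1))); first by rewrite !mulr_ge0 ?addr_ge0.
move=> x.
pose f s : C := (g s)%:C * cexp (0 +i* (2 * pi * x * s)).
have sk : smooth (fun s => cexp (0 +i* (2 * pi * x * s)) : C).
  have -> : (fun s => cexp (0 +i* (2 * pi * x * s)) : C) = (fun s => cexp ((0 +i* (2 * pi * x)) * s%:C)).
    by apply/funext => s; congr cexp; apply: complex_ext => /=; ring.
  exact: smooth_cexp.
have tf : test_supported A f by exact: test_supportedM tg sk.
have nf s : normc (f s) <= 1.
  rewrite normcM normc_cexp expR0 mulr1 normcR ger0_norm; by case/andP: (g01 s).
have fE l : fourier (fun s => (g s)%:C) (l - x) = fourier f l.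
  rewrite /fourier; congr cintegral; apply/funext => s; rewrite /f mulrCA mulrC -mulrA -cexpD.
  by congr (_ * cexp _); apply: complex_ext => /=; ring.
pose w (N : nat) := \sum_(l <- pts S N%:R) normc (fourier f l).
have [K1 K10 h1] := fourier_derivatives_decay 0 M.+2 A0 tf.
have [K2 K20 h2] := @big_pts_weight_bounded R S (fun=> 1) K M lf (fun=> ler01) K0 gr.
have wm N : w N <= w N.+1 by apply: big_pts_nondecreasing => // l; exact: normc_ge0.
have wb N : w N <= K1 * K2.
  apply: (@le_trans _ _ (\sum_(l <- pts S N%:R) K1 * (1 / (1 + `|l| ^+ M.+2)))).
    by apply: ler_sum => l _; rewrite mul1r; exact: (h1 0%N).
  by rewrite -mulr_sumr ler_wpM2l.
have [wl wle wc] := nondecreasing_cauchy wm wb.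
have [N1 hN1] := wc 1 ltr01.
(* The spectral side of the formula for the translate has at most the mass C0 of a on [-2A, 2A];
   one unit bounds its error, another the tail of the sum over S. *)
have shift_bound N u : (N1 <= N)%N -> `|u| <= A ->
    normc (\sum_(l <- pts S N%:R) cexp (0 +i* (2 * pi * l * u)) * fourier f l) <= C0 + 2.
  move=> NN uA.
  have tu : test_supported (2 * A) (fun s => f (s + u)).
    split.
      have -> : (fun s => f (s + u)) = (fun s => f (1 * s + u)) by apply/funext => s; rewrite mul1r.
      by apply: smooth_comp_affine; exact: tf.1.
    move=> s sA; apply: tf.2; have := ler_normD (s + u) (- u).
    by rewrite addrK normrN; lra.
  have [N2 hN2] := poisson_summation lf TT TS Ta K0 gr (mulr_ge0 (ler0n R 2) A0) tu ltr01.
  pose N3 := maxn N N2.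
  have := hN2 N3 (leq_maxr _ _).
  under eq_bigr do rewrite (fourier_shift _ _ tf).
  rewrite (integral_atomicE lfa tu.2).
  have rhs : normc (\sum_(s <- pts (atoms a) (2 * A)) a s * f (s + u)) <= C0.
    apply: le_trans (normc_sum _ _ _) _; apply: ler_sum => s _.
    by rewrite normcM ler_piMr ?normc_ge0.
  have NN3 : N%:R <= N3%:R :> R by rewrite ler_nat leq_maxl.
  rewrite (big_pts_split _ lf NN3) => h3.
  have tail : normc (\sum_(l <- pts S N3%:R | N%:R < `|l|) cexp (0 +i* (2 * pi * l * u)) * fourier f l) <= 1.
    apply: le_trans (normc_sum _ _ _) _.
    apply: (@le_trans _ _ (\sum_(l <- pts S N3%:R | N%:R < `|l|) normc (fourier f l))).
      by apply: ler_sum => l _; rewrite normcM normc_cexp expR0 mul1r.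
    have := hN1 N NN; have := wle N3; rewrite /w (big_pts_split _ lf NN3); clear; lra.
  move: h3 rhs tail; set X := \sum_(l <- pts S N%:R) _; set Y := \sum_(l <- _ | _) _; set Z := \sum_(s <- _) _ => h3 rhs tail.
  have -> : X = (X + Y - Z) + Z - Y by ring.
  apply: le_trans (normcB _ _) _; have := normcD (X + Y - Z) Z; lra.
have final N : (N1 <= N)%N ->
   \sum_(l <- pts S N%:R) normc (fourier f l) ^+ 2 <= (C0 + 2) * (2 * (A + 1)).
  move=> NN.
  (* G l is f^(l) times the conjugate of the integrand that defines f^(l). *)
  pose G l u : C := (g u)%:C * (fourier f l * cexp ((0 +i* (2 * pi * (l - x))) * u%:C)).
  have tG l : test_supported A (G l).
    apply: test_supportedM tg _.
    by apply: smoothM; [exact: smooth_cst|exact: smooth_cexp].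
  have GE l : G l = fun u => fourier f l * conjc (cexp (0 -i* (2 * pi * l * u)) * f u).
    apply/funext => u; rewrite /G /f (conjc_mul (cexp _)) (conjc_mul (g u)%:C) 2!conjc_cexp conjc_real.
    rewrite [X in _ * X = _](_ : _ = fourier f l * (cexp (conjc (0 -i* (2 * pi * l * u))) * cexp (conjc (0 +i* (2 * pi * x * u))))); last first.
      by rewrite -cexpD; congr (_ * cexp _); apply: complex_ext => /=; ring.
    by rewrite mulrCA [(g u)%:C * _]mulrCA.
  have iG l : cintegral (G l) = (normc (fourier f l) ^+ 2)%:C.
    have [s v] := test_supported_fourier_integrand l tf.
    rewrite GE -mul_conjc -(cintegral_conjc (smooth_ccontinuous s) v).
    apply: (@cintegralZ _ _ _ A); last by move=> u uA; rewrite v // rmorph0.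
    have [c1 c2] := smooth_ccontinuous s; split => y.
      rewrite (_ : _ \o _ = Re \o (fun u => cexp (0 -i* (2 * pi * l * u)) * f u)); first exact: c1.
      by apply/funext => u; rewrite /= ; case: (_ * _).
    rewrite (_ : _ \o _ = - (Im \o (fun u => cexp (0 -i* (2 * pi * l * u)) * f u))).
      by apply: continuousN; exact: c2.
    by apply/funext => u; exact: Im_conjc.
  have sG u : \sum_(l <- pts S N%:R) G l u =
     (g u)%:C * cexp (0 -i* (2 * pi * x * u)) * \sum_(l <- pts S N%:R) cexp (0 +i* (2 * pi * l * u)) * fourier f l.
    rewrite mulr_sumr; apply: eq_bigr => l _; rewrite /G -[RHS]mulrA; congr (_ * _).
    rewrite [RHS]mulrA -cexpD mulrC; congr (cexp _ * _).
    by apply: complex_ext => /=; ring.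
  have := cintegral_sum (pts S N%:R) tG.
  under [in RHS]eq_bigr do rewrite iG.
  rewrite -rmorph_sum => e.
  have nn : 0 <= \sum_(l <- pts S N%:R) normc (fourier f l) ^+ 2 by apply: sumr_ge0 => l _; exact: sqr_ge0.
  rewrite -(normc_real_ge0 nn) -e.
  have tS : test_supported A (fun u => \sum_(l <- pts S N%:R) G l u).
    rewrite (funext sG); apply: (@test_supportedM _ A (fun u => (g u)%:C * cexp (0 -i* (2 * pi * x * u)))).
      by apply: test_supportedM tg (smooth_fourier_kernel x).
    elim: (pts S N%:R) => [|l r IH].
      rewrite (_ : (fun u => _) = fun=> 0); first exact: smooth_cst.
      by apply/funext => u; rewrite big_nil.
    rewrite (_ : (fun u => _) = fun u => cexp ((0 +i* (2 * pi * l)) * u%:C) * fourier f l + \sum_(l <- r) cexp (0 +i* (2 * pi * l * u)) * fourier f l).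
      have h := smoothM (smooth_cexp (0 +i* (2 * pi * l))) (smooth_cst (fourier f l)).
      exact: (smoothD h IH).
    apply/funext => u; rewrite big_cons; congr (cexp _ * _ + _).
    by apply: complex_ext => /=; ring.
  apply: normc_cintegral_sup A0 (smooth_ccontinuous tS.1) tS.2 _ => u.
  rewrite sG; have [uA|uA] := leP `|u| A; last first.
    by have := tg.2 u uA => ->; rewrite !mul0r normc0 addr_ge0.
  rewrite normcM -[leRHS]mul1r ler_pM ?normc_ge0 ?shift_bound //.
  rewrite normcM normc_fourier_kernel mulr1 normcR ger0_norm; by case/andP: (g01 u).
move=> N; under eq_bigr do rewrite fE.
have le := leq_maxl N N1; have le2 := leq_maxr N N1.
apply: le_trans (final _ le2).
rewrite [leRHS](@big_pts_split _ _ S N%:R) ?ler_nat // lerDl sumr_ge0 // => l _.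
exact: sqr_ge0.
Qed.

End density.

(** * Bounded density *)

Section bounded_density.
Variable R : realType.
Local Notation C := R[i].
Local Notation Re := (@complex.Re R).
Implicit Types (S : set R) (f : R -> C).

(** A bump with support so short that the kernel e^(-2 pi i t s) hardly oscillates on it for
  |t| <= 1. *)
Lemma test_function_transform_bounded_below : exists (A c : R) (g : R -> R),
  [/\ 0 <= A, 0 < c, test_supported A (fun s => (g s)%:C), (forall s, 0 <= g s <= 1) &
      forall t, `|t| <= 1 -> c <= normc (fourier (fun s => (g s)%:C) t)].
Proof.
(* With this dilation the integral of the bump is at least 1/(3k) and oscillation costs at
   most 1/(6k). *)
have [k kE] : exists k : R, k = 48 * pi by eexists.
have k0 : 0 < k by rewrite kE mulr_gt0 // pi_gt0.
have ki0 : 0 < k^-1 by rewrite invr_gt0.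
pose g s := bumpf (k * s).
have tg : test_supported k^-1 (fun s => (g s)%:C).
  split.
    have -> : (fun s => (g s)%:C) = (fun s => (bumpf (k * s + 0))%:C) :> (R -> C).
      by apply/funext => s; rewrite addr0.
    by apply: (@smooth_comp_affine R (fun s => (bumpf s)%:C)); have [] := @test_supported_bumpf R.
  move=> s sk; rewrite /g bump_out // normrM gtr0_norm //.
  by move: sk; rewrite -[_^-1]mul1r ltr_pdivrMr // mulrC => /ltW.
have g01 s : 0 <= g s <= 1 by rewrite bump_ge0 bump_le1.
exists k^-1, (6 * k)^-1, g; split => //; rewrite ?(ltW ki0) ?invr_gt0 ?mulr_gt0 // => t t1.
have tf := test_supported_fourier_integrand t tg.
have tf0 := test_supported_fourier_integrand 0 tg.
have kk : k^-1 < 2 * k^-1 by lra.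
have at0 : (3 * k)^-1 <= normc (fourier (fun s => (g s)%:C) 0).
  have [F dF eF] := cintegral_primitive (smooth_ccontinuous tf0.1) tf0.2.
  rewrite /fourier (eF _ kk).
  apply: le_trans (Re_le_normc _); rewrite Re_sub.
  have fE x : Re (cexp (0 -i* (2 * pi * 0 * x)) * (g x)%:C) = g x.
    have -> : (0 -i* (2 * pi * 0 * x)) = 0 :> C.
      by apply: complex_ext => //=; rewrite mulr0 mul0r oppr0.
    by rewrite cexp0 mul1r.
  have mono a b : a <= b -> Re (F a) <= Re (F b).
    move=> ab; rewrite -lerN2.
    apply: (@is_derive_le0_nincr R (fun x => - Re (F x)) (fun x => - g x)) => // x _.
      by apply: is_deriveN; have := (dF x).1; rewrite fE.
    by rewrite oppr_le0; case/andP: (g01 x).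
  have mid : Re (F (- (2 * k)^-1)) + 3^-1 * k^-1 <= Re (F ((2 * k)^-1)).
    have ab : - (2 * k)^-1 <= (2 * k)^-1 by rewrite ge0_cp // invr_ge0 mulr_ge0 // ltW.
    have := @is_derive_le0_nincr R (fun x => 3^-1 * x - Re (F x)) (fun x => 3^-1 - g x) _ _ ab.
    have -> : (2 * k)^-1 = 2^-1 * k^-1 by rewrite invfM.
    move=> h; suff : 3^-1 * (2^-1 * k^-1) - Re (F (2^-1 * k^-1)) <=
       3^-1 * - (2^-1 * k^-1) - Re (F (- (2^-1 * k^-1))) by lra.
    apply: h => x xab.
      apply: is_deriveB; last by have := (dF x).1; rewrite fE.
      by apply: is_derive_eq (is_deriveZ 3^-1 (is_derive_id x 1)) _; rewrite /GRing.scale /= mulr1.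
    by rewrite subr_le0 bump_ge // normrM gtr0_norm // mulrC -ler_pdivlMr // ler_norml.
  have m1 : Re (F (- (2 * k^-1))) <= Re (F (- (2 * k)^-1)).
    by apply: mono; rewrite lerN2 invfM; lra.
  have m2 : Re (F ((2 * k)^-1)) <= Re (F (2 * k^-1)).
    by apply: mono; rewrite invfM; lra.
  rewrite invfM; lra.
have diff : normc (fourier (fun s => (g s)%:C) t - fourier (fun s => (g s)%:C) 0) <= (6 * k)^-1.
  have -> : fourier (fun s => (g s)%:C) t - fourier (fun s => (g s)%:C) 0 =
     cintegral (fun x => cexp (0 -i* (2 * pi * t * x)) * (g x)%:C + (-1) * (cexp (0 -i* (2 * pi * 0 * x)) * (g x)%:C)).
    have s2 := smoothM (smooth_cst (-1)) tf0.1.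
    rewrite (cintegralD (A := k^-1) (smooth_ccontinuous tf.1) (smooth_ccontinuous s2) tf.2).
      by rewrite (cintegralZ _ (smooth_ccontinuous tf0.1) tf0.2) mulN1r.
    by move=> x xA; rewrite tf0.2 // mulr0.
  have -> : (6 * k)^-1 = (2 * pi * k^-1) * (2 * (2 * k^-1)).
    have piE : pi = k / 48 by rewrite kE mulrC mulKf.
    by rewrite piE; field; rewrite gt_eqF.
  apply: (@normc_cintegral_le_const R _ _ k^-1 _ (ltW ki0) kk).
  - apply: smooth_ccontinuous; apply: smoothD tf.1 _; apply: smoothM tf0.1; exact: smooth_cst.
  - by move=> x xA; rewrite tf.2 // tf0.2 // mulr0 addr0.
  - move=> x.
    have -> : cexp (0 -i* (2 * pi * t * x)) * (g x)%:C + -1 * (cexp (0 -i* (2 * pi * 0 * x)) * (g x)%:C) =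
       (cexp (0 +i* - (2 * pi * t * x)) - 1) * (g x)%:C.
      have -> : (0 -i* (2 * pi * 0 * x)) = 0 :> C.
        by apply: complex_ext => //=; rewrite mulr0 mul0r oppr0.
      by rewrite cexp0; ring.
    have [xA|xA] := leP `|x| k^-1; last first.
      by rewrite tg.2 // mulr0 normc0 !mulr_ge0 ?pi_ge0 // ltW.
    rewrite normcM -[leRHS]mulr1 ler_pM ?normc_ge0 //; last first.
      by rewrite normcR ger0_norm; case/andP: (g01 x).
    apply: le_trans (cexp_sub1_imaginary _) _.
    rewrite normrN 2!normrM ger0_norm ?mulr_ge0 ?pi_ge0 //.
    rewrite -mulrA ler_wpM2l ?mulr_ge0 ?pi_ge0 // -[leRHS]mul1r.
    by rewrite ler_pM.
have := normcD (fourier (fun s => (g s)%:C) t) (fourier (fun s => (g s)%:C) 0 - fourier (fun s => (g s)%:C) t).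
rewrite addrC subrK normc_distC => h.
move: at0 diff; rewrite !invfM; lra.
Qed.

Variables (S : set R) (T : (R -> C) -> C) (a : R -> C) (K : R) (M : nat).
Hypotheses (lf : locally_finite S) (lfa : locally_finite (atoms a)).
Hypotheses (TT : tempered_distribution T) (TS : agrees_with_measure T (unit_masses S)).
Hypothesis Ta : agrees_with_measure (fourier_distribution T) a.
Hypotheses (K0 : 0 <= K) (gr : forall N : nat, \sum_(x <- pts S N%:R) 1 <= K * N.+1%:R ^+ M).

(** Each point within distance 1 of x contributes at least c^2 to the sum of squares. *)
Lemma bounded_density : exists2 B : R, 0 <= B & forall x (N : nat),
  \sum_(l <- pts S N%:R | `|l - x| <= 1) 1 <= B.
Proof.
have [A [c [g [A0 c0 tg g01 gc]]]] := test_function_transform_bounded_below.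
have [B B0 hB] := sum_square_fourier_bounded lf lfa TT TS Ta K0 gr A0 tg g01.
exists (B / c ^+ 2); first by rewrite divr_ge0 // exprn_ge0 // ltW.
move=> x N; rewrite ler_pdivlMr ?exprn_gt0 // mulr_suml.
apply: le_trans (hB x N); rewrite [leRHS](bigID (fun l => `|l - x| <= 1)) -[leLHS]addr0.
apply: lerD; last by apply: sumr_ge0 => l _; exact: sqr_ge0.
apply: ler_sum => l lx; rewrite mul1r lerXn2r ?nnegrE ?normc_ge0 ?(ltW c0) //.
exact: gc.
Qed.

(** The shell between radii N+1 and N+2 holds boundedly many points, each of weight at most
  1/(N+1)^2. *)
Lemma sum_inverse_square_bounded : exists2 B : R, 0 <= B & forall N : nat,
  \sum_(l <- pts S N%:R) (1 + l ^+ 2)^-1 <= B.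
Proof.
have [B B0 hB] := bounded_density.
pose u (N : nat) := \sum_(l <- pts S N%:R) (1 + l ^+ 2)^-1.
have wp (l : R) : 0 < 1 + l ^+ 2 by rewrite ltr_wpDr ?sqr_ge0.
have u0 N : 0 <= u N by apply: sumr_ge0 => l _; rewrite invr_ge0 ltW.
exists (u 1%N + 2 * (2 * B)); first by rewrite addr_ge0 // !mulr_ge0.
apply: (@bounded_from_one _ u).
  by apply: big_pts_nondecreasing => // l; rewrite invr_ge0 ltW.
apply: inverse_square_increments; first by rewrite mulr_ge0.
move=> N; rewrite /u (@big_pts_split _ _ S N.+1%:R N.+2%:R) ?ler_nat // lerD2l.
have p : 0 < N.+1%:R :> R by rewrite ltr0n.
apply: (@le_trans _ _ (\sum_(l <- pts S N.+2%:R | N.+1%:R < `|l|) 1 * (N.+1%:R ^+ 2)^-1)).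
  apply: ler_sum => l xN; rewrite mul1r lef_pV2 ?posrE ?exprn_gt0 //.
  rewrite -[l ^+ 2]real_normK ?num_real //; apply: (@le_trans _ _ (`|l| ^+ 2)); last by rewrite lerDr.
  by rewrite lerXn2r ?nnegrE ?(ltW p) ?(ltW xN) ?normr_ge0.
rewrite -mulr_suml ler_wpM2r ?invr_ge0 ?exprn_ge0 // ?(ltW p) //.
have -> : 2 * B = B + B by ring.
apply: le_trans (lerD (hB N.+2%:R N.+2) (hB (- N.+2%:R) N.+2)).
rewrite big_mkcond [X in _ <= X + _]big_mkcond [X in _ <= _ + X]big_mkcond -big_split /=.
rewrite big_seq [leRHS]big_seq; apply: ler_sum => l /(mem_pts _ _ lf)[_ lN].
case: ifP => lN1; last by case: ifP; case: ifP.
have e : N.+2%:R = N.+1%:R + 1 :> R by rewrite -natr1.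
have [l0|l0] := leP 0 l.
  rewrite [X in _ <= X + _]ifT; first by case: ifP => // _; rewrite ?addr0 ?lerDl.
  rewrite ger0_norm // in lN lN1.
  rewrite ler_norml; lra.
rewrite [X in _ <= _ + X]ifT; first by case: ifP => // _; rewrite ?add0r ?lerDr.
rewrite ltr0_norm // in lN lN1.
rewrite ler_norml; lra.
Qed.

End bounded_density.

(** * A smooth ramp *)

Section regularized_ramp.
Variable R : realType.
Local Notation C := R[i].

Lemma exp_inv_mul k (u : R) : u * exp_inv k.+1 u = exp_inv k u.
Proof.
rewrite /exp_inv; case: ifP => u0; last by rewrite mulr0.
by rewrite exprS !mulrA mulfV ?gt_eqF // mul1r.
Qed.

Lemma exp_inv_nonpos k (u : R) : u <= 0 -> exp_inv k u = 0.
Proof. by rewrite /exp_inv ltNge => ->. Qed.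

Lemma exp_inv0_le1 (u : R) : exp_inv 0 u <= 1.
Proof.
rewrite /exp_inv; case: ifP => // u0.
by rewrite expr0 mul1r -[leRHS]expR0 ler_expR oppr_le0 invr_ge0 ltW.
Qed.

Lemma exp_inv1_le1 (u : R) : exp_inv 1 u <= 1.
Proof.
rewrite /exp_inv; case: ifP => // u0.
rewrite expr1 expRN ler_pdivrMr ?expR_gt0 // mul1r.
by apply: le_trans (expR_ge1Dx _); rewrite lerDr.
Qed.

Lemma exp_inv0_ge (u : R) : 0 < u -> 1 - u^-1 <= exp_inv 0 u.
Proof. by move=> u0; rewrite /exp_inv u0 expr0 mul1r; exact: expR_ge1Dx. Qed.

Variable m : R.
Hypothesis m1 : 1 <= m.
Let m0 : 0 < m. Proof. exact: lt_le_trans m1. Qed.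
Let r := m^-1.
Let r0 : 0 < r. Proof. by rewrite invr_gt0. Qed.

(** A smooth version of max(s, 0), sharpening as m grows.  Its second derivative ramp2 is
  nonnegative of total mass 1, concentrated near 0. *)
Definition ramp s := s * exp_inv 0 (m * s).
Definition ramp1 s := exp_inv 0 (m * s) + exp_inv 1 (m * s).
Definition ramp2 s := m * exp_inv 3 (m * s).

Let d_scale k (s : R) : is_derive s 1 (fun s => exp_inv k (m * s))
  ((- k%:R * exp_inv k.+1 (m * s) + exp_inv k.+2 (m * s)) * m).
Proof.
have h : is_derive s 1 (fun s => m * s) m.
  by apply: is_derive_eq (is_deriveZ m (is_derive_id s 1)) _; rewrite /GRing.scale /= mulr1.
exact: (is_derive_chain (is_derive_exp_inv k (m * s)) h).
Qed.

Lemma is_derive_ramp (s : R) : is_derive s 1 ramp (ramp1 s).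
Proof.
apply: is_derive_eq (is_deriveM (is_derive_id s 1) (d_scale 0 s)) _.
rewrite /ramp1 /GRing.scale /= -(exp_inv_mul 1) oppr0 mul0r add0r; ring.
Qed.

Lemma is_derive_ramp1 (s : R) : is_derive s 1 ramp1 (ramp2 s).
Proof.
apply: is_derive_eq (is_deriveD (d_scale 0 s) (d_scale 1 s)) _.
by rewrite /ramp2; ring.
Qed.

(** An explicit primitive of s ramp2(s), which tends to 1/m at infinity: this quantifies how far
  ramp2 is from the Dirac mass at 0. *)
Lemma is_derive_ramp_moment (s : R) : is_derive s 1 (fun s => exp_inv 0 (m * s) / m) (s * ramp2 s).
Proof.
have -> : (fun s => exp_inv 0 (m * s) / m) = m^-1 \*: (fun s => exp_inv 0 (m * s)).
  by apply/funext => t; rewrite mulrC.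
apply: is_derive_eq (is_deriveZ m^-1 (d_scale 0 s)) _.
rewrite /ramp2 /GRing.scale /= -(exp_inv_mul 2) oppr0 mul0r add0r.
by rewrite mulrC mulrK ?unitfE ?gt_eqF //; ring.
Qed.

Lemma ramp2_ge0 s : 0 <= ramp2 s.
Proof. by apply: mulr_ge0; [exact: ltW|exact: exp_inv_ge0]. Qed.

Lemma ramp1_bounds s : 0 <= ramp1 s <= 2.
Proof.
rewrite /ramp1 addr_ge0 ?exp_inv_ge0 //=.
by have := exp_inv0_le1 (m * s); have := exp_inv1_le1 (m * s); lra.
Qed.

Lemma ramp_bounds s : 0 <= s -> 0 <= ramp s <= s.
Proof.
move=> s0; apply/andP; split; first by apply: mulr_ge0 => //; exact: exp_inv_ge0.
by rewrite ler_piMr // exp_inv0_le1.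
Qed.

Lemma ramp_nonpos s : s <= 0 -> [/\ ramp s = 0, ramp1 s = 0 & ramp2 s = 0].
Proof.
move=> s0; rewrite /ramp /ramp1 /ramp2.
have ms : m * s <= 0 by rewrite pmulr_rle0.
by rewrite !exp_inv_nonpos // !mulr0 addr0.
Qed.

Let b (s : R) : C := (bumpf s)%:C.
Let sb : smooth b. Proof. by have [] := @test_supported_bumpf R. Qed.

(** The ramp cut off at distance m, to obtain a test function. *)
Definition cut_ramp (s : R) : C := (ramp s)%:C * b (r * s).
Definition cut_ramp1 (s : R) : C := (ramp1 s)%:C * b (r * s) + (ramp s)%:C * (cD b (r * s) * r%:C).
(** The part of the second derivative produced by the cut-off; it is small as m grows. *)
Definition cut_ramp2_tail (s : R) : C :=
  2 * ((ramp1 s)%:C * (cD b (r * s) * r%:C)) + (ramp s)%:C * (cD (cD b) (r * s) * (r ^+ 2)%:C).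
Definition cut_ramp2 (s : R) : C := (ramp2 s)%:C * b (r * s) + cut_ramp2_tail s.

Let d_bscale (f : R -> C) s : smooth f -> cder (fun s => f (r * s)) s (cD f (r * s) * r%:C).
Proof.
move=> sf; apply: (@cder_comp _ f (fun s => r * s)); first exact: smooth_cder.
by apply: is_derive_eq (is_deriveZ r (is_derive_id s 1)) _; rewrite /GRing.scale /= mulr1.
Qed.

Lemma has_cder_cut_ramp : has_cder cut_ramp cut_ramp1.
Proof.
by move=> s; exact: cderM (cder_real (is_derive_ramp s)) (d_bscale s sb).
Qed.

Lemma has_cder_cut_ramp1 : has_cder cut_ramp1 cut_ramp2.
Proof.
move=> s; have sb1 := smooth_cD sb.
have d1 := cderM (cder_real (is_derive_ramp1 s)) (d_bscale s sb).
have d2 := cderM (cder_real (is_derive_ramp s)) (cderM (d_bscale s sb1) (cder_cst r%:C s)).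
apply: cder_eq (cderD d1 d2) _.
rewrite /cut_ramp2 /cut_ramp2_tail expr2 complexRM; ring.
Qed.

Lemma smooth_cut_ramp : smooth cut_ramp.
Proof.
apply: smoothM.
  have -> : (fun s => (ramp s)%:C) = (fun s => s%:C * (exp_inv 0 (m * s + 0))%:C) :> (R -> C).
    by apply/funext => s; rewrite /ramp complexRM addr0.
  apply: smoothM; first exact: smooth_id.
  by apply: (@smooth_comp_affine R (fun s => (exp_inv 0 s)%:C)); exact: smooth_exp_inv.
have -> : (fun s => b (r * s)) = (fun s => b (r * s + 0)) by apply/funext => s; rewrite addr0.
exact: smooth_comp_affine.
Qed.

Lemma b_out (f : R -> C) s : vanishes_beyond 1 f -> m < `|s| -> f (r * s) = 0.
Proof.
move=> v ms; apply: v; rewrite normrM gtr0_norm // /r mulrC ltr_pdivlMr // mul1r //.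
Qed.

Lemma test_supported_cut_ramp : test_supported m cut_ramp.
Proof.
split; first exact: smooth_cut_ramp.
move=> s ms; rewrite /cut_ramp (b_out _ ms) ?mulr0 //.
by have [] := @test_supported_bumpf R.
Qed.

(** Two integrations by parts. *)
Lemma fourier_cut_ramp (w : C) :
  cintegral (fun s => cut_ramp2 s * cexp (w * s%:C)) =
  w ^+ 2 * cintegral (fun s => cut_ramp s * cexp (w * s%:C)).
Proof.
have [s0 v0] := test_supported_cut_ramp.
have s1 := smooth_cD s0; have v1 := vanishes_cD s0 v0.
have s2 := smooth_cD s1; have v2 := vanishes_cD s1 v1.
rewrite (has_cder_cD has_cder_cut_ramp) in s1 v1 s2 v2.
rewrite (has_cder_cD has_cder_cut_ramp1) in s2 v2.
pose e (s : R) : C := cexp (w * s%:C).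
have se : smooth e by exact: smooth_cexp.
have de s : cder e s (w * e s).
  by apply: cder_eq (cder_cexp (cderZ w (cder_id s))) _; rewrite mulr1.
pose f s := cut_ramp1 s * e s + (- w) * (cut_ramp s * e s).
have df s : cder f s (cut_ramp2 s * e s + (- w ^+ 2) * (cut_ramp s * e s)).
  apply: cder_eq (cderD (cderM (has_cder_cut_ramp1 s) (de s)) (cderZ (- w) (cderM (has_cder_cut_ramp s) (de s)))) _.
  ring.
have c0 := smooth_ccontinuous (smoothM s0 se).
have c2 := smooth_ccontinuous (smoothM s2 se).
have sz := smoothM (smooth_cst (- w ^+ 2)) (smoothM s0 se).
have := @cintegral_derivative R f _ m _ _ _ df.
rewrite (cintegralD (A := m) c2 (smooth_ccontinuous sz)).
- rewrite (cintegralZ (A := m) _ c0); last by move=> s ms; rewrite v0 // mul0r.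
  move=> h; apply/eqP; rewrite -subr_eq0 -mulNr h //.
  + by move=> s ms; rewrite /f v0 // v1 // !mul0r mulr0 addr0.
  + by move=> s ms; rewrite v0 // v2 // !mul0r mulr0 addr0.
  + by apply: smooth_ccontinuous; exact: smoothD (smoothM s2 se) sz.
- by move=> s ms; rewrite v2 // mul0r.
- by move=> s ms; rewrite v0 // mul0r mulr0.
Qed.

Lemma normc_cintegral_half (f : R -> C) (G G' : R -> R) (B : R) : ccontinuous f ->
  vanishes_beyond m f -> m < B -> (forall x, x <= 0 -> f x = 0) ->
  (forall x : R, 0 <= x <= B -> is_derive x 1 G (G' x)) ->
  (forall x, 0 <= x <= B -> normc (f x) <= G' x) ->
  normc (cintegral f) <= G B - G 0.
Proof.
move=> cf f0 mB fneg dG le; have [F dF eF] := cintegral_primitive cf f0.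
have B0 : 0 <= B by apply: le_trans (ltW mB); exact: ltW.
rewrite (eF _ mB); have -> : F (- B) = F 0.
  apply/eqP; rewrite -subr_eq0 -normc_eq0 eq_le normc_ge0 andbT.
  have := @cmvt_abs _ F f 0 0 (- B); rewrite mul0r; apply => x; first by move=> _; exact: dF.
  rewrite min_r ?max_l ?oppr_le0 // => /andP[_ x0].
  by rewrite fneg // normc0.
exact: (cmvt B0 (fun x _ => dF x) dG).
Qed.

End regularized_ramp.

(** * Transforms of the cut-off ramp *)

Section ramp_transform.
Variable R : realType.
Local Notation C := R[i].
Local Notation Re := (@complex.Re R).

Lemma normc_cexp_sub1_nonpos (w : C) (s : R) : Re w <= 0 -> 0 <= s ->
  normc (cexp (w * s%:C) - 1) <= normc w * s.
Proof.
move=> w0 s0.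
have := @cmvt_abs R (fun t => cexp (w * t%:C)) (fun t => w * cexp (w * t%:C)) (normc w) 0 s.
rewrite mulr0 cexp0 subr0 ger0_norm //; apply => t.
  by move=> _; apply: cder_eq (cder_cexp (cderZ w (cder_id t))) _; rewrite mulr1.
rewrite min_l // max_r // => /andP[t0 _].
rewrite normcM ler_piMr ?normc_ge0 // normc_cexp -[leRHS]expR0 ler_expR Re_mul /= mulr0 subr0.
exact: mulr_le0_ge0.
Qed.

(** The second derivative of the cut-off ramp is an approximate Dirac mass at 0, uniformly
  against exponentials of a given rate of decay. *)
Lemma ramp_transform_bounds (c : R) : 0 < c -> exists2 K : R, 0 <= K &
  forall (m : R) (w : C), 1 <= m -> Re w = - c ->
    normc (cintegral (fun s => cut_ramp2 m s * cexp (w * s%:C))) <= K /\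
    normc (cintegral (fun s => cut_ramp2 m s * cexp (w * s%:C)) - 1) <= K * (1 + normc w) / m.
Proof.
move=> c0.
have [L L0 hL] := @bump_lipschitz R.
have [B1 B10 hB] := test_supported_bounded 2 (@test_supported_bumpf R).
pose b (s : R) : C := (bumpf s)%:C.
have sb : smooth b by have [] := @test_supported_bumpf R.
have Q0 : 0 <= 5 * B1 / c by rewrite divr_ge0 ?mulr_ge0 // ltW.
exists (3 + L + 5 * B1 / c); first by rewrite !addr_ge0.
move=> m w m1 wc; have m0 : 0 < m := lt_le_trans ltr01 m1.
have [r rE] : exists r, r = m^-1 by eexists.
have r0 : 0 < r by rewrite rE invr_gt0.
have rm : r * m = 1 by rewrite rE mulVf // gt_eqF.
have r1 : r <= 1 by rewrite rE invf_le1.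
pose e (s : R) : C := cexp (w * s%:C).
have se : smooth e by exact: smooth_cexp.
have ne s : normc (e s) = expR (- c * s).
  by rewrite normc_cexp Re_mul /= mulr0 subr0 wc.
have sbr (f : R -> C) : smooth f -> smooth (fun s => f (r * s)).
  move=> sf; have -> : (fun s => f (r * s)) = (fun s => f (r * s + 0)) by apply/funext => s; rewrite addr0.
  exact: smooth_comp_affine.
have sx k : smooth (fun s => (exp_inv k (m * s))%:C : C).
  have -> : (fun s => (exp_inv k (m * s))%:C) = (fun s => (exp_inv k (m * s + 0))%:C) :> (R -> C).
    by apply/funext => s; rewrite addr0.
  by apply: (@smooth_comp_affine R (fun s => (exp_inv k s)%:C)); exact: smooth_exp_inv.
have sr : smooth (fun s => (ramp m s)%:C : C).
  rewrite (_ : (fun s => _) = (fun s => s%:C * (exp_inv 0 (m * s))%:C)); last first.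
    by apply/funext => s; rewrite /ramp complexRM.
  by apply: smoothM (sx 0%N); exact: smooth_id.
have sr1 : smooth (fun s => (ramp1 m s)%:C : C).
  rewrite (_ : (fun s => _) = (fun s => (exp_inv 0 (m * s))%:C + (exp_inv 1 (m * s))%:C)); last first.
    by apply/funext => s; rewrite /ramp1 complexRD.
  exact: (smoothD (sx 0%N) (sx 1%N)).
have sr2 : smooth (fun s => (ramp2 m s)%:C : C).
  rewrite (_ : (fun s => _) = (fun s => m%:C * (exp_inv 3 (m * s))%:C)); last first.
    by apply/funext => s; rewrite /ramp2 complexRM.
  by apply: smoothM (sx 3%N); exact: smooth_cst.
pose f1 s := (ramp2 m s)%:C * b (r * s) * e s.
pose f2 s := cut_ramp2_tail m s * e s.
have sf1 : smooth f1 by apply: smoothM se; apply: smoothM sr2 _; exact: sbr.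
have sf2 : smooth f2.
  apply: smoothM se; rewrite /cut_ramp2_tail -rE; apply: smoothD.
    apply: smoothM; first exact: smooth_cst.
    apply: smoothM sr1 _; apply: smoothM; last exact: smooth_cst.
    exact: (sbr (cD b) (smooth_cD sb)).
  apply: smoothM sr _; apply: smoothM; last exact: smooth_cst.
  exact: (sbr (cD (cD b)) (smooth_cD (smooth_cD sb))).
have tb := @test_supported_bumpf R; have tb1 := test_supported_cD tb; have tb2 := test_supported_cD tb1.
have out f s : vanishes_beyond 1 f -> m < `|s| -> f (r * s) = 0 :> C.
  by rewrite rE; exact: b_out.
have v1 : vanishes_beyond m f1.
  by move=> s ms; rewrite /f1 (out b) ?mulr0 ?mul0r //; exact: tb.2.
have v2 : vanishes_beyond m f2.
  move=> s ms; rewrite /f2 /cut_ramp2_tail -rE (out (cD b) s tb1.2 ms) (out (cD (cD b)) s tb2.2 ms).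
  by rewrite !(mul0r, mulr0) addr0 mul0r.
have n1 s : s <= 0 -> f1 s = 0 by move=> /(ramp_nonpos m1) [_ _ h]; rewrite /f1 h !mul0r.
have n2 s : s <= 0 -> f2 s = 0.
  by move=> /(ramp_nonpos m1) [h1 h2 _]; rewrite /f2 /cut_ramp2_tail h1 h2 !(mul0r, mulr0) addr0 mul0r.
have -> : cintegral (fun s => cut_ramp2 m s * cexp (w * s%:C)) = cintegral f1 + cintegral f2.
  rewrite -(cintegralD (smooth_ccontinuous sf1) (smooth_ccontinuous sf2) v1 v2).
  by congr cintegral; apply/funext => s; rewrite /cut_ramp2 /f1 /f2 -rE mulrDl.
have mB : m < 2 * m by lra.
have b01 (s : R) : 0 <= bumpf s <= 1 by rewrite bump_ge0 bump_le1.
have nb (s : R) : normc (b s) <= 1 by rewrite normcR ger0_norm; case/andP: (b01 s).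
have ne1 s : 0 <= s -> normc (e s) <= 1.
  by move=> s0; rewrite ne -[leRHS]expR0 ler_expR mulNr oppr_le0 mulr_ge0 // ltW.
have I2 : normc (cintegral f2) <= (5 * B1 / c) / m.
  have dG (s : R) : 0 <= s <= 2 * m -> is_derive s 1 (fun s => - (5 * B1 * r / c) * expR (- c * s)) (5 * B1 * r * expR (- c * s)).
    move=> _; have h : is_derive s 1 (fun s => - c * s) (- c).
      by apply: is_derive_eq (is_deriveZ (- c) (is_derive_id s 1)) _; rewrite /GRing.scale /= mulr1.
    have h2 := is_derive_chain (is_derive_expR (- c * s)) h.
    apply: is_derive_eq (is_deriveZ (- (5 * B1 * r / c)) h2) _.
    by rewrite /GRing.scale /=; field; rewrite gt_eqF.
  have := normc_cintegral_half m1 (smooth_ccontinuous sf2) v2 mB n2 dG.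
  rewrite mulr0 expR0 mulr1 opprK -rE => h.
  have -> : 5 * B1 / c * r = 5 * B1 * r / c by ring.
  apply: le_trans (h _) _; last first.
    by rewrite gerDr mulNr oppr_le0 mulr_ge0 ?expR_ge0 // divr_ge0 ?mulr_ge0 // ltW.
  move=> s /andP[s0 sB]; have [sm|sm] := leP s m; last first.
    by rewrite v2 ?ger0_norm // normc0 !mulr_ge0 ?expR_ge0 // ltW.
  rewrite /f2 normcM ne ler_wpM2r ?expR_ge0 // /cut_ramp2_tail -rE.
  apply: le_trans (normcD _ _) _.
  have [g0 g2] := andP (ramp1_bounds m s); have [g3 g4] := andP (ramp_bounds m s0).
  rewrite (normcM 2) 2!(normcM (_%:C)) 2!(normcM (cD _ _)) !normcR.
  rewrite (_ : normc (2 : C) = 2); last by rewrite -[2]/(2%:R) -(rmorph_nat (real_complex R)) normcR ger0_norm.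
  rewrite !ger0_norm ?exprn_ge0 ?(ltW r0) //.
  have n1b : normc (cD b (r * s)) <= B1 by exact: (hB 1%N).
  have n2b : normc (cD (cD b) (r * s)) <= B1 by exact: (hB 2%N).
  have -> : 5 * B1 * r = 2 * (2 * (B1 * r)) + m * (B1 * r ^+ 2).
    have -> : m * (B1 * r ^+ 2) = B1 * r * (r * m) by ring.
    by rewrite rm; ring.
  apply: lerD.
    rewrite ler_wpM2l //; apply: ler_pM => //; first by rewrite mulr_ge0 ?normc_ge0 // ltW.
    by rewrite ler_wpM2r // ltW.
  apply: ler_pM => //; first by rewrite mulr_ge0 ?normc_ge0 // exprn_ge0 // ltW.
    exact: le_trans g4 sm.
  by rewrite ler_wpM2r // exprn_ge0 // ltW.
have I1 : normc (cintegral f1) <= 2.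
  have dG (s : R) : 0 <= s <= 2 * m -> is_derive s 1 (ramp1 m) (ramp2 m s) by move=> _; exact: is_derive_ramp1.
  have := normc_cintegral_half m1 (smooth_ccontinuous sf1) v1 mB n1 dG.
  have [_ -> _] := ramp_nonpos m1 (lexx 0); rewrite subr0 => h.
  apply: le_trans (h _) _; last by case/andP: (ramp1_bounds m (2 * m)).
  move=> s /andP[s0 sB]; rewrite /f1 2!normcM normcR ger0_norm ?ramp2_ge0 //.
  rewrite -mulrA ler_piMr ?ramp2_ge0 //.
  by rewrite -[leRHS]mulr1 ler_pM ?normc_ge0 ?ne1.
have I1' : normc (cintegral f1 - 1) <= (L + normc w + 1) / m.
  have [F dF eF] := cintegral_primitive (smooth_ccontinuous sf1) v1.
  rewrite (eF _ mB); have -> : F (- (2 * m)) = F 0.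
    apply/eqP; rewrite -subr_eq0 -normc_eq0 eq_le normc_ge0 andbT.
    have := @cmvt_abs _ F f1 0 0 (- (2 * m)); rewrite mul0r; apply => x; first by move=> _; exact: dF.
    rewrite min_r ?max_l ?oppr_le0 ?mulr_ge0 ?(ltW m0) // => /andP[_ x0].
    by rewrite n1 // normc0.
  have B0 : 0 <= 2 * m by rewrite mulr_ge0 // ltW.
  have dF' x : 0 <= x <= 2 * m -> cder (fun s => F s - (ramp1 m s)%:C) x (f1 x - (ramp2 m x)%:C).
    by move=> _; exact: cderB (dF x) (cder_real (is_derive_ramp1 m x)).
  have dG (x : R) : 0 <= x <= 2 * m -> is_derive x 1
      (fun s => (L * r + normc w) * (exp_inv 0 (m * s) / m)) ((L * r + normc w) * (x * ramp2 m x)).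
    by move=> _; exact: (is_deriveZ (L * r + normc w) (is_derive_ramp_moment m1 x)).
  have := cmvt B0 dF' dG.
  have [_ -> _] := ramp_nonpos m1 (lexx 0).
  have -> : exp_inv 0 (m * 0) = 0 :> R by rewrite mulr0 exp_inv_nonpos.
  rewrite mul0r mulr0 !subr0 => h.
  have {}h : normc (F (2 * m) - (ramp1 m (2 * m))%:C - F 0) <= (L + normc w) / m.
    apply: le_trans (h _) _.
      move=> s /andP[s0 sB].
      have -> : f1 s - (ramp2 m s)%:C = (ramp2 m s)%:C * (b (r * s) * e s - 1) by rewrite /f1; ring.
      rewrite normcM normcR ger0_norm ?ramp2_ge0 // mulrA mulrC ler_wpM2r ?ramp2_ge0 //.
      have -> : b (r * s) * e s - 1 = (b (r * s) - 1) * e s + (e s - 1) by ring.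
      apply: le_trans (normcD _ _) _; rewrite [leRHS]mulrDl; apply: lerD; last first.
        by apply: normc_cexp_sub1_nonpos; rewrite ?wc ?oppr_le0 // ltW.
      rewrite normcM -[leRHS]mulr1; apply: ler_pM; [exact: normc_ge0|exact: normc_ge0| |exact: ne1].
      rewrite /b complexRB1 normcR distrC -mulrA.
      by apply: le_trans (hL _) _; rewrite ger0_norm // mulr_ge0 // ltW.
    apply: ler_pM; rewrite ?addr_ge0 ?mulr_ge0 ?normc_ge0 ?exp_inv_ge0 ?invr_ge0 ?(ltW r0) ?(ltW m0) //.
      by rewrite lerD2r ler_piMr.
    by rewrite ler_piMl ?invr_ge0 ?(ltW m0) // exp_inv0_le1.
  have u0 : 0 < m * (2 * m) by rewrite !mulr_gt0.
  have um : (m * (2 * m))^-1 <= m^-1.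
    rewrite lef_pV2 ?posrE // ler_peMr ?(ltW m0) //; lra.
  have e0 := exp_inv0_ge u0; have e0' := exp_inv0_le1 (m * (2 * m)).
  have e1 : exp_inv 1 (m * (2 * m)) <= (m * (2 * m))^-1.
    by rewrite -[leRHS]mul1r ler_pdivlMr // mulrC exp_inv_mul.
  have e1' := exp_inv_ge0 1 (m * (2 * m)).
  have hr : normc ((ramp1 m (2 * m))%:C - 1) <= m^-1.
    by rewrite complexRB1 normcR /ramp1 ler_norml; lra.
  have -> : F (2 * m) - F 0 - 1 = (F (2 * m) - (ramp1 m (2 * m))%:C - F 0) + ((ramp1 m (2 * m))%:C - 1) by ring.
  by apply: le_trans (normcD _ _) _; rewrite [(_ + 1) / m]mulrDl mul1r lerD.
have mi1 : m^-1 <= 1 by rewrite invf_le1.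
split.
  apply: le_trans (normcD _ _) _; have : (5 * B1 / c) / m <= 5 * B1 / c by rewrite ler_piMr.
  lra.
have -> : cintegral f1 + cintegral f2 - 1 = (cintegral f1 - 1) + cintegral f2 by ring.
apply: le_trans (normcD _ _) _; apply: le_trans (lerD I1' I2) _.
rewrite -mulrDl ler_wpM2r ?invr_ge0 ?(ltW m0) //.
have wn := normc_ge0 w.
have : 0 <= (2 + L + 5 * B1 / c) * normc w by rewrite mulr_ge0 // !addr_ge0.
lra.
Qed.

End ramp_transform.

(** * The positive spectrum *)

Section positive_spectrum.
Variable R : realType.
Local Notation C := R[i].
Implicit Types (S : set R) (a : R -> C).

(** Only positive frequencies matter: the functions e^(2 pi i s z) with s > 0 decay in the upper
  half plane. *)
Definition spectrum a (k : nat) : seq R := [seq s <- pts (atoms a) k%:R | 0 < s].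

Lemma mem_spectrum a k s : locally_finite (atoms a) ->
  (s \in spectrum a k) <-> [/\ a s != 0, 0 < s & s <= k%:R].
Proof.
move=> lf; rewrite mem_filter; split.
  by move=> /andP[s0 /(mem_pts _ _ lf)[as0]]; rewrite ger0_norm ?(ltW s0).
by move=> [as0 s0 sk]; rewrite s0; apply/mem_pts => //; rewrite ger0_norm ?(ltW s0).
Qed.

Lemma big_spectrum_split (V : nmodType) a (k m : nat) (F : R -> V) : locally_finite (atoms a) -> (k <= m)%N ->
  \sum_(s <- spectrum a m) F s = \sum_(s <- spectrum a k) F s + \sum_(s <- spectrum a m | k%:R < s) F s.
Proof.
move=> lf km; rewrite /spectrum !big_filter [LHS]big_mkcond [X in _ = X + _]big_mkcond /=.
rewrite (@big_pts_split _ _ _ k%:R m%:R) ?ler_nat //; congr (_ + _).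
rewrite big_filter_cond -big_mkcondr /=; apply: eq_bigl => s /=; rewrite andbC.
have [s0|] := ltP 0 s; last by [].
by rewrite gtr0_norm.
Qed.

(** Polynomial growth of |a| is beaten by the exponential. *)
Lemma sum_exponential_bounded a (K : R) (M : nat) : locally_finite (atoms a) -> 0 <= K ->
  (forall N : nat, \sum_(x <- pts (atoms a) N%:R) normc (a x) <= K * N.+1%:R ^+ M) ->
  forall h : R, 0 < h -> exists2 B : R, 0 <= B & forall k,
    \sum_(s <- spectrum a k) normc (a s) * ((1 + s) ^+ 2 * expR (- (2 * pi * h) * s)) <= B.
Proof.
move=> lf K0 gr h h0.
have [K' K'0 hK'] := @big_pts_weight_bounded R (atoms a) (fun x => normc (a x)) K M lf (fun x => normc_ge0 _) K0 gr.
have [u uE] : exists u : R, u = 2 * pi * h by eexists.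
have u0 : 0 < u by rewrite uE !mulr_gt0 ?pi_gt0.
(* The power n+1 = M+4 covers (1 + s)^2 times the weight s^(M+2). *)
pose n := M.+3.
pose D : R := 6 * (1 + (n.+1%:R / u) ^+ n.+1).
have D0 : 0 <= D.
  by apply: mulr_ge0 => //; apply: addr_ge0 => //; apply: exprn_ge0; rewrite divr_ge0 // ltW.
exists (D * K'); first exact: mulr_ge0.
move=> k; apply: le_trans (ler_wpM2l D0 (hK' k)); rewrite mulr_sumr /spectrum big_filter.
rewrite [leRHS](bigID (fun s => 0 < s)) /= -[leLHS]addr0 lerD //; last first.
  apply: sumr_ge0 => s _; apply: mulr_ge0 => //; apply: divr_ge0; first exact: normc_ge0.
  by rewrite addr_ge0 // exprn_ge0.
apply: ler_sum => s s0; rewrite -uE [leRHS]mulrCA ler_wpM2l ?normc_ge0 // gtr0_norm //.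
have sM : 0 <= s ^+ M.+2 by rewrite exprn_ge0 // ltW.
rewrite ler_pdivlMr ?ltr_wpDr // mulrAC mulNr expRN ler_pdivrMr ?expR_gt0 //.
have p2 : s ^+ 2 <= 1 + s ^+ n.+1 by apply: ler_exp_1D; rewrite ?(ltW s0).
have pM : s ^+ M.+2 <= 1 + s ^+ n.+1 by apply: ler_exp_1D; rewrite ?(ltW s0) // /n; lia.
have p1 : s <= 1 + s ^+ n.+1 by rewrite -{1}[s]expr1; apply: ler_exp_1D; rewrite ?(ltW s0).
have e1 : 1 <= expR (u * s) by rewrite -[leLHS]expR0 ler_expR mulr_ge0 // ltW.
have e2 : s ^+ n.+1 <= (n.+1%:R / u) ^+ n.+1 * expR (u * s).
  have := @expR_ge_powV R (u * s) n; rewrite mulr_ge0 ?(ltW u0) ?(ltW s0) // => /(_ isT) h1.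
  have q : 0 <= (n.+1%:R / u) ^+ n.+1 by apply: exprn_ge0; rewrite divr_ge0 // ltW.
  apply: le_trans (ler_wpM2l q h1); rewrite -exprMn lerXn2r ?nnegrE ?(ltW s0) //.
    by rewrite !mulr_ge0 ?divr_ge0 ?invr_ge0 ?mulr_ge0 ?(ltW u0) ?(ltW s0).
  rewrite le_eqVlt; apply/orP; left; apply/eqP; field.
  by rewrite ?pnatr_eq0 ?gt_eqF.
have e3 : s ^+ 2 * s ^+ M.+2 = s ^+ n.+1 by rewrite -exprD.
have : (1 + s) ^+ 2 * (1 + s ^+ M.+2) <= 6 * (1 + s ^+ n.+1).
  have -> : (1 + s) ^+ 2 * (1 + s ^+ M.+2) = (1 + 2 * s + s ^+ 2) * (1 + s ^+ M.+2) by ring.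
  have s1 : 2 * s <= 1 + s ^+ 2 by rewrite -subr_ge0; have := sqr_ge0 (s - 1); rewrite sqrrB expr1n mulr1; lra.
  have : (1 + 2 * s + s ^+ 2) * (1 + s ^+ M.+2) <= (2 + 2 * s ^+ 2) * (1 + s ^+ M.+2).
    by rewrite ler_wpM2r ?addr_ge0 //; lra.
  move/le_trans; apply.
  have -> : (2 + 2 * s ^+ 2) * (1 + s ^+ M.+2) = 2 + 2 * s ^+ 2 + 2 * s ^+ M.+2 + 2 * (s ^+ 2 * s ^+ M.+2) by ring.
  rewrite e3; lra.
move/le_trans; apply; rewrite /D -mulrA ler_wpM2l // mulrDl mul1r.
exact: lerD.
Qed.

(** Compares 1 / |z - l|^2 with 1 / (1 + l^2) uniformly in l, on vertical strips away from the
  real axis. *)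
Definition poisson_kernel_weight (X h : R) : R := 2 + (1 + 2 * X ^+ 2) / h ^+ 2.

Lemma poisson_kernel_weight_ge0 (X h : R) : 0 <= poisson_kernel_weight X h.
Proof.
apply: addr_ge0 => //; apply: mulr_ge0; last by rewrite invr_ge0 sqr_ge0.
by apply: addr_ge0 => //; apply: mulr_ge0 => //; exact: sqr_ge0.
Qed.

Lemma inverse_dist_sqr_le (X h x y l : R) : 0 < h -> `|x| <= X -> h <= `|y| ->
  ((x - l) ^+ 2 + y ^+ 2)^-1 <= poisson_kernel_weight X h * (1 + l ^+ 2)^-1.
Proof.
move=> h0 xX hy; rewrite /poisson_kernel_weight.
have h20 : 0 < h ^+ 2 by rewrite exprn_gt0.
have y2 : h ^+ 2 <= y ^+ 2.
  by rewrite -[y ^+ 2]real_normK ?num_real // lerXn2r ?nnegrE ?(ltW h0).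
have x2 : x ^+ 2 <= X ^+ 2.
  by rewrite -[x ^+ 2]real_normK ?num_real // lerXn2r ?nnegrE // (le_trans (normr_ge0 x)).
have p : 0 < (x - l) ^+ 2 + y ^+ 2 by rewrite ltr_wpDl ?sqr_ge0 // (lt_le_trans h20).
have q : 0 < 1 + l ^+ 2 by rewrite ltr_wpDr ?sqr_ge0.
rewrite ler_pdivlMr // mulrC ler_pdivrMr //.
have a1 : l ^+ 2 <= 2 * (x - l) ^+ 2 + 2 * x ^+ 2.
  by rewrite -subr_ge0; have := sqr_ge0 (l - 2 * x); rewrite (_ : _ - l ^+ 2 = (l - 2 * x) ^+ 2) //; ring.
have a2 : 1 + 2 * X ^+ 2 <= (1 + 2 * X ^+ 2) / h ^+ 2 * y ^+ 2.
  by rewrite mulrAC ler_pdivlMr // ler_wpM2l // addr_ge0 // mulr_ge0 // sqr_ge0.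
have a3 : 0 <= (1 + 2 * X ^+ 2) / h ^+ 2 * (x - l) ^+ 2.
  by rewrite mulr_ge0 ?sqr_ge0 // divr_ge0 ?(ltW h20) // addr_ge0 // mulr_ge0 // sqr_ge0.
have a4 := sqr_ge0 y; rewrite mulrDl !mulrDr; lra.
Qed.

Definition resolvent_sum S N (z : C) := \sum_(l <- pts S N%:R) ((z - l%:C)^-1) ^+ 2.
Definition spectral_sum a k (z : C) :=
  \sum_(s <- spectrum a k) s%:C * a s * cexp ((0 +i* (2 * pi * s)) * z).

End positive_spectrum.

(** * The resolvent identity *)

Section resolvent_identity.
Variable R : realType.
Local Notation C := R[i].
Local Notation Re := (@complex.Re R).
Local Notation Im := (@complex.Im R).

Lemma complexRB (u v : R) : (u - v)%:C = u%:C - v%:C :> C.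
Proof. exact: rmorphB. Qed.

(** The function s e^(2 pi i s z) on s > 0 has the transform proportional to (z - t)^(-2), but is
  neither smooth at 0 nor compactly supported.  The summation formula is applied to its smooth
  truncations, obtained from the cut-off ramp; their transforms are (z - t)^(-2) times a factor
  that is bounded and tends to 1, so both sides converge. *)
Lemma summation_resolvent (S : set R) (T : (R -> C) -> C) (a : R -> C) (K Ka : R) (M Ma : nat) :
  locally_finite S -> locally_finite (atoms a) ->
  tempered_distribution T -> agrees_with_measure T (unit_masses S) ->
  agrees_with_measure (fourier_distribution T) a ->
  0 <= K -> (forall N : nat, \sum_(x <- pts S N%:R) 1 <= K * N.+1%:R ^+ M) ->
  0 <= Ka -> (forall N : nat, \sum_(x <- pts (atoms a) N%:R) normc (a x) <= Ka * N.+1%:R ^+ Ma) ->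
  forall z : C, 0 < Im z -> forall e : R, 0 < e -> exists N0, forall N k, (N0 <= N)%N -> (N0 <= k)%N ->
    normc (resolvent_sum S N z + (4 * pi ^+ 2)%:C * spectral_sum a k z) <= e.
Proof.
move=> lf lfa TT TS Ta K0 gr Ka0 gra z y0 e e0.
have [x xE] : exists x, x = Re z by eexists.
have [y yE] : exists y, y = Im z by eexists.
rewrite -yE in y0.
(* c is the decay rate of e^(2 pi i s z). *)
have [c cE] : exists c : R, c = 2 * pi * y by eexists.
have c0 : 0 < c by rewrite cE !mulr_gt0 ?pi_gt0.
have p0 : 0 < 4 * pi ^+ 2 :> R by rewrite mulr_gt0 // exprn_gt0 // pi_gt0.
have [K1 K10 hJ] := ramp_transform_bounds c0.
have [L L0 hL] := @bump_lipschitz R.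
have [W WE] : exists W : C, W = (0 +i* (2 * pi)) * z by eexists.
have ReW : Re W = - c by rewrite WE Re_mul /= cE -yE; ring.
(* F m is the truncated function, and J m (w l) is the correction factor to its transform at l. *)
pose w (l : R) : C := W - (0 +i* (2 * pi * l)).
have Rew l : Re (w l) = - c by rewrite /w Re_sub ReW /= subr0.
have w0 l : w l != 0.
  apply/eqP => h; have := Rew l; rewrite h /= => /eqP; rewrite eq_sym oppr_eq0 => /eqP c00.
  by rewrite c00 ltxx in c0.
pose J m (w : C) := cintegral (fun s => cut_ramp2 m s * cexp (w * s%:C)).
pose F m (s : R) : C := cut_ramp m s * cexp (W * s%:C).
have tF m : 1 <= m -> test_supported m (F m).
  by move=> m1; apply: test_supportedM (test_supported_cut_ramp m1) _; exact: smooth_cexp.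
have fF m l : 1 <= m -> fourier (F m) l = J m (w l) / (w l) ^+ 2.
  move=> m1; rewrite /J (fourier_cut_ramp m1) mulrC mulKf ?expf_neq0 //.
  rewrite /fourier; congr cintegral; apply/funext => s; rewrite /F mulrCA -cexpD.
  by congr (_ * cexp _); rewrite /w mulrBl addrC; congr (_ + _); apply: complex_ext => /=; ring.
pose v l : R := (normc (w l) ^+ 2)^-1.
have v0 l : 0 <= v l by rewrite invr_ge0 sqr_ge0.
have vE l : v l = (4 * pi ^+ 2)^-1 * ((x - l) ^+ 2 + y ^+ 2)^-1.
  rewrite /v normc_sqrE -invfM; congr (_^-1).
  by rewrite /w WE Re_sub Im_sub Re_mul Im_mul /= -xE -yE; ring.
have [BL BL0 hBL] := sum_inverse_square_bounded lf lfa TT TS Ta K0 gr.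
pose V (N : nat) := \sum_(l <- pts S N%:R) v l.
have Vm N : V N <= V N.+1 by exact: big_pts_nondecreasing.
have Vb N : V N <= (4 * pi ^+ 2)^-1 * (poisson_kernel_weight `|x| y * BL).
  apply: (@le_trans _ _ (\sum_(l <- pts S N%:R) (4 * pi ^+ 2)^-1 * (poisson_kernel_weight `|x| y * (1 + l ^+ 2)^-1))).
    apply: ler_sum => l _; rewrite vE ler_wpM2l ?invr_ge0 ?(ltW p0) //.
    by apply: inverse_dist_sqr_le => //; rewrite gtr0_norm.
  rewrite -!mulr_sumr ler_wpM2l ?invr_ge0 ?(ltW p0) // ler_wpM2l //.
  exact: poisson_kernel_weight_ge0.
have [Vl Vle Vc] := nondecreasing_cauchy Vm Vb.
have [B B0 hB] := sum_exponential_bounded lfa Ka0 gra y0.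
rewrite -cE in hB.
pose t s : R := normc (a s) * ((1 + s) ^+ 2 * expR (- c * s)).
have t0 s : 0 <= t s.
  by apply: mulr_ge0; [exact: normc_ge0|apply: mulr_ge0; [exact: sqr_ge0|exact: expR_ge0]].
pose Wt (k : nat) := \sum_(s <- spectrum a k) t s.
have Wm k : Wt k <= Wt k.+1.
  by rewrite /Wt (@big_spectrum_split _ _ a k k.+1) // lerDl sumr_ge0.
have [Wl Wle Wc] := nondecreasing_cauchy Wm hB.
have e'0 : 0 < e / (4 * pi ^+ 2) by rewrite divr_gt0.
have [e1 e1E] : exists e1, e1 = e / (4 * pi ^+ 2) / (K1 + 6) by eexists.
have K6 : 0 < K1 + 6 by rewrite ltr_wpDl.
have e10 : 0 < e1 by rewrite e1E divr_gt0.
have [N1 hN1] := Vc e1 e10.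
have [k1 hk1] := Wc e1 e10.
(* The error is split in five: s1 truncation of the spectral sum at k, s2 replacement
   of s by the cut ramp, s3 the summation formula, s4 the correction factors J, s5 truncation of the sum over S at N. *)
have Ytail k m : (k1 <= k)%N -> (k <= m)%N -> normc (spectral_sum a m z - spectral_sum a k z) <= e1.
  move=> kk km; rewrite /spectral_sum (big_spectrum_split _ lfa km) addrAC subrr add0r.
  apply: le_trans (normc_sum _ _ _) _.
  apply: (@le_trans _ _ (\sum_(s <- spectrum a m | k%:R < s) t s)).
    rewrite big_seq_cond [leRHS]big_seq_cond; apply: ler_sum => s /andP[/(mem_spectrum _ _ lfa)[as0 s0 sm] ks].
    rewrite 2!normcM normcR gtr0_norm // normc_cexp /t.
    have -> : Re ((0 +i* (2 * pi * s)) * z) = - c * s by rewrite Re_mul /= -yE cE; ring.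
    rewrite mulrAC [leRHS]mulrC ler_wpM2r ?normc_ge0 // ler_wpM2r ?expR_ge0 //.
    rewrite sqrrD expr1n mul1r; move: (sqr_ge0 s) s0; clear; lra.
  move: (hk1 k kk) (Wle m); rewrite /Wt (big_spectrum_split _ lfa km); clear; lra.
have Q0 : 0 <= \sum_(l <- pts S N1%:R) v l * (1 + normc (w l)).
  by apply: sumr_ge0 => l _; rewrite mulr_ge0 // addr_ge0 // normc_ge0.
move: Q0; set Q := \sum_(l <- pts S N1%:R) v l * _ => Q0.
have [m1 hm1] := ex_nat_ge (((1 + L) * B + K1 * Q) / e1 + 1).
pose m := maxn m1 k1.
have mm : ((1 + L) * B + K1 * Q) / e1 + 1 <= m%:R by apply: hm1; exact: leq_maxl.
have mge1 : 1 <= m%:R :> R.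
  by apply: le_trans mm; rewrite lerDr divr_ge0 ?addr_ge0 ?mulr_ge0 ?addr_ge0 // ltW.
have m0 : 0 < m%:R :> R := lt_le_trans ltr01 mge1.
have mQ : (1 + L) * B + K1 * Q <= e1 * m%:R.
  by rewrite [leRHS]mulrC -ler_pdivrMr //; apply: le_trans mm; rewrite lerDl.
have s2 : normc (spectral_sum a m z - integral_atomic a (F m%:R)) <= e1.
  have [sF vF] := tF _ mge1.
  rewrite (integral_atomicE lfa vF).
  have -> : \sum_(s <- pts (atoms a) m%:R) a s * F m%:R s = \sum_(s <- spectrum a m) a s * F m%:R s.
    rewrite /spectrum big_filter [LHS](bigID (fun s => 0 < s)) /= [X in _ + X]big1 ?addr0 // => s.
    by rewrite -leNgt => /(ramp_nonpos mge1)[h _ _]; rewrite /F /cut_ramp h !mul0r mulr0.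
  rewrite /spectral_sum -sumrB; apply: le_trans (normc_sum _ _ _) _.
  apply: (@le_trans _ _ (\sum_(s <- spectrum a m) (1 + L) / m%:R * t s)); last first.
    rewrite -mulr_sumr mulrAC ler_pdivrMr //; apply: le_trans mQ.
    apply: (@le_trans _ _ ((1 + L) * B)); last by rewrite lerDl mulr_ge0.
    by rewrite ler_wpM2l ?addr_ge0 // hB.
  rewrite big_seq [leRHS]big_seq; apply: ler_sum => s /(mem_spectrum _ _ lfa)[as0 s0 sm].
  have -> : s%:C * a s * cexp ((0 +i* (2 * pi * s)) * z) - a s * F m%:R s =
    (a s * cexp (W * s%:C)) * (s - ramp m%:R s * bumpf (m%:R^-1 * s))%:C.
    rewrite /F /cut_ramp complexRB complexRM WE.
    have -> : (0 +i* (2 * pi * s)) * z = (0 +i* (2 * pi)) * z * s%:C.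
      by rewrite [RHS]mulrAC; congr (_ * _); apply: complex_ext => /=; ring.
    ring.
  rewrite 2!normcM normcR normc_cexp Re_mul /= mulr0 subr0 ReW.
  have -> : (1 + L) / m%:R * t s = normc (a s) * expR (- c * s) * ((1 + L) * (1 + s) ^+ 2 / m%:R) by rewrite /t; ring.
  rewrite ler_wpM2l ?mulr_ge0 ?normc_ge0 ?expR_ge0 //.
  have -> : s - ramp m%:R s * bumpf (m%:R^-1 * s) =
    s * ((1 - exp_inv 0 (m%:R * s)) + exp_inv 0 (m%:R * s) * (1 - bumpf (m%:R^-1 * s))) by rewrite /ramp; ring.
  rewrite normrM gtr0_norm //.
  have ms0 : 0 < m%:R * s by rewrite mulr_gt0.
  have E1 := exp_inv0_le1 (m%:R * s); have E0 := exp_inv_ge0 0 (m%:R * s).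
  have b1 : `|1 - exp_inv 0 (m%:R * s)| <= (m%:R * s)^-1.
    by rewrite ger0_norm ?subr_ge0 //; move: (exp_inv0_ge ms0); clear; lra.
  have b2 : `|exp_inv 0 (m%:R * s) * (1 - bumpf (m%:R^-1 * s))| <= L * s / m%:R.
    rewrite normrM ger0_norm // -[leRHS]mul1r ler_pM // (le_trans (hL _)) //.
    by rewrite normrM (gtr0_norm s0) gtr0_norm ?invr_gt0 // -mulrA [s / _]mulrC.
  apply: (@le_trans _ _ (s * ((m%:R * s)^-1 + L * s / m%:R))).
    by rewrite ler_wpM2l ?(ltW s0) //; apply: le_trans (ler_normD _ _) _; exact: lerD.
  have -> : s * ((m%:R * s)^-1 + L * s / m%:R) = (1 + L * s ^+ 2) / m%:R.
    by field; rewrite !gt_eqF.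
  rewrite ler_wpM2r ?invr_ge0 ?(ltW m0) //.
  rewrite mulrDl mul1r; have g1 : 1 <= (1 + s) ^+ 2 by rewrite sqrrD expr1n; move: (sqr_ge0 s) s0; clear; lra.
  have g2 : L * s ^+ 2 <= L * (1 + s) ^+ 2 by rewrite ler_wpM2l // sqrrD expr1n; move: s0; clear; lra.
  move: g1 g2; clear; lra.
have [N2 hN2] := poisson_summation lf TT TS Ta K0 gr (ltW m0) (tF _ mge1) e10.
exists (maxn N1 k1) => N k; rewrite !geq_max => /andP[NN1 _] /andP[_ kk1].
pose N' := maxn N N2.
have NN' : (N <= N')%N := leq_maxl _ _.
have N1N' : (N1 <= N')%N := leq_trans NN1 NN'.
have s1 : normc (spectral_sum a k z - spectral_sum a m z) <= e1.
  have k1m : (k1 <= m)%N := leq_maxr _ _.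
  by case/orP: (leq_total k m) => [km|mk]; [rewrite normc_distC|]; apply: Ytail.
have s3 := hN2 N' (leq_maxr _ _).
have nwi l : normc ((w l) ^- 2) = v l by rewrite normcV normcX.
have s4 : normc (\sum_(l <- pts S N'%:R) fourier (F m%:R) l - \sum_(l <- pts S N'%:R) (w l) ^- 2) <= (K1 + 2) * e1.
  rewrite -sumrB; apply: le_trans (normc_sum _ _ _) _.
  have tE l : normc (fourier (F m%:R) l - (w l) ^- 2) = v l * normc (J m%:R (w l) - 1).
    rewrite fF // -{2}[(w l) ^- 2]mul1r -mulrBl mulrC.
    by rewrite (normcM ((w l) ^- 2)) nwi.
  rewrite (@big_pts_split _ _ S N1%:R N'%:R) ?ler_nat //.
  have -> : (K1 + 2) * e1 = e1 + (K1 + 1) * e1 by ring.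
  apply: lerD.
    apply: (@le_trans _ _ (\sum_(l <- pts S N1%:R) (K1 / m%:R) * (v l * (1 + normc (w l))))).
      apply: ler_sum => l _; rewrite tE; have [_ h] := hJ m%:R (w l) mge1 (Rew l).
      have -> : K1 / m%:R * (v l * (1 + normc (w l))) = v l * (K1 * (1 + normc (w l)) / m%:R) by ring.
      by rewrite ler_wpM2l.
    rewrite -mulr_sumr -/Q mulrAC ler_pdivrMr //; apply: le_trans mQ.
    by rewrite lerDr mulr_ge0 // addr_ge0.
  apply: (@le_trans _ _ (\sum_(l <- pts S N'%:R | N1%:R < `|l|) (K1 + 1) * v l)).
    apply: ler_sum => l _; rewrite tE mulrC ler_wpM2r //.
    have [h _] := hJ m%:R (w l) mge1 (Rew l).
    by apply: le_trans (normcB _ _) _; rewrite normc1 lerD2r.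
  rewrite -mulr_sumr ler_wpM2l ?addr_ge0 //.
  have N1N'r : N1%:R <= N'%:R :> R by rewrite ler_nat.
  have := hN1 N1 (leqnn _); have := Vle N'; rewrite /V (big_pts_split _ lf N1N'r); clear; lra.
have s5 : normc (\sum_(l <- pts S N'%:R) (w l) ^- 2 - \sum_(l <- pts S N%:R) (w l) ^- 2) <= e1.
  have NN'r : N%:R <= N'%:R :> R by rewrite ler_nat.
  rewrite (big_pts_split _ lf NN'r) addrAC subrr add0r.
  apply: le_trans (normc_sum _ _ _) _.
  under eq_bigr do rewrite nwi.
  have := hN1 N NN1; have := Vle N'; rewrite /V (big_pts_split _ lf NN'r); clear; lra.
have -> : resolvent_sum S N z = - (4 * pi ^+ 2)%:C * \sum_(l <- pts S N%:R) (w l) ^- 2.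
  rewrite /resolvent_sum mulr_sumr; apply: eq_bigr => l _.
  have -> : w l = (0 +i* (2 * pi)) * (z - l%:C).
    by rewrite /w WE mulrBr; congr (_ - _); apply: complex_ext => /=; ring.
  have zl0 : z - l%:C != 0.
    apply/eqP => h; have : Im (z - l%:C) = 0 by rewrite h.
    by rewrite Im_sub /= subr0 -yE => y00; rewrite y00 ltxx in y0.
  have i2 : (0 +i* (2 * pi)) ^+ 2 = - (4 * pi ^+ 2)%:C :> C.
    by apply: complex_ext => /=; ring.
  have i20 : - (4 * pi ^+ 2)%:C != 0 :> C by rewrite oppr_eq0 -normc_eq0 normcR gtr0_norm // gt_eqF.
  by rewrite exprMn i2 invfM mulrA mulfV // mul1r exprVn.
rewrite mulNr addrC -mulrBr normcM normcR gtr0_norm // mulrC -ler_pdivlMr //.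
move: s1 s2 s3 s4 s5; set Yk := spectral_sum a k z; set Ym := spectral_sum a m z.
set I := integral_atomic _ _; set P := \sum_(l <- _) fourier _ _.
set D' := \sum_(l <- pts S N'%:R) _; set D := \sum_(l <- pts S N%:R) _ => s1 s2 s3 s4 s5.
have -> : Yk - D = (Yk - Ym) + (Ym - I) + (I - P) + (P - D') + (D' - D) by ring.
have -> : e / (4 * pi ^+ 2) = (K1 + 6) * e1 by rewrite e1E [RHS]mulrC divfK // gt_eqF.
apply: le_trans (normcD _ _) _; apply: le_trans (lerD (normcD _ _) (lexx _)) _.
apply: le_trans (lerD (lerD (normcD _ _) (lexx _)) (lexx _)) _.
apply: le_trans (lerD (lerD (lerD (normcD _ _) (lexx _)) (lexx _)) (lexx _)) _.
rewrite normc_distC in s3; move: s1 s2 s3 s4 s5; clear; lra.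
Qed.

End resolvent_identity.

(** * Series of exponentials in the upper half plane *)

Section dominated_sequences.
Variable R : realType.
Local Notation C := R[i].
Local Notation Re := (@complex.Re R).
Local Notation Im := (@complex.Im R).

(** Convergence with rate: tails of the nondecreasing sequence W serve as majorants for tails of
  other series. *)
Definition increases_to (W : nat -> R) (l : R) :=
  [/\ forall k m, (k <= m)%N -> W k <= W m, forall k, W k <= l &
      forall e, 0 < e -> exists k0, forall k, (k0 <= k)%N -> l - W k <= e].

Lemma ex_increases_to (W : nat -> R) (B : R) : (forall k, W k <= W k.+1) -> (forall k, W k <= B) ->
  exists l, increases_to W l.
Proof.
move=> m b; have [l h1 h2] := nondecreasing_cauchy m b; exists l; split=> //.
by have /nondecreasing_seqP h := m; exact: h.
Qed.

Lemma le_of_forall_pos (x y : R) : (forall e, 0 < e -> x <= y + e) -> x <= y.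
Proof. by move=> h; apply/ler_addgt0Pr. Qed.

Lemma dominated_real_limit (u W : nat -> R) (l : R) : increases_to W l ->
  (forall k m, (k <= m)%N -> `|u m - u k| <= W m - W k) ->
  exists L, forall k, `|u k - L| <= l - W k.
Proof.
move=> [mW Wl cW] du.
have m1 k : u k + W k <= u k.+1 + W k.+1.
  by have := du k k.+1 (leqnSn k); rewrite ler_norml => /andP[]; lra.
have b1 k : u k + W k <= u 0%N + (l - W 0%N) + l.
  by have := du 0%N k (leq0n k); have := Wl k; rewrite ler_norml => ? /andP[]; lra.
have [p [mp p1 p2]] := ex_increases_to m1 b1.
exists (p - l) => k; apply: le_of_forall_pos => e e0.
have [k1 h1] := cW _ (divr_gt0 e0 (ltr0n R 2)); have [k2 h2] := p2 _ (divr_gt0 e0 (ltr0n R 2)).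
pose m := maxn k (maxn k1 k2).
have km : (k <= m)%N by exact: leq_maxl.
have a1 := h1 m (leq_trans (leq_maxl _ _) (leq_maxr _ _)).
have a2 := h2 m (leq_trans (leq_maxr _ _) (leq_maxr _ _)).
have a3 := du k m km; have a4 := Wl m; have a5 := p1 m.
move: a3; rewrite !ler_norml => /andP[a31 a32]; apply/andP; split; lra.
Qed.

Lemma dominated_complex_limit (u : nat -> C) (W : nat -> R) (l : R) : increases_to W l ->
  (forall k m, (k <= m)%N -> normc (u m - u k) <= W m - W k) ->
  exists L : C, forall k, normc (u k - L) <= l - W k.
Proof.
move=> hW du.
have [L1 h1] : exists L, forall k, `|Re (u k) - L| <= l - W k.
  apply: dominated_real_limit => // k m /du; apply: le_trans.
  by rewrite -Re_sub; exact: ler_Re_normc.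
have [L2 h2] : exists L, forall k, `|Im (u k) - L| <= l - W k.
  apply: dominated_real_limit => // k m /du; apply: le_trans.
  by rewrite -Im_sub; exact: ler_Im_normc.
have [mW Wl cW] := hW.
exists (L1 +i* L2) => k; apply: le_of_forall_pos => e e0.
have [k1 hk] := cW _ (divr_gt0 e0 (ltr0n R 2)).
pose m := maxn k k1; have a1 := hk m (leq_maxr _ _); have a2 := du k m (leq_maxl _ _).
have -> : u k - (L1 +i* L2) = (u m - (L1 +i* L2)) - (u m - u k) by ring.
apply: le_trans (normcB _ _) _.
have := normc_le_ReIm (u m - (L1 +i* L2)); rewrite Re_sub Im_sub /=.
by have := h1 m; have := h2 m; have := Wl m; lra.
Qed.

End dominated_sequences.

Section exponential_series.
Variable R : realType.
Local Notation C := R[i].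
Local Notation Im := (@complex.Im R).
Variable a : R -> C.
Hypothesis lfa : locally_finite (atoms a).

Definition exp_freq (s : R) (z : C) : C := cexp ((0 +i* (2 * pi * s)) * z).

Lemma normc_exp_freq s z : normc (exp_freq s z) = expR (- (2 * pi * Im z) * s).
Proof. by rewrite normc_cexp; congr expR; rewrite Re_mul /=; ring. Qed.

Lemma holo_exp_freq s z : holo (exp_freq s) z ((0 +i* (2 * pi * s)) * exp_freq s z).
Proof.
by apply: holo_eq (holo_cexp (holoZ _ (holo_id z))) _; rewrite mulr1.
Qed.

Definition exp_series (u : R -> C) k z := \sum_(s <- spectrum a k) u s * exp_freq s z.

(** A common majorant of the coefficients of the three series used below: the factor (1 + s)^2
  absorbs the powers of s gained by differentiation. *)
Definition exp_weight (h s : R) : R := normc (a s) * ((1 + s) ^+ 2 * expR (- (2 * pi * h) * s)).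

Definition exp_weight_sum h k := \sum_(s <- spectrum a k) exp_weight h s.

Lemma exp_weight_ge0 h s : 0 <= exp_weight h s.
Proof. by apply: mulr_ge0; [exact: normc_ge0|apply: mulr_ge0; [exact: sqr_ge0|exact: expR_ge0]]. Qed.

Definition coef_dominated (Q : R) (u : R -> C) := forall k s, s \in spectrum a k ->
  normc (u s) <= Q * (normc (a s) * (1 + s) ^+ 2).

Lemma normc_exp_term_le Q u h k s z : 0 <= Q -> coef_dominated Q u -> h <= Im z ->
  s \in spectrum a k -> normc (u s * exp_freq s z) <= Q * exp_weight h s.
Proof.
move=> Q0 hu hz sk; have [_ s0 _] := (mem_spectrum k s lfa).1 sk.
rewrite normcM normc_exp_freq /exp_weight.
apply: (@le_trans _ _ (Q * (normc (a s) * (1 + s) ^+ 2) * expR (- (2 * pi * h) * s))).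
  apply: ler_pM; rewrite ?normc_ge0 ?expR_ge0 ?(hu k) // ler_expR.
  by rewrite ler_wpM2r ?(ltW s0) // lerN2 ler_wpM2l // mulr_ge0 ?pi_ge0.
by rewrite -!mulrA.
Qed.

Lemma exp_series_tail Q u h k m z : 0 <= Q -> coef_dominated Q u -> h <= Im z -> (k <= m)%N ->
  normc (exp_series u m z - exp_series u k z) <= Q * (exp_weight_sum h m - exp_weight_sum h k).
Proof.
move=> Q0 hu hz km; rewrite /exp_series /exp_weight_sum !(big_spectrum_split _ lfa km).
rewrite addrAC subrr add0r addrAC subrr add0r.
apply: le_trans (normc_sum _ _ _) _; rewrite mulr_sumr big_seq_cond [leRHS]big_seq_cond.
by apply: ler_sum => s /andP[sk _]; exact: normc_exp_term_le hz sk.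
Qed.

Lemma exp_series_le Q u h k z : 0 <= Q -> coef_dominated Q u -> h <= Im z ->
  normc (exp_series u k z) <= Q * exp_weight_sum h k.
Proof.
move=> Q0 hu hz; apply: le_trans (normc_sum _ _ _) _.
rewrite mulr_sumr big_seq [leRHS]big_seq; apply: ler_sum => s sk.
exact: normc_exp_term_le hz sk.
Qed.

Lemma holo_exp_series u k z :
  holo (exp_series u k) z (exp_series (fun s => (0 +i* (2 * pi * s)) * u s) k z).
Proof.
apply: (holo_eq (d := \sum_(s <- spectrum a k) u s * ((0 +i* (2 * pi * s)) * exp_freq s z))).
  by apply: holo_sum => s; apply: holoZ; exact: holo_exp_freq.
by apply: eq_bigr => s _; rewrite mulrCA mulrA.
Qed.

Hypothesis hexp : forall h : R, 0 < h -> exists2 B : R, 0 <= B & forall k, exp_weight_sum h k <= B.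

Lemma exp_weight_limit : exists Wl : R -> R, forall h, 0 < h -> increases_to (exp_weight_sum h) (Wl h).
Proof.
suff /choice [Wl h] : forall h : R, exists l : R, 0 < h -> increases_to (exp_weight_sum h) l by exists Wl.
move=> h; have [h0|h0] := boolP (0 < h); last by exists 0.
have [B B0 hB] := hexp h0.
have mW k : exp_weight_sum h k <= exp_weight_sum h k.+1.
  rewrite /exp_weight_sum (@big_spectrum_split _ _ a k k.+1) // lerDl sumr_ge0 // => s _.
  exact: exp_weight_ge0.
by have [l hl] := ex_increases_to mW hB; exists l.
Qed.

(** As the spectrum is locally finite, its positive part stays away from 0; so dividing the
  coefficients by s is harmless. *)
Lemma spectral_gap : exists2 e : R, 0 < e & forall k s, s \in spectrum a k -> e <= s.
Proof.
pose r : seq R := [seq s <- pts (atoms a) 1 | 0 < s].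
exists (\big[Num.min/1]_(s <- r) s).
  have : all (fun s => 0 < s) r by apply/allP => s; rewrite mem_filter => /andP[].
  elim: r => [|s r IH]; first by rewrite big_nil.
  by rewrite big_cons lt_min /= => /andP[-> /IH].
move=> k s /(mem_spectrum _ _ lfa)[as0 s0 sk].
have [s1|/ltW s1] := leP s 1; last first.
  apply: le_trans s1; elim: r => [|x r IH]; first by rewrite big_nil.
  by rewrite big_cons ge_min IH orbT.
have : s \in r.
  by rewrite mem_filter s0; apply/mem_pts => //; rewrite gtr0_norm.
elim: r => [|x r IH] //; rewrite inE big_cons ge_min => /orP[/eqP ->|/IH ->]; first by rewrite lexx.
by rewrite orbT.
Qed.

(** Integrating twice: these coefficients belong to the second logarithmic derivative of the
  limit function, divided by 4 pi^2, to its logarithmic derivative, up to a constant, and to its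
  logarithm, up to an affine function. *)
Definition spectral_coef (s : R) : C := s%:C * a s.
Definition log_der_coef (s : R) : C := - (0 +i* (2 * pi)) * a s.
Definition log_coef (s : R) : C := - a s / s%:C.

Lemma spectral_coef_dominated : coef_dominated 1 spectral_coef.
Proof.
move=> k s /(mem_spectrum _ _ lfa)[_ s0 _]; rewrite mul1r normcM normcR gtr0_norm //.
rewrite mulrC ler_wpM2l ?normc_ge0 //; rewrite sqrrD expr1n mul1r; have := sqr_ge0 s; lra.
Qed.

Lemma log_der_coef_dominated : coef_dominated (2 * pi) log_der_coef.
Proof.
move=> k s /(mem_spectrum _ _ lfa)[_ s0 _]; rewrite normcM normc_opp normc_i.
have p0 : 0 <= 2 * pi :> R by rewrite mulr_ge0 ?pi_ge0.
rewrite ger0_norm // ler_wpM2l // ler_peMr ?normc_ge0 //.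
rewrite sqrrD expr1n mul1r; have := sqr_ge0 s; lra.
Qed.

Lemma log_coef_dominated (e : R) : 0 < e -> (forall k s, s \in spectrum a k -> e <= s) ->
  coef_dominated e^-1 log_coef.
Proof.
move=> e0 he k s sk; have es := he k s sk; have [_ s0 _] := (mem_spectrum k s lfa).1 sk.
rewrite normcM normc_opp normcV normcR gtr0_norm // mulrC.
rewrite ler_pM ?normc_ge0 ?invr_ge0 ?(ltW s0) // ?lef_pV2 ?posrE //.
rewrite ler_peMr ?normc_ge0 //; rewrite sqrrD expr1n mul1r; have := sqr_ge0 s; lra.
Qed.

Lemma holo_log_der_series k z : holo (exp_series log_der_coef k) z ((4 * pi ^+ 2)%:C * spectral_sum a k z).
Proof.
apply: holo_eq (holo_exp_series _ _ _) _.
rewrite /exp_series /spectral_sum mulr_sumr; apply: eq_bigr => s _.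
rewrite -[cexp _]/(exp_freq s z) /log_der_coef; move: (exp_freq s z) => E.
have e : (0 +i* (2 * pi * s)) * (- (0 +i* (2 * pi))) = (4 * pi ^+ 2)%:C * s%:C :> C.
  by apply: complex_ext => /=; ring.
by rewrite (mulrA (0 +i* (2 * pi * s))) e; ring.
Qed.

Lemma holo_log_series k z : holo (exp_series log_coef k) z (exp_series log_der_coef k z).
Proof.
apply: holo_eq (holo_exp_series _ _ _) _.
rewrite /exp_series big_seq [RHS]big_seq; apply: eq_bigr => s /(mem_spectrum _ _ lfa)[_ s0 _].
congr (_ * _); rewrite /log_coef /log_der_coef.
have s00 : s%:C != 0 :> C by rewrite -normc_eq0 normcR normr_eq0 gt_eqF.
have -> : (0 +i* (2 * pi * s)) = (0 +i* (2 * pi)) * s%:C :> C by apply: complex_ext => /=; ring.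
by rewrite -mulrA [s%:C * _]mulrC divfK // mulrN mulNr.
Qed.

Lemma log_series_limit : exists H : C -> C, exists2 Q : R, 0 <= Q & forall h, 0 < h -> forall Wh,
  increases_to (exp_weight_sum h) Wh -> forall z k, h <= Im z ->
  normc (exp_series log_coef k z - H z) <= Q * (Wh - exp_weight_sum h k) /\ normc (H z) <= Q * Wh.
Proof.
have [Wl hWl] := exp_weight_limit; have [e e0 he] := spectral_gap.
have dl := log_coef_dominated e0 he.
have Q0 : 0 <= e^-1 by rewrite invr_ge0 ltW.
suff /choice [H hH] : forall z : C, exists L : C, 0 < Im z -> forall k,
    normc (exp_series log_coef k z - L) <= e^-1 * Wl (Im z) - e^-1 * exp_weight_sum (Im z) k.
  exists H, e^-1 => // h h0 Wh [mW Wle Wc] z k hz.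
  have z0 : 0 < Im z := lt_le_trans h0 hz.
  have [mW' Wle' Wc'] := hWl _ z0.
  have cl : forall j, normc (exp_series log_coef j z - H z) <= e^-1 * (Wh - exp_weight_sum h j).
    move=> j; apply: le_of_forall_pos => d d0.
    have [k1 hk1] := Wc' (d * e) (mulr_gt0 d0 e0).
    pose m := maxn j k1.
    have := exp_series_tail Q0 dl hz (leq_maxl j k1 : (j <= m)%N).
    have := hH z z0 m; rewrite -mulrBr => b1 b2.
    have b3 : e^-1 * (Wl (Im z) - exp_weight_sum (Im z) m) <= d.
      by rewrite mulrC ler_pdivrMr // hk1 // leq_maxr.
    have -> : exp_series log_coef j z - H z = (exp_series log_coef m z - H z) - (exp_series log_coef m z - exp_series log_coef j z) by ring.
    apply: le_trans (normcB _ _) _.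
    have : e^-1 * (exp_weight_sum h m - exp_weight_sum h j) <= e^-1 * (Wh - exp_weight_sum h j).
      by rewrite ler_wpM2l // lerD2r.
    lra.
  split => //.
  have := exp_series_le k Q0 dl hz; have := cl k => b1 b2.
  have -> : H z = exp_series log_coef k z - (exp_series log_coef k z - H z) by ring.
  apply: le_trans (normcB _ _) _; rewrite mulrBr in b1; lra.
move=> z; have [z0|z0] := boolP (0 < Im z); last by exists 0.
have [mW' Wle' Wc'] := hWl _ z0.
have [L hL] : exists L : C, forall k, normc (exp_series log_coef k z - L) <= e^-1 * Wl (Im z) - e^-1 * exp_weight_sum (Im z) k.
  apply: dominated_complex_limit.
    split.
    - by move=> k m km; rewrite ler_wpM2l // mW'.
    - by move=> k; rewrite ler_wpM2l.
    - move=> d d0; have [k0 hk0] := Wc' (d * e) (mulr_gt0 d0 e0); exists k0 => k kk.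
      by rewrite -mulrBr mulrC ler_pdivrMr // hk0.
  by move=> k m km; rewrite -mulrBr; exact: exp_series_tail.
by exists L.
Qed.

End exponential_series.

(** * Convergence of logarithmic derivatives *)

Section canonical_product.
Variable R : realType.
Local Notation C := R[i].
Local Notation Re := (@complex.Re R).
Local Notation Im := (@complex.Im R).
Variables (S : set R) (a : R -> C).
Hypotheses (lf : locally_finite S) (lfa : locally_finite (atoms a)).
Hypothesis hden : exists2 B : R, 0 <= B & forall N : nat, \sum_(l <- pts S N%:R) (1 + l ^+ 2)^-1 <= B.
Hypothesis hexp : forall h : R, 0 < h -> exists2 B : R, 0 <= B & forall k, exp_weight_sum a h k <= B.
Hypothesis hres : forall z : C, 0 < Im z -> forall e : R, 0 < e -> exists N0, forall N k,
  (N0 <= N)%N -> (N0 <= k)%N ->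
  normc (resolvent_sum S N z + (4 * pi ^+ 2)%:C * spectral_sum a k z) <= e.

Definition resolvent N (z : C) := \sum_(l <- pts S N%:R) (z - l%:C)^-1.

Lemma sub_real_neq0 (z : C) (l : R) : Im z != 0 -> z - l%:C != 0.
Proof.
move=> z0; apply/eqP => h; have : Im (z - l%:C) = 0 by rewrite h.
by rewrite Im_sub /= subr0 => /eqP; rewrite (negPf z0).
Qed.

Lemma holo_resolvent N z : Im z != 0 -> holo (resolvent N) z (- resolvent_sum S N z).
Proof.
move=> z0; rewrite /resolvent_sum -sumrN; apply: holo_sum => l.
have h := holoB (holo_id z) (holo_cst l%:C z).
apply: (holo_eq (@holoV R (fun z => z - l%:C) z _ (sub_real_neq0 l z0) h)).
by rewrite subr0 mulN1r exprVn.
Qed.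

Definition weight_sum N := \sum_(l <- pts S N%:R) (1 + l ^+ 2)^-1.

Lemma weight_limit : exists V, increases_to weight_sum V.
Proof.
have [B B0 hB] := hden; apply: ex_increases_to hB; apply: big_pts_nondecreasing => // l.
by rewrite invr_ge0 addr_ge0 // sqr_ge0.
Qed.

Lemma resolvent_sum_tail (X h : R) (z : C) N M : 0 < h -> `|Re z| <= X -> h <= `|Im z| -> (N <= M)%N ->
  normc (resolvent_sum S M z - resolvent_sum S N z) <=
    poisson_kernel_weight X h * (weight_sum M - weight_sum N).
Proof.
move=> h0 zX zh NM; have NMr : N%:R <= M%:R :> R by rewrite ler_nat.
rewrite /resolvent_sum /weight_sum !(big_pts_split _ lf NMr) addrAC subrr add0r addrAC subrr add0r.
apply: le_trans (normc_sum _ _ _) _; rewrite mulr_sumr; apply: ler_sum => l _.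
rewrite normcX normcV exprVn normc_sqrE Re_sub Im_sub /= subr0.
exact: inverse_dist_sqr_le.
Qed.

(** Both partial sums have tails dominated uniformly on the strip by convergent numerical series;
  so pointwise convergence is uniform. *)
Lemma resolvent_spectral_uniform (X h e : R) : 0 < h -> 0 < e -> exists N0, forall N k,
  (N0 <= N)%N -> (N0 <= k)%N -> forall z : C, `|Re z| <= X -> h <= Im z ->
  normc (resolvent_sum S N z + (4 * pi ^+ 2)%:C * spectral_sum a k z) <= e.
Proof.
move=> h0 e0; have [V [mV Vle Vc]] := weight_limit.
have [Wl hWl] := exp_weight_limit lfa hexp; have [mW Wle Wc] := hWl _ h0.
have [Q QE] : exists Q, Q = poisson_kernel_weight X h by eexists.
have Q0 : 0 <= Q by rewrite QE poisson_kernel_weight_ge0.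
have p0 : 0 < 4 * pi ^+ 2 :> R by rewrite mulr_gt0 // exprn_gt0 // pi_gt0.
have [N1 hN1] := Vc (e / 2 / (Q + 1)) ltac:(by rewrite !divr_gt0 // ltr_wpDl).
have [k1 hk1] := Wc (e / 2 / (4 * pi ^+ 2)) ltac:(by rewrite !divr_gt0).
exists (maxn N1 k1) => N k; rewrite !geq_max => /andP[NN _] /andP[_ kk] z zX zh.
apply: le_of_forall_pos => d d0.
have z0 : 0 < Im z := lt_le_trans h0 zh.
have [N2 hN2] := hres z0 d0.
pose M := maxn N N2; pose m := maxn k N2.
have b1 : normc (resolvent_sum S M z - resolvent_sum S N z) <= e / 2.
  have zh' : h <= `|Im z| by rewrite gtr0_norm.
  apply: le_trans (resolvent_sum_tail h0 zX zh' (leq_maxl _ _)) _; rewrite -QE.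
  apply: (@le_trans _ _ (Q * (e / 2 / (Q + 1)))).
    by rewrite ler_wpM2l // (le_trans _ (hN1 _ NN)) // lerD2r.
  rewrite mulrA ler_pdivrMr ?ltr_wpDl // mulrC ler_wpM2l ?divr_ge0 ?(ltW e0) //.
  by rewrite lerDl.
have b2 : normc ((4 * pi ^+ 2)%:C * (spectral_sum a m z - spectral_sum a k z)) <= e / 2.
  rewrite normcM normcR gtr0_norm // mulrC -ler_pdivlMr //.
  apply: le_trans (exp_series_tail lfa ler01 (spectral_coef_dominated lfa) zh (leq_maxl _ _)) _.
  rewrite mul1r; apply: le_trans (hk1 _ kk).
  by rewrite lerD2r.
have b3 := hN2 M m (leq_maxr _ _) (leq_maxr _ _).
have -> : resolvent_sum S N z + (4 * pi ^+ 2)%:C * spectral_sum a k z =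
  (resolvent_sum S M z + (4 * pi ^+ 2)%:C * spectral_sum a m z) -
  (resolvent_sum S M z - resolvent_sum S N z) - (4 * pi ^+ 2)%:C * (spectral_sum a m z - spectral_sum a k z) by ring.
apply: le_trans (normcB _ _) _; apply: le_trans (lerD (normcB _ _) (lexx _)) _; move: b1 b2 b3; clear -lf lfa hden hexp hres; lra.
Qed.

(** Vertical leg from i, then horizontal leg to z. *)
Lemma two_leg_bound (F f : C -> C) (X h Y e : R) (z : C) : 0 < h -> h <= 1 -> 1 <= Y ->
  `|Re z| <= X -> h <= Im z -> Im z <= Y ->
  (forall z : C, `|Re z| <= X -> h <= Im z -> holo F z (f z) /\ normc (f z) <= e) ->
  normc (F z - F 'i) <= e * (X + Y).
Proof.
move=> h0 h1 Y1 zX zh zY hF.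
have X0 : 0 <= X by apply: le_trans zX.
have e0 : 0 <= e by have [_] := hF z zX zh; apply: le_trans; exact: normc_ge0.
have leg1 : normc (F (0 +i* Im z) - F (0 +i* 1)) <= e * `|Im z - 1|.
  apply: (@holo_vertical R F f) => y /andP[y1 _]; apply: hF => /=; first by rewrite normr0.
  by apply: le_trans y1; rewrite le_min h1 zh.
have leg2 : normc (F (Re z +i* Im z) - F (0 +i* Im z)) <= e * `|Re z - 0|.
  apply: (@holo_horizontal R F f) => x; rewrite ge_min le_max => /andP[x1 x2]; apply: hF => //=.
  have := normr_ge0 (Re z); have := ler_norm (Re z); have := ler_norm (- Re z); rewrite normrN.
  by move=> n1 n2 n3; rewrite ler_norml; case/orP: x1; case/orP: x2; move: zX n1 n2 n3; clear -lf lfa hden hexp hres; lra.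
have -> : F z - F 'i = (F (Re z +i* Im z) - F (0 +i* Im z)) + (F (0 +i* Im z) - F (0 +i* 1)).
  by rewrite addrA subrK; case: (z).
apply: le_trans (normcD _ _) _; apply: le_trans (lerD leg2 leg1) _.
rewrite subr0 -mulrDr ler_wpM2l // lerD //.
rewrite ler_norml; move: h0 zh zY Y1; clear -lf lfa hden hexp hres; lra.
Qed.

(** Integrate the previous convergence from i to z.  The constants of integration are fixed at i:
  there the real part of the resolvent may diverge, and c N compensates for it, whereas its
  imaginary part is minus the sum of 1/(1 + l^2), which converges and yields sigma. *)
Lemma log_derivative_converges : exists (c : nat -> R) (sigma : R), forall X h Y e : R,
  0 < h -> h <= 1 -> 1 <= Y -> 0 < e -> exists N0, forall N k, (N0 <= N)%N -> (N0 <= k)%N ->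
  forall z : C, `|Re z| <= X -> h <= Im z -> Im z <= Y ->
  normc (resolvent N z + (c N)%:C + 'i * sigma%:C - exp_series a (log_der_coef a) k z) <= e.
Proof.
have [V [mV Vle Vc]] := weight_limit.
have [Wl hWl] := exp_weight_limit lfa hexp.
have [mW Wle Wc] := hWl 1 ltr01.
have p0 : 0 < 2 * pi :> R by rewrite mulr_gt0 // pi_gt0.
have [M hM] : exists M : C, forall k, normc (exp_series a (log_der_coef a) k 'i - M) <= 2 * pi * Wl 1 - 2 * pi * exp_weight_sum a 1 k.
  apply: dominated_complex_limit.
    split.
    - by move=> k m km; rewrite ler_wpM2l ?(ltW p0) // mW.
    - by move=> k; rewrite ler_wpM2l ?(ltW p0).
    - move=> d d0; have [k0 hk0] := Wc (d / (2 * pi)) (divr_gt0 d0 p0); exists k0 => k kk.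
      by rewrite -mulrBr mulrC -ler_pdivlMr // hk0.
  move=> k m km; rewrite -mulrBr.
  exact: (exp_series_tail lfa (ltW p0) (log_der_coef_dominated lfa)).
(* With these constants the error at i is the tail of V plus the tail of the series. *)
exists (fun N => - Re (resolvent N 'i) + Re M), (V + Im M) => X h Y e h0 h1 Y1 e0.
have e20 : 0 < e / 4 by rewrite divr_gt0.
have [N1 hN1] := Vc _ e20.
have [k1 hk1] := Wc (e / 4 / (2 * pi)) (divr_gt0 e20 p0).
pose X' := `|X|; have X'0 : 0 <= X' := normr_ge0 X.
have XY0 : 0 < X' + Y by rewrite ltr_wpDl // (lt_le_trans ltr01).
have [N2 hN2] := @resolvent_spectral_uniform X' h (e / 2 / (X' + Y)) h0 ltac:(by rewrite !divr_gt0).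
exists (maxn (maxn N1 k1) N2) => N k; rewrite !geq_max => /andP[/andP[NN1 _] NN2] /andP[/andP[_ kk1] kN2] z zX zh zY.
have zX' : `|Re z| <= X' by apply: le_trans zX (ler_norm _).
pose D z := resolvent N z - exp_series a (log_der_coef a) k z.
have path : normc (D z - D 'i) <= e / 2.
  apply: le_trans (@two_leg_bound D (fun w => - resolvent_sum S N w - (4 * pi ^+ 2)%:C * spectral_sum a k w) X' h Y (e / 2 / (X' + Y)) z h0 h1 Y1 zX' zh zY _) _; last first.
    by rewrite divfK // gt_eqF.
  move=> w wX wh; have w0 : Im w != 0 by rewrite gt_eqF // (lt_le_trans h0).
  split; first exact: (holoB (holo_resolvent N w0) (holo_log_der_series a k w)).
  by rewrite -opprD normc_opp hN2.
have ImL : Im (resolvent N 'i) = - weight_sum N.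
  rewrite /resolvent Im_sum /weight_sum -sumrN; apply: eq_bigr => l _ /=.
  by rewrite -[RHS]mul1r; rewrite /= ?oppr0 ?addr0 ?subr0 ?sub0r; rewrite sqrrN expr1n [l ^+ 2 + 1]addrC; ring.
have base : normc (D 'i + (- Re (resolvent N 'i) + Re M)%:C + 'i * (V + Im M)%:C) <= e / 2.
  have -> : D 'i + (- Re (resolvent N 'i) + Re M)%:C + 'i * (V + Im M)%:C =
     'i * (V - weight_sum N)%:C - (exp_series a (log_der_coef a) k 'i - M).
    apply: complex_ext; rewrite /D !(Re_add, Re_sub, Im_add, Im_sub, Re_mul, Im_mul) ?ImL /=; ring.
  apply: le_trans (normcB _ _) _; rewrite normcM normc_i normr1 mul1r normcR.
  rewrite ger0_norm ?subr_ge0 //.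
  have := hN1 N NN1; have := hM k; rewrite -mulrBr => b1 b2.
  have : 2 * pi * (Wl 1 - exp_weight_sum a 1 k) <= e / 4.
    by rewrite mulrC -ler_pdivlMr // hk1.
  lra.
have -> : resolvent N z + (- Re (resolvent N 'i) + Re M)%:C + 'i * (V + Im M)%:C - exp_series a (log_der_coef a) k z =
   (D z - D 'i) + (D 'i + (- Re (resolvent N 'i) + Re M)%:C + 'i * (V + Im M)%:C) by rewrite /D; ring.
apply: le_trans (normcD _ _) _; move: path base; clear -lf lfa hden hexp hres; lra.
Qed.

End canonical_product.

(** * Finite products with real zeros *)

Section finite_products.
Variable R : realType.
Local Notation C := R[i].
Local Notation Re := (@complex.Re R).
Local Notation Im := (@complex.Im R).
Implicit Types (c l x y : R) (L : seq R) (z w : C).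

(** Exponential times polynomial with zeros L, normalized to be 1 at i.  The real
  exponent c does not affect the growth of the modulus along vertical lines. *)
Definition zero_product c L z : C := cexp (c%:C * (z - 'i)) * \prod_(l <- L) ((z - l%:C) / ('i - l%:C)).

Lemma Im_sub_real z l : Im (z - l%:C) = Im z.
Proof. by rewrite Im_sub /= subr0. Qed.

Lemma Re_sub_real z l : Re (z - l%:C) = Re z - l.
Proof. by rewrite Re_sub. Qed.

Lemma i_sub_real_neq0 l : 'i - l%:C != 0 :> C.
Proof. by apply: sub_real_neq0; rewrite /= oner_neq0. Qed.

Lemma zero_product_base c L : zero_product c L 'i = 1.
Proof.
rewrite /zero_product subrr mulr0 cexp0 mul1r big1 // => l _.
by rewrite divff // i_sub_real_neq0.
Qed.

Lemma normc_zero_product c L z : normc (zero_product c L z) =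
  expR (c * Re z) * \prod_(l <- L) (normc (z - l%:C) / normc ('i - l%:C)).
Proof.
have ReE : Re (c%:C * (z - 'i)) = c * Re z by rewrite Re_mul Re_sub /= mul0r !subr0.
rewrite normcM normc_cexp normc_prod ReE.
by congr (_ * _); apply: eq_bigr => l _; rewrite normcM normcV.
Qed.

Lemma zero_product_cons c l L z : zero_product c (l :: L) z = (z - l%:C) / ('i - l%:C) * zero_product c L z.
Proof. by rewrite /zero_product big_cons mulrCA. Qed.

Lemma holo_zero_product c L z : Im z != 0 ->
  holo (zero_product c L) z ((\sum_(l <- L) (z - l%:C)^-1 + c%:C) * zero_product c L z).
Proof.
move=> z0; elim: L => [|l L IH].
  have h := holo_cexp (holoZ c%:C (holoB (holo_id z) (holo_cst 'i z))).
  have {}h := holoM h (holo_cst 1 z).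
  have E w : cexp (c%:C * (id w - 'i)) * 1 = zero_product c [::] w by rewrite /zero_product big_nil.
  apply: holo_eq (holo_ext E h) _.
  by rewrite -E big_nil; move: (cexp _) => e; ring.
have h := holoM (holoZ ('i - l%:C)^-1 (holoB (holo_id z) (holo_cst l%:C z))) IH.
apply: holo_eq (holo_ext _ h) _ => [w|]; first by rewrite zero_product_cons [_ / _]mulrC.
rewrite zero_product_cons big_cons subr0 mulr1.
have zl := sub_real_neq0 l z0.
move: (zero_product c L z) (\sum_(_ <- _) _) => P s; set w := (_ - l%:C)^-1.
rewrite /= -/w; move: (z - l%:C) zl => u u0.
have -> : (u^-1 + s + c%:C) * (u * w * P) = w * P * (u * u^-1) + (s + c%:C) * (u * w * P) by ring.
by rewrite mulfV // mulr1; ring.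
Qed.

Lemma normc_zero_product_conj c L z : normc (zero_product c L (conjc z)) = normc (zero_product c L z).
Proof.
rewrite !normc_zero_product; congr (_ * _); first by case: (z).
apply: eq_bigr => l _; congr (_ / _); rewrite -[RHS]normc_conj; congr normc.
by apply: complex_ext; case: (z) => ? ? /=; ring.
Qed.

(** Reflecting z across the real axis only changes the phase of the product. *)
Lemma zero_product_reflection c L : exists2 w : C, normc w = 1 &
  forall z, zero_product c L z = w * conjc (zero_product c L (conjc z)).
Proof.
elim: L => [|l L [w w1 IH]].
  exists (cexp (c%:C * (0 -i* 2))).
    by rewrite normc_cexp Re_mul /= mulr0 mul0r subr0 expR0.
  move=> z; rewrite /zero_product !big_nil !mulr1 conjc_cexp -cexpD; congr cexp.
  by apply: complex_ext; case: (z) => ? ? /=; ring.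
exists (conjc ('i - l%:C) / ('i - l%:C) * w).
  by rewrite normcM w1 mulr1 normcM normcV normc_conj mulfV // normc_eq0 i_sub_real_neq0.
move=> z; rewrite !zero_product_cons IH; move: (zero_product c L _) => P; rewrite !conjc_mul.
have -> : conjc (conjc z - l%:C) = z - l%:C by apply: complex_ext; case: (z) => ? ? /=; ring.
have -> : conjc (('i - l%:C)^-1) = (conjc ('i - l%:C))^-1 by exact: fmorphV.
have n0 : conjc ('i - l%:C) != 0 by rewrite -normc_eq0 normc_conj normc_eq0 i_sub_real_neq0.
have n1 := i_sub_real_neq0 l.
move: (conjc P) => P'; move: n0 n1.
by move: (conjc ('i - l%:C)) ('i - l%:C) => u v u0 v0; field; rewrite u0 v0.
Qed.

Lemma ler_normc z w : (normc z <= normc w) = (normc z ^+ 2 <= normc w ^+ 2).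
Proof. by rewrite ler_sqr ?nnegrE ?normc_ge0. Qed.

Lemma normc_sub_real_le x y y' l : `|y| <= `|y'| -> normc (x +i* y - l%:C) <= normc (x +i* y' - l%:C).
Proof.
move=> yy; rewrite ler_normc !normc_sqrE !Re_sub_real !Im_sub_real /= lerD2l.
by rewrite -(real_normK (num_real y)) -(real_normK (num_real y')) ler_sqr ?nnegrE.
Qed.

Lemma ler_prod_seq L (F G : R -> R) : (forall l, l \in L -> 0 <= F l <= G l) ->
  \prod_(l <- L) F l <= \prod_(l <- L) G l.
Proof.
by move=> h; rewrite big_seq [leRHS]big_seq; apply: ler_prod => l; exact: h.
Qed.

(** All zeros are real, so every factor grows in modulus away from the real axis. *)
Lemma zero_product_le c L x y y' : `|y| <= `|y'| ->
  normc (zero_product c L (x +i* y)) <= normc (zero_product c L (x +i* y')).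
Proof.
move=> yy; rewrite !normc_zero_product ler_wpM2l ?expR_ge0 //.
apply: ler_prod_seq => l _; rewrite divr_ge0 ?normc_ge0 //=.
by rewrite ler_wpM2r ?invr_ge0 ?normc_ge0 // normc_sub_real_le.
Qed.

(** An infinite chain of successive primitives passes from f to (z - l) f: integrating by parts
  once per level replaces F_k by (z - l) F_k - k F_(k+1). *)
Definition primitive_tower (f : C -> C) := exists F : nat -> C -> C,
  F 0%N = f /\ forall k z, holo (F k.+1) z (F k z).

Lemma holoX z k : holo (fun z => z ^+ k.+1) z (k.+1%:R * z ^+ k).
Proof.
elim: k => [|k IH].
  by apply: holo_eq (holo_ext _ (holo_id z)) _; [move=> t; rewrite expr1|rewrite expr0 mulr1].
apply: holo_eq (holo_ext _ (holoM (holo_id z) IH)) _; first by move=> t; rewrite [RHS]exprS.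
rewrite mul1r -[X in _ = X]mulr1 [k.+2%:R]mulrS exprS; ring.
Qed.

Lemma primitive_tower_cexp w : primitive_tower (fun z => cexp (w * z)).
Proof.
have [->|w0] := eqVneq w 0.
  exists (fun k z => k`!%:R^-1 * z ^+ k); split.
    by apply/funext => z; rewrite mul0r cexp0 expr0 mulr1 fact0 invr1.
  move=> k z; apply: holo_eq (holoZ _ (holoX z k)) _.
  rewrite factS natrM invfM mulrA; congr (_ * _).
  by rewrite mulrAC mulVf ?mul1r // pnatr_eq0.
exists (fun k z => w ^- k * cexp (w * z)); split.
  by apply/funext => z; rewrite expr0 invr1 mul1r.
move=> k z; apply: holo_eq (holoZ _ (holo_cexp (holoZ w (holo_id z)))) _.
move: (cexp _) => E; rewrite mulr1 exprS invfM.
have -> : w^-1 / w ^+ k * (w * E) = w ^- k * E * (w^-1 * w) by ring.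
by rewrite mulVf // mulr1.
Qed.

Lemma primitive_tower_sub f l : primitive_tower f -> primitive_tower (fun z => (z - l%:C) * f z).
Proof.
move=> [F [F0 hF]]; exists (fun k z => (z - l%:C) * F k z - k%:R * F k.+1 z); split.
  by apply/funext => z; rewrite F0 mul0r subr0.
move=> k z.
apply: holo_eq (holoB (holoM (holoB (holo_id z) (holo_cst l%:C z)) (hF k z)) (holoZ k.+1%:R (hF k.+1 z))) _.
by rewrite subr0 mul1r [k.+1%:R]mulrS; ring.
Qed.

Lemma primitive_towerZ f w : primitive_tower f -> primitive_tower (fun z => w * f z).
Proof.
move=> [F [F0 hF]]; exists (fun k z => w * F k z); split; first by rewrite F0.
by move=> k z; exact: holoZ.
Qed.

(** An explicit primitive makes contour integrals path independent without any appeal to the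
  theorem of Cauchy. *)
Lemma zero_product_primitive c L w : exists F : C -> C, forall z, holo F z (zero_product c L z * cexp (w * z)).
Proof.
suff [F [F0 hF]] : primitive_tower (fun z => zero_product c L z * cexp (w * z)).
  by exists (F 1%N) => z; have := hF 0%N z; rewrite F0.
elim: L => [|l L IH].
  have -> : (fun z => zero_product c [::] z * cexp (w * z)) =
            (fun z => cexp (- c%:C * 'i) * cexp ((c%:C + w) * z)).
    apply/funext => z; rewrite /zero_product big_nil mulr1 -!cexpD; congr cexp; ring.
  exact: primitive_towerZ (primitive_tower_cexp _).
have -> : (fun z => zero_product c (l :: L) z * cexp (w * z)) =
          (fun z => ('i - l%:C)^-1 * ((z - l%:C) * (zero_product c L z * cexp (w * z)))).
  by apply/funext => z; rewrite zero_product_cons; move: (cexp _) => E; ring.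
exact: primitive_towerZ (primitive_tower_sub _ IH).
Qed.

End finite_products.

(** * Convergence of the products *)

Section product_limit.
Variable R : realType.
Local Notation C := R[i].
Local Notation Re := (@complex.Re R).
Local Notation Im := (@complex.Im R).

(** The logarithmic derivative u of F is small on the path from i, hence F is nearly constant. *)
Lemma two_leg_gronwall (F u : C -> C) (X h Y e : R) (z : C) : 0 < h -> h <= 1 -> 1 <= Y ->
  `|Re z| <= X -> h <= Im z -> Im z <= Y ->
  (forall z : C, `|Re z| <= X -> h <= Im z -> Im z <= Y -> holo F z (u z * F z) /\ normc (u z) <= e) ->
  normc (F z - F 'i) <= normc (F 'i) * (expR (e * (X + Y)) - 1).
Proof.
move=> h0 h1 Y1 zX zh zY hF.
have X0 : 0 <= X by apply: le_trans zX.
have e0 : 0 <= e by have [_] := hF z zX zh zY; apply: le_trans; exact: normc_ge0.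
have leg1 : normc (F (0 +i* Im z) - F (0 +i* 1)) <= normc (F (0 +i* 1)) * (expR (e * `|Im z - 1|) - 1).
  apply: (@gronwall R (fun y => F (0 +i* y)) (fun y => 'i * u (0 +i* y)) e) => // y /andP[y1 y2].
    have [] := hF (0 +i* y); rewrite /= ?normr0 //.
    - by apply: le_trans y1; rewrite le_min h1 zh.
    - by apply: (le_trans y2); rewrite ge_max Y1 zY.
    by move=> [_ d] _; apply: cder_eq d _; rewrite mulrA.
  have [] := hF (0 +i* y); rewrite /= ?normr0 //.
  - by apply: le_trans y1; rewrite le_min h1 zh.
  - by apply: (le_trans y2); rewrite ge_max Y1 zY.
  by move=> _ d; rewrite normcM normc_i normr1 mul1r.
have inX x : Num.min 0 (Re z) <= x <= Num.max 0 (Re z) -> `|x| <= X.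
  rewrite ge_min le_max => /andP[x1 x2].
  have := normr_ge0 (Re z); have := ler_norm (Re z); have := ler_norm (- Re z); rewrite normrN.
  by move=> n1 n2 n3; rewrite ler_norml; case/orP: x1; case/orP: x2; move: zX n1 n2 n3; clear; lra.
have leg2 : normc (F (Re z +i* Im z) - F (0 +i* Im z)) <= normc (F (0 +i* Im z)) * (expR (e * `|Re z - 0|) - 1).
  apply: (@gronwall R (fun x => F (x +i* Im z)) (fun x => u (x +i* Im z)) e) => // x /inX xX.
    by have [[d _] _] := hF (x +i* Im z) xX zh zY.
  by have [_ d] := hF (x +i* Im z) xX zh zY.
have -> : F z = F (Re z +i* Im z) by case: (z).
rewrite subr0 in leg2.
have -> : 'i = 0 +i* 1 :> C by [].
move: leg1 leg2; set A := F (0 +i* 1); set B := F (0 +i* Im z); set D := F _.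
have E1 : 1 <= expR (e * `|Im z - 1|) by rewrite -expR0 ler_expR mulr_ge0.
have E2 : 1 <= expR (e * `|Re z|) by rewrite -expR0 ler_expR mulr_ge0.
have E3 : expR (e * `|Im z - 1|) * expR (e * `|Re z|) <= expR (e * (X + Y)).
  rewrite -expRD ler_expR -mulrDr ler_wpM2l // addrC lerD //.
  rewrite ler_norml; move: h0 zh zY Y1; clear; lra.
move: E1 E2 E3; move: (expR (e * `|Im z - 1|)) (expR (e * `|Re z|)) (expR (e * (X + Y))) => u1 u2 u3 E1 E2 E3 l1 l2.
have nB : normc B <= normc A * u1.
  have -> : B = A + (B - A) by rewrite addrC subrK.
  by apply: le_trans (normcD _ _) _; rewrite mulrBr mulr1 in l1; move: l1; clear; lra.
have -> : D - A = (B - A) + (D - B) by ring.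
apply: le_trans (normcD _ _) _; apply: le_trans (lerD l1 l2) _.
have a1 : normc B * (u2 - 1) <= normc A * u1 * (u2 - 1) by rewrite ler_wpM2r // subr_ge0.
have a2 : normc A * (u1 * u2) <= normc A * u3 by rewrite ler_wpM2l ?normc_ge0.
apply: le_trans (lerD (lexx _) a1) _; move: a2; clear; lra.
Qed.

Lemma cexp_perturb (z w : C) (d : R) : normc (z - w) <= d ->
  normc (cexp z - cexp w) <= expR (Re w) * (d * expR d).
Proof.
move=> h; have -> : cexp z - cexp w = cexp w * (cexp (z - w) - 1).
  by rewrite mulrBr mulr1 -cexpD [w + _]addrC subrK.
have d0 : 0 <= d := le_trans (normc_ge0 _) h.
rewrite [normc _]normcM normc_cexp ler_wpM2l ?expR_ge0 //.
apply: le_trans (cexp_sub1 _) _.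
by apply: ler_pM; rewrite ?normc_ge0 ?expR_ge0 ?ler_expR.
Qed.

(** Gives x e^x <= 3 x on [0, 1]. *)
Lemma expR1_le3 : expR 1 <= 3 :> R.
Proof.
have h : expR (- (1/2)) >= 1/2 :> R by have := expR_ge1Dx (- (1/2) : R); lra.
(* e <= (6/5)^6 < 3. *)
have h2 : expR (1/6 : R) <= 6/5.
  have g : 5/6 <= expR (- (1/6) : R) by have := expR_ge1Dx (- (1/6) : R); lra.
  have p := expR_gt0 (- (1/6) : R).
  have -> : expR (1/6 : R) = (expR (- (1/6)))^-1 by rewrite expRN invrK.
  by rewrite -[6/5]invrK lef_pV2 ?posrE //; rewrite invf_div.
have -> : expR 1 = expR (1/6 : R) ^+ 6 by rewrite -expRM_natl; congr expR; field.
apply: (@le_trans _ _ ((6/5) ^+ 6)); first by rewrite lerXn2r ?nnegrE ?expR_ge0 //; lra.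
lra.
Qed.

Variables (S : set R) (a : R -> C).
Hypotheses (lfa : locally_finite (atoms a)).
Hypothesis hexp : forall h : R, 0 < h -> exists2 B : R, 0 <= B & forall k, exp_weight_sum a h k <= B.
Variables (c : nat -> R) (sigma : R) (H : C -> C) (Q : R).
Hypothesis hlog : forall X h Y e : R, 0 < h -> h <= 1 -> 1 <= Y -> 0 < e ->
  exists N0, forall N k, (N0 <= N)%N -> (N0 <= k)%N ->
  forall z : C, `|Re z| <= X -> h <= Im z -> Im z <= Y ->
  normc (resolvent S N z + (c N)%:C + 'i * sigma%:C - exp_series a (log_der_coef a) k z) <= e.
Hypothesis Q0 : 0 <= Q.
Hypothesis hH : forall h, 0 < h -> forall Wh, increases_to (exp_weight_sum a h) Wh ->
  forall z k, h <= Im z ->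
  normc (exp_series a (log_coef a) k z - H z) <= Q * (Wh - exp_weight_sum a h k) /\ normc (H z) <= Q * Wh.

Definition psi (N : nat) : C -> C := zero_product (c N) (pts S N%:R).
Definition psi_limit z := cexp (- sigma%:C - H 'i - 'i * sigma%:C * z + H z).

(** The quotient of psi N by the exponential built on a partial sum of H has a small logarithmic
  derivative, so it stays close to its value at i. *)
Lemma psi_converges (X h Y e : R) : 0 < h -> h <= 1 -> 1 <= Y -> 0 < e ->
  exists N0, forall N, (N0 <= N)%N -> forall z : C, `|Re z| <= X -> h <= Im z -> Im z <= Y ->
  normc (psi N z - psi_limit z) <= e.
Proof.
move=> h0 h1 Y1 e0.
have [Wl hWl] := exp_weight_limit lfa hexp; have [mW Wle Wc] := hWl _ h0.
pose X' := `|X|; have X'0 : 0 <= X' := normr_ge0 X.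
have XY0 : 0 < X' + Y by rewrite ltr_wpDl // (lt_le_trans ltr01).
have [W WE] : exists W, W = Wl h by eexists.
have QW0 : 0 <= Q * W.
  rewrite WE mulr_ge0 // (le_trans _ (Wle 0%N)) // sumr_ge0 // => s _; exact: exp_weight_ge0.
have [B BE] : exists B, B = expR (`|sigma| + `|sigma| * Y + Q * W + Q * W + 1) by eexists.
have B0 : 0 < B by rewrite BE expR_gt0.
(* An exponent off by d <= 1 changes the exponential by at most 3 d B. *)
have [d dE] : exists d, d = Num.min 1 (e / (12 * B)) by eexists.
have d0 : 0 < d by rewrite dE lt_min ltr01 divr_gt0 // mulr_gt0.
have d1 : d <= 1 by rewrite dE ge_min lexx.
have dB : B * (d * 3) <= e / 4.
  have : d <= e / (12 * B) by rewrite dE ge_min lexx orbT.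
  rewrite ler_pdivlMr ?mulr_gt0 //; clear -lfa hexp hlog Q0 hH; lra.
have dd : d * expR d <= d * 3.
  by rewrite ler_wpM2l ?(ltW d0) // (le_trans _ expR1_le3) // ler_expR.
have [N1 hN1] := @hlog X' h Y (d / (X' + Y)) h0 h1 Y1 (divr_gt0 d0 XY0).
have [k1 hk1] := Wc (d / 2 / (Q + 1)) ltac:(by rewrite !divr_gt0 // ltr_wpDl).
pose k := maxn N1 k1.
have kW : Q * (W - exp_weight_sum a h k) <= d / 2.
  apply: (@le_trans _ _ (Q * (d / 2 / (Q + 1)))).
    by rewrite ler_wpM2l // WE hk1 // leq_maxr.
  by rewrite mulrA ler_pdivrMr ?ltr_wpDl // mulrC ler_wpM2l ?divr_ge0 ?(ltW d0) // lerDl.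
exists N1 => N NN1 z zX zh zY.
have zX' : `|Re z| <= X' by apply: le_trans zX (ler_norm _).
have ih : h <= Im 'i by [].
pose Hk := exp_series a (log_coef a) k.
have hWh : increases_to (exp_weight_sum a h) W by rewrite WE; exact: hWl.
have [Hi1 Hi2] := hH h0 hWh k ih; have [Hz1 Hz2] := hH h0 hWh k zh.
pose rho w := psi N w * cexp ('i * sigma%:C * w - Hk w).
pose G := - sigma%:C - H 'i - 'i * sigma%:C * z + H z.
pose Gk := - sigma%:C - Hk 'i - 'i * sigma%:C * z + Hk z.
have ReG : Re G <= `|sigma| + `|sigma| * Y + Q * W + Q * W.
  rewrite /G Re_add !Re_sub Re_opp Re_mul /= !(mul0r, mulr0, mul1r, subr0, sub0r, addr0, add0r).
  have := ler_Re_normc (H 'i); have := Re_le_normc (H z).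
  have := ler_norm (- Re (H 'i)); have := ler_norm (- sigma); rewrite !normrN.
  have : sigma * Im z <= `|sigma| * Y.
    apply: le_trans (ler_norm _) _; rewrite normrM ler_wpM2l //.
    by rewrite gtr0_norm // (lt_le_trans h0).
  move=> a1 a2 a3 a4 a5; move: Hi2 Hz2 a1 a2 a3 a4 a5; clear -lfa hexp hlog Q0 hH; lra.
have GG : normc (Gk - G) <= d.
  have -> : Gk - G = (Hk z - H z) - (Hk 'i - H 'i) by rewrite /Gk /G; ring.
  apply: le_trans (normcB _ _) _; move: Hi1 Hz1 kW; clear -lfa hexp hlog Q0 hH; lra.
have eG : expR (Re G) <= B by rewrite BE ler_expR; move: ReG; clear -lfa hexp hlog Q0 hH; lra.
have eGk : expR (Re Gk) <= B.
  rewrite BE ler_expR; have := Re_le_normc (Gk - G); rewrite Re_sub; move: ReG GG d1; clear -lfa hexp hlog Q0 hH; lra.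
have step1 : normc (cexp Gk - cexp G) <= e / 4.
  apply: le_trans (cexp_perturb GG) _; apply: le_trans dB.
  by apply: ler_pM; rewrite ?expR_ge0 // mulr_ge0 ?expR_ge0 ?(ltW d0).
have rhoi : rho 'i = cexp (- sigma%:C - Hk 'i).
  have ii : 'i * sigma%:C * 'i = - sigma%:C :> C by apply: complex_ext => /=; ring.
  by rewrite /rho /psi zero_product_base ii [LHS]mul1r.
have step2 : normc (rho z - rho 'i) <= normc (rho 'i) * (d * 3).
  have := @two_leg_gronwall rho (fun w => resolvent S N w + (c N)%:C + 'i * sigma%:C - exp_series a (log_der_coef a) k w)
    X' h Y (d / (X' + Y)) z h0 h1 Y1 zX' zh zY.
  rewrite divfK ?gt_eqF // => hg; apply: le_trans (hg _) _; last first.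
    rewrite ler_wpM2l ?normc_ge0 //; apply: le_trans dd.
    have g := expR_ge1Dx (- d); have p := expR_gt0 d.
    have q : expR d * expR (- d) = 1 by rewrite -expRD subrr expR0.
    have : expR d * (1 + - d) <= expR d * expR (- d) by rewrite ler_wpM2l // ltW.
    rewrite q; clear -lfa hexp hlog Q0 hH; lra.
  move=> w wX wh wY; split; last by apply: hN1 => //; exact: leq_maxl.
  have w0 : Im w != 0 by rewrite gt_eqF // (lt_le_trans h0).
  have e1 := holo_cexp (holoB (holoZ ('i * sigma%:C) (holo_id w)) (holo_log_series lfa k w)).
  apply: holo_eq (holoM (holo_zero_product (c N) (pts S N%:R) w0) e1) _.
  rewrite /rho /psi /resolvent /Hk; move: (cexp _) (zero_product _ _ _) => E P; ring.
have E1 : psi N z = rho z * cexp (- ('i * sigma%:C * z - Hk z)).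
  by rewrite /rho -[RHS]mulrA -cexpD subrr cexp0 mulr1.
have E2 : cexp Gk = rho 'i * cexp (- ('i * sigma%:C * z - Hk z)).
  by rewrite rhoi -cexpD /Gk; congr cexp; ring.
have step3 : normc (psi N z - cexp Gk) <= e / 4.
  rewrite E1 E2 -mulrBl normcM.
  apply: (@le_trans _ _ (normc (rho 'i) * (d * 3) * normc (cexp (- ('i * sigma%:C * z - Hk z))))).
    by apply: ler_wpM2r; first exact: normc_ge0.
  rewrite mulrAC -[normc _ * normc _]normcM -E2 normc_cexp.
  by apply: le_trans dB; rewrite ler_wpM2r // mulr_ge0 // ltW.
rewrite -[psi_limit z]/(cexp G).
have -> : psi N z - cexp G = (psi N z - cexp Gk) + (cexp Gk - cexp G) by rewrite addrA subrK.
apply: le_trans (normcD _ _) _; move: step1 step3 e0; clear -lfa hexp hlog Q0 hH; lra.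
Qed.

End product_limit.

(** * Finite exponential sums and truncation of exp H *)

Section exponential_sums.
Variable R : realType.
Local Notation C := R[i].
Local Notation Im := (@complex.Im R).
Local Notation expsum := (seq (C * R)).
Implicit Types (P : expsum) (h r t s : R) (z : C) (p : C * R).

Definition evl P z : C := \sum_(p <- P) p.1 * exp_freq p.2 z.
(** A multiplicative norm; when all frequencies are nonnegative it dominates |evl P| on the half
  plane Im z >= h. *)
Definition wnorm h P : R := \sum_(p <- P) normc p.1 * expR (- (2 * pi * h) * p.2).

Lemma exp_freqD s t z : exp_freq (s + t) z = exp_freq s z * exp_freq t z.
Proof.
rewrite /exp_freq -cexpD -mulrDl; congr (cexp (_ * z)).
by apply: complex_ext => /=; ring.
Qed.

Lemma exp_freq0 z : exp_freq 0 z = 1.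
Proof. by rewrite /exp_freq mulr0 mul0r cexp0. Qed.

Definition scales (k : C) P : expsum := [seq (k * p.1, p.2) | p <- P].
Definition shifts t P : expsum := [seq (p.1, p.2 + t) | p <- P].
Definition muls P P' : expsum := [seq (p.1 * q.1, p.2 + q.2) | p <- P, q <- P'].

Lemma evl_scales k P z : evl (scales k P) z = k * evl P z.
Proof. by rewrite /evl big_map mulr_sumr; apply: eq_bigr => p _ /=; rewrite mulrA. Qed.

Lemma evl_shifts t P z : evl (shifts t P) z = evl P z * exp_freq t z.
Proof.
by rewrite /evl big_map mulr_suml; apply: eq_bigr => p _; rewrite -[RHS]mulrA -exp_freqD.
Qed.

Lemma evl_cat P P' z : evl (P ++ P') z = evl P z + evl P' z.
Proof. by rewrite /evl big_cat. Qed.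

Lemma evl_muls P P' z : evl (muls P P') z = evl P z * evl P' z.
Proof.
rewrite /evl /muls big_allpairs_dep mulr_suml; apply: eq_bigr => p _.
rewrite mulr_sumr; apply: eq_bigr => q _ /=; rewrite exp_freqD.
by move: (exp_freq _ _) (exp_freq _ _) => u v; ring.
Qed.

Lemma wnorm_scales h k P : wnorm h (scales k P) = normc k * wnorm h P.
Proof. by rewrite /wnorm big_map mulr_sumr; apply: eq_bigr => p _; rewrite normcM mulrA. Qed.

Lemma wnorm_muls h P P' : wnorm h (muls P P') = wnorm h P * wnorm h P'.
Proof.
rewrite /wnorm /muls big_allpairs_dep mulr_suml; apply: eq_bigr => p _.
rewrite mulr_sumr; apply: eq_bigr => q _; rewrite normcM mulrDr expRD.
by move: (expR _) (expR _) (normc _) (normc _) => ? ? ? ?; ring.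
Qed.

Lemma wnorm_ge0 h P : 0 <= wnorm h P.
Proof. by apply: sumr_ge0 => p _; apply: mulr_ge0; [exact: normc_ge0|exact: expR_ge0]. Qed.

Fixpoint powers P n : expsum := if n is n'.+1 then muls P (powers P n') else [:: (1, 0)].

Fixpoint exp_taylor P n : expsum :=
  if n is n'.+1 then exp_taylor P n' ++ scales (n'`!%:R)^-1 (powers P n') else [::].

Lemma evl_powers P n z : evl (powers P n) z = evl P z ^+ n.
Proof.
elim: n => [|n IH] /=; last by rewrite evl_muls IH exprS.
by rewrite /evl big_seq1 exp_freq0 mulr1.
Qed.

Lemma wnorm_powers h P n : wnorm h (powers P n) = wnorm h P ^+ n.
Proof.
elim: n => [|n IH] /=; last by rewrite wnorm_muls IH exprS.
by rewrite /wnorm big_seq1 normc1 mulr0 expR0 mulr1.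
Qed.

Lemma evl_exp_taylor P n z : evl (exp_taylor P n) z = \sum_(k < n) evl P z ^+ k / k`!%:R.
Proof.
elim: n => [|n IH]; first by rewrite big_ord0 /evl big_nil.
by rewrite big_ord_recr /= evl_cat IH evl_scales evl_powers; congr (_ + _); exact: mulrC.
Qed.

Lemma normc_natV n : normc ((n%:R : C)^-1) = n%:R^-1.
Proof. by rewrite normcV -(rmorph_nat (@real_complex R)) normcR normr_nat. Qed.

Lemma wnorm_exp_taylor h P n : wnorm h (exp_taylor P n) = \sum_(k < n) wnorm h P ^+ k / k`!%:R.
Proof.
elim: n => [|n IH]; first by rewrite big_ord0 /wnorm big_nil.
rewrite big_ord_recr /= /wnorm big_cat /= -/(wnorm _ _) IH -/(wnorm _ (scales _ _)).
by rewrite wnorm_scales wnorm_powers normc_natV; congr (_ + _); exact: mulrC.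
Qed.

Lemma exp_partial_sum_le (x : R) n : 0 <= x -> \sum_(k < n) x ^+ k / k`!%:R <= expR x.
Proof.
move=> x0; rewrite /expR; have -> : \sum_(k < n) x ^+ k / k`!%:R = series (exp_coeff x) n.
  by rewrite /series /= big_mkord; apply: eq_bigr.
apply: nondecreasing_cvgn_le; last exact: is_cvg_series_exp_coeff.
by apply: nondecreasing_series => k _ _; exact: exp_coeff_ge0.
Qed.

Lemma exp_term_le (x : R) n : 0 <= x -> x ^+ n / n`!%:R <= expR x.
Proof.
move=> x0; apply: le_trans (exp_partial_sum_le n.+1 x0); rewrite big_ord_recr /= lerDr.
by apply: sumr_ge0 => k _; rewrite mulr_ge0 ?invr_ge0 ?exprn_ge0.
Qed.

Lemma exp_freq_decay s r h z : r <= s -> h <= Im z ->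
  normc (exp_freq s z) <= expR (- (2 * pi * r) * (Im z - h)) * expR (- (2 * pi * h) * s).
Proof.
move=> rs hz; rewrite normc_exp_freq -expRD ler_expR.
have : 0 <= 2 * pi * ((s - r) * (Im z - h)) :> R by rewrite !mulr_ge0 ?pi_ge0 // subr_ge0.
lra.
Qed.

Lemma truncation_decay P r h z : h <= Im z ->
  normc (evl P z - evl [seq p <- P | p.2 < r] z) <= expR (- (2 * pi * r) * (Im z - h)) * wnorm h P.
Proof.
move=> hz.
have -> : evl P z - evl [seq p <- P | p.2 < r] z = \sum_(p <- P | ~~ (p.2 < r)) p.1 * exp_freq p.2 z.
  by rewrite /evl big_filter [X in X - _](bigID (fun p => p.2 < r)) /= addrAC subrr add0r.
apply: le_trans (normc_sum _ _ _) _; rewrite /wnorm mulr_sumr.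
rewrite [leRHS](bigID (fun p => p.2 < r)) /= -[leLHS]add0r; apply: lerD.
  by apply: sumr_ge0 => p _; apply: mulr_ge0; [exact: expR_ge0|apply: mulr_ge0; [exact: normc_ge0|exact: expR_ge0]].
apply: ler_sum => p; rewrite -leNgt => rp.
rewrite normcM [leRHS]mulrCA; apply: ler_wpM2l; first exact: normc_ge0.
exact: exp_freq_decay.
Qed.

End exponential_sums.

Section exponential_of_series.
Variable R : realType.
Local Notation C := R[i].
Local Notation Im := (@complex.Im R).
Local Notation expsum := (seq (C * R)).
Variable a : R -> C.
Hypotheses (lfa : locally_finite (atoms a)).
Hypothesis hexp : forall h : R, 0 < h -> exists2 B : R, 0 <= B & forall k, exp_weight_sum a h k <= B.
Variables (H : C -> C) (Q : R).
Hypothesis Q0 : 0 <= Q.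
Hypothesis hH : forall h, 0 < h -> forall Wh, increases_to (exp_weight_sum a h) Wh ->
  forall z k, h <= Im z ->
  normc (exp_series a (log_coef a) k z - H z) <= Q * (Wh - exp_weight_sum a h k) /\ normc (H z) <= Q * Wh.

Lemma exp_series_decay (q r h : R) u k m z : 0 <= q -> coef_dominated a q u -> h <= Im z -> r <= k%:R -> (k <= m)%N ->
  normc (exp_series a u m z - exp_series a u k z) <=
    expR (- (2 * pi * r) * (Im z - h)) * (q * exp_weight_sum a h m).
Proof.
move=> q0 hu hz rk km; rewrite /exp_series (big_spectrum_split _ lfa km) addrAC subrr add0r.
apply: le_trans (normc_sum _ _ _) _; rewrite /exp_weight_sum !mulr_sumr.
rewrite [leRHS](bigID (fun s => k%:R < s)) /= -[leLHS]addr0; apply: lerD; last first.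
  by apply: sumr_ge0 => s _; apply: mulr_ge0; [exact: expR_ge0|apply: mulr_ge0; [exact: q0|exact: exp_weight_ge0]].
rewrite big_seq_cond [leRHS]big_seq_cond; apply: ler_sum => s /andP[sm ks].
rewrite normcM; apply: (@le_trans _ _ (q * (normc (a s) * (1 + s) ^+ 2) *
   (expR (- (2 * pi * r) * (Im z - h)) * expR (- (2 * pi * h) * s)))).
  apply: ler_pM; [exact: normc_ge0|exact: normc_ge0|exact: hu sm|].
  by apply: exp_freq_decay hz; apply: le_trans rk (ltW ks).
rewrite /exp_weight; move: (expR _) (expR _) (normc _) => E1 E2 A.
by have -> : q * (A * (1 + s) ^+ 2) * (E2 * E1) = E2 * (q * (A * ((1 + s) ^+ 2 * E1))) by ring.
Qed.

Lemma exp_series_first (g q h : R) u k z : 0 <= q -> coef_dominated a q u -> h <= Im z ->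
  (forall k s, s \in spectrum a k -> g <= s) ->
  normc (exp_series a u k z) <= expR (- (2 * pi * g) * (Im z - h)) * (q * exp_weight_sum a h k).
Proof.
move=> q0 hu hz hg; rewrite /exp_series.
apply: le_trans (normc_sum _ _ _) _; rewrite /exp_weight_sum !mulr_sumr.
rewrite big_seq [leRHS]big_seq; apply: ler_sum => s sm.
rewrite normcM; apply: (@le_trans _ _ (q * (normc (a s) * (1 + s) ^+ 2) *
   (expR (- (2 * pi * g) * (Im z - h)) * expR (- (2 * pi * h) * s)))).
  apply: ler_pM; [exact: normc_ge0|exact: normc_ge0|exact: hu sm|].
  by apply: exp_freq_decay hz; apply: hg sm.
rewrite /exp_weight; move: (expR _) (expR _) (normc _) => E1 E2 A.
by have -> : q * (A * (1 + s) ^+ 2) * (E2 * E1) = E2 * (q * (A * ((1 + s) ^+ 2 * E1))) by ring.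
Qed.

(** The exponential of a series of exponentials agrees, up to frequencies beyond r, with a finite
  exponential sum: expand exp as a power series, whose terms of high order carry only high
  frequencies.  The constant is uniform in r, which later lets r tend to infinity. *)
Lemma exp_series_truncation : exists K : R -> R, forall r, 0 < r -> exists2 P : expsum,
  (forall p, p \in P -> p.2 < r) & forall h, 0 < h -> forall z, h <= Im z ->
  normc (cexp (H z) - evl P z) <= K h * expR (- (2 * pi * r) * (Im z - h)).
Proof.
have [Wl hWl] := exp_weight_limit lfa hexp.
have [g g0 hg] := spectral_gap lfa.
have dl := log_coef_dominated lfa g0 hg.
have q0 : 0 <= g^-1 by rewrite invr_ge0 ltW.
pose B h := (Q + g^-1) * Wl h.
exists (fun h => expR (B h) * (B h * expR (B h)) + expR (B h) * expR (B h) + expR (B h)) => r r0.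
(* The series is cut at k >= r and the power series at n with n g >= r, g the spectral gap. *)
have [k0 hk0] := ex_nat_ge r; have rk := hk0 k0 (leqnn _); move: rk => {hk0}; set k := k0 => rk.
have [n0 hn0] := ex_nat_ge (r / g); have := hn0 n0 (leqnn _); move=> {hn0}; set n := n0.
rewrite ler_pdivrMr // => rn.
pose L : expsum := [seq (log_coef a s, s) | s <- spectrum a k].
have evL z : evl L z = exp_series a (log_coef a) k z by rewrite /evl big_map.
exists [seq p <- exp_taylor L n | p.2 < r] => [p|h h0 z hz]; first by rewrite mem_filter => /andP[].
have hW := hWl _ h0; have [mW Wle Wc] := hW.
have wk0 j : 0 <= exp_weight_sum a h j by apply: sumr_ge0 => s _; exact: exp_weight_ge0.
have W0 : 0 <= Wl h := le_trans (wk0 0%N) (Wle 0%N).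
have BQ : Q * Wl h <= B h by rewrite /B ler_wpM2r // lerDl.
have Bg j : g^-1 * exp_weight_sum a h j <= B h.
  rewrite /B; apply: (@le_trans _ _ (g^-1 * Wl h)); first by rewrite ler_wpM2l // Wle.
  by rewrite ler_wpM2r // lerDr.
have [b bE] : exists b, b = B h by eexists.
rewrite -bE in BQ Bg *.
have b0 : 0 <= b by apply: le_trans BQ; rewrite mulr_ge0.
have [E EE] : exists E, E = expR (- (2 * pi * r) * (Im z - h)) by eexists.
have E0 : 0 <= E by rewrite EE expR_ge0.
have E1 : E <= 1.
  by rewrite EE -expR0 ler_expR mulNr oppr_le0 !mulr_ge0 ?pi_ge0 ?(ltW r0) // subr_ge0.
rewrite -EE.
have nHk : normc (evl L z) <= b.
  by rewrite evL; apply: le_trans (exp_series_le lfa k q0 dl hz) (Bg k).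
have s1 : normc (cexp (H z) - cexp (evl L z)) <= expR b * (b * expR b) * E.
  have dH : normc (H z - evl L z) <= E * b.
    apply: le_of_forall_pos => d d0.
    have [m1 hm1] := Wc (d / (Q + 1)) ltac:(by rewrite divr_gt0 // ltr_wpDl).
    pose m := maxn k m1.
    have [c1 _] := hH h0 hW m hz.
    have c2 := exp_series_decay q0 dl hz rk (leq_maxl k m1 : (k <= m)%N).
    rewrite -EE in c2.
    have c3 : E * (g^-1 * exp_weight_sum a h m) <= E * b by rewrite ler_wpM2l.
    have c4 : Q * (Wl h - exp_weight_sum a h m) <= d.
      apply: (@le_trans _ _ (Q * (d / (Q + 1)))).
        by rewrite ler_wpM2l // hm1 // leq_maxr.
      by rewrite mulrA ler_pdivrMr ?ltr_wpDl // mulrC ler_wpM2l ?(ltW d0) // lerDl.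
    rewrite normc_distC in c1; rewrite evL.
    have -> : H z - exp_series a (log_coef a) k z = (H z - exp_series a (log_coef a) m z) +
      (exp_series a (log_coef a) m z - exp_series a (log_coef a) k z) by rewrite addrA subrK.
    apply: le_trans (normcD _ _) _; lra.
  apply: le_trans (cexp_perturb dH) _.
  have -> : expR b * (b * expR b) * E = expR b * ((E * b) * expR b) by move: (expR b) => e; ring.
  have Eb : E * b <= b by rewrite ler_piMl.
  have Eb0 : 0 <= E * b by rewrite mulr_ge0.
  apply: ler_pM; [exact: expR_ge0|by apply: mulr_ge0; [exact: Eb0|exact: expR_ge0]| |].
    by rewrite ler_expR (le_trans (Re_le_normc _)).
  by apply: ler_wpM2l => //; rewrite ler_expR.
have s2 : normc (cexp (evl L z) - evl (exp_taylor L n) z) <= expR b * expR b * E.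
  rewrite evl_exp_taylor; apply: le_trans (cexp_taylor _ _) _.
  have first : normc (evl L z) <= expR (- (2 * pi * g) * (Im z - h)) * b.
    rewrite evL; apply: le_trans (exp_series_first k q0 dl hz hg) _.
    by rewrite ler_wpM2l ?expR_ge0.
  apply: (@le_trans _ _ ((expR (- (2 * pi * g) * (Im z - h)) * b) ^+ n / n`!%:R * expR b)).
    apply: ler_pM; [|exact: expR_ge0| |by rewrite ler_expR].
      by apply: mulr_ge0; [apply: exprn_ge0; exact: normc_ge0|rewrite invr_ge0].
    apply: ler_wpM2r; first by rewrite invr_ge0.
    apply: lerXn2r => //; rewrite nnegrE; first exact: normc_ge0.
    by apply: mulr_ge0; first exact: expR_ge0.
  rewrite exprMn -expRM_natl.
  have : expR (n%:R * (- (2 * pi * g) * (Im z - h))) <= E.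
    rewrite EE ler_expR.
    have : 0 <= 2 * pi * ((n%:R * g - r) * (Im z - h)) :> R by rewrite !mulr_ge0 ?pi_ge0 // subr_ge0.
    lra.
  have := exp_term_le n b0; have := expR_ge0 b; have := expR_ge0 (n%:R * (- (2 * pi * g) * (Im z - h))).
  move: (expR b) (expR _) => e f f0 e0 hn fE.
  have -> : f * b ^+ n / n`!%:R * e = (b ^+ n / n`!%:R) * f * e by ring.
  have -> : e * e * E = e * E * e by ring.
  by rewrite ler_wpM2r // ler_pM // mulr_ge0 ?exprn_ge0 ?invr_ge0.
have s3 := truncation_decay (exp_taylor L n) r hz.
have wL : wnorm h L <= b.
  apply: le_trans (Bg k); rewrite /wnorm big_map /exp_weight_sum mulr_sumr big_seq [leRHS]big_seq.
  apply: ler_sum => s sk /=; have := dl k s sk.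
  rewrite /exp_weight; have := expR_ge0 (- (2 * pi * h) * s); move: (expR _) (normc _) (normc _) => e D A e0 hA.
  have -> : g^-1 * (D * ((1 + s) ^+ 2 * e)) = g^-1 * (D * (1 + s) ^+ 2) * e by ring.
  by rewrite ler_wpM2r.
have wT : wnorm h (exp_taylor L n) <= expR b.
  rewrite wnorm_exp_taylor; apply: le_trans (exp_partial_sum_le n (wnorm_ge0 h L)) _.
  by rewrite ler_expR.
rewrite -EE in s3; have s4 : E * wnorm h (exp_taylor L n) <= E * expR b by rewrite ler_wpM2l.
have -> : cexp (H z) - evl [seq p <- exp_taylor L n | p.2 < r] z =
  (cexp (H z) - cexp (evl L z)) + (cexp (evl L z) - evl (exp_taylor L n) z) +
  (evl (exp_taylor L n) z - evl [seq p <- exp_taylor L n | p.2 < r] z) by rewrite !addrA !subrK.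
apply: le_trans (normcD _ _) _; apply: le_trans (lerD (normcD _ _) (lexx _)) _.
rewrite !mulrDl; apply: lerD; first exact: lerD.
by apply: le_trans s3 _; rewrite [leRHS]mulrC.
Qed.

End exponential_of_series.

(** * Mean values and coefficients *)

Section mean_values.
Variable R : realType.
Local Notation C := R[i].
Local Notation Im := (@complex.Im R).
Local Notation expsum := (seq (C * R)).
Implicit Types (P : expsum) (h r t s T y : R) (z : C) (p : C * R).

(** Lists may repeat a frequency; only these totals determine the function. *)
Definition coefs t P : C := \sum_(p <- P | p.2 == t) p.1.

Lemma coefs_cat t P P' : coefs t (P ++ P') = coefs t P + coefs t P'.
Proof. by rewrite /coefs big_cat. Qed.

Lemma coefs_scales t k P : coefs t (scales k P) = k * coefs t P.
Proof. by rewrite /coefs big_map mulr_sumr. Qed.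

Lemma coefs_filter t P (Q : pred R) : coefs t [seq p <- P | Q p.2] = if Q t then coefs t P else 0.
Proof.
rewrite /coefs big_filter_cond /=.
have [Qt|Qt] := boolP (Q t).
  by apply: eq_bigl => p; case: eqP => [->|]; rewrite ?Qt ?andbF.
by rewrite big1 // => p /andP[Qp /eqP pt]; rewrite pt (negPf Qt) in Qp.
Qed.

Lemma evl_coefs P z : evl P z = \sum_(t <- undup [seq p.2 | p <- P]) coefs t P * exp_freq t z.
Proof.
under eq_bigr do rewrite /coefs mulr_suml.
rewrite (exchange_big_dep xpredT) //= /evl big_seq [RHS]big_seq; apply: eq_bigr => p pP.
rewrite (big_rem p.2) /=; last by rewrite mem_undup map_f.
rewrite eqxx big1_seq ?addr0 // => t /andP[/eqP <-].
by rewrite mem_rem_uniq ?undup_uniq // inE eqxx.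
Qed.

Lemma evl_eq0 P z : (forall t, coefs t P = 0) -> evl P z = 0.
Proof. by move=> h; rewrite evl_coefs big1 // => t _; rewrite h mul0r. Qed.

Lemma eq_coefs_evl P P' z : (forall t, coefs t P = coefs t P') -> evl P z = evl P' z.
Proof.
move=> h; apply/eqP; rewrite -subr_eq0 -mulN1r -evl_scales -evl_cat; apply/eqP/evl_eq0 => t.
by rewrite coefs_cat coefs_scales h mulN1r subrr.
Qed.

Lemma holo_exp_freq_primitive t z : t != 0 ->
  holo (fun z => (0 +i* (2 * pi * t))^-1 * exp_freq t z) z (exp_freq t z).
Proof.
move=> t0; apply: holo_eq (holoZ _ (holo_exp_freq t z)) _.
by rewrite mulrA mulVf ?mul1r // -normc_eq0 normc_i normr_eq0 !mulf_neq0 // gt_eqF // pi_gt0.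
Qed.

(** The coefficient of frequency t is the mean of P e^(-2 pi i t z) along any horizontal line:
  every other frequency has a bounded primitive there. *)
Lemma exponential_sum_primitive P t : exists2 F : C -> C,
  forall z, holo F z (evl P z * exp_freq (- t) z) &
  exists B : R -> R, forall y, 0 <= B y /\
    forall T, normc (F (T +i* y) - F (- T +i* y) - (2 * T)%:C * coefs t P) <= B y.
Proof.
elim: P => [|p P [F hF [B hB]]].
  exists (fun=> 0) => [z|]; first by apply: holo_eq (holo_cst 0 z) _; rewrite /evl big_nil mul0r.
  exists (fun=> 0) => y; split=> // T.
  by rewrite /coefs big_nil mulr0 !subr0 normc0.
have E z : evl (p :: P) z * exp_freq (- t) z = p.1 * exp_freq (p.2 - t) z + evl P z * exp_freq (- t) z.
  by rewrite /evl big_cons mulrDl -[_ * _ * exp_freq (- t) z]mulrA -exp_freqD.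
have [pt|pt] := eqVneq p.2 t.
  exists (fun z => p.1 * z + F z) => [z|].
    apply: holo_eq (holoD (holoZ p.1 (holo_id z)) (hF z)) _.
    by rewrite E pt subrr exp_freq0.
  exists B => y; have [B0 hT] := hB y; split=> // T.
  have -> : p.1 * (T +i* y) + F (T +i* y) - (p.1 * (- T +i* y) + F (- T +i* y)) - (2 * T)%:C * coefs t (p :: P) =
      F (T +i* y) - F (- T +i* y) - (2 * T)%:C * coefs t P.
    rewrite /coefs big_cons pt eqxx.
    have -> : T +i* y = - T +i* y + (2 * T)%:C by apply: complex_ext => /=; ring.
    ring.
  exact: hT.
have pt0 : p.2 - t != 0 by rewrite subr_eq0.
have [w wE] : exists w : C, w = (0 +i* (2 * pi * (p.2 - t)))^-1 by eexists.
exists (fun z => p.1 * (w * exp_freq (p.2 - t) z) + F z) => [z|].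
  rewrite E wE; exact: (holoD (holoZ p.1 (holo_exp_freq_primitive z pt0)) (hF z)).
exists (fun y => 2 * (normc p.1 * (normc w * expR (- (2 * pi * y) * (p.2 - t)))) + B y) => y.
have [B0 hT] := hB y; split=> [|T].
  apply: addr_ge0 => //; apply: mulr_ge0 => //; apply: mulr_ge0; first exact: normc_ge0.
  by apply: mulr_ge0; [exact: normc_ge0|exact: expR_ge0].
set g := fun z => p.1 * (w * exp_freq (p.2 - t) z).
have ng x : normc (g (x +i* y)) = normc p.1 * (normc w * expR (- (2 * pi * y) * (p.2 - t))).
  by rewrite /g !(normcM p.1) (normcM w) normc_exp_freq.
have -> : coefs t (p :: P) = coefs t P by rewrite /coefs big_cons (negPf pt).
have -> : g (T +i* y) + F (T +i* y) - (g (- T +i* y) + F (- T +i* y)) - (2 * T)%:C * coefs t P =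
   (g (T +i* y) - g (- T +i* y)) + (F (T +i* y) - F (- T +i* y) - (2 * T)%:C * coefs t P).
  by move: (g _) (g _) (coefs _ _) => u v k; ring.
apply: le_trans (normcD _ _) _; apply: lerD (hT T).
by apply: le_trans (normcB _ _) _; rewrite !ng; lra.
Qed.

(** The constant B depends neither on T nor on F; dividing by T and letting T grow extracts the
  coefficient up to e. *)
Lemma mean_value_close P t y : exists2 B : R, 0 <= B & forall (F f : C -> C) (T e : R), 0 <= T ->
  (forall x, `|x| <= T -> holo F (x +i* y) (f (x +i* y)) /\
     normc (f (x +i* y) - evl P (x +i* y) * exp_freq (- t) (x +i* y)) <= e) ->
  normc (F (T +i* y) - F (- T +i* y) - (2 * T)%:C * coefs t P) <= B + 2 * T * e.
Proof.
have [G hG [B hB]] := exponential_sum_primitive P t.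
have [B0 hT] := hB y; exists (B y) => // F f T e T0 hF.
have := @holo_horizontal R (fun z => F z - G z) (fun z => f z - evl P z * exp_freq (- t) z) e (- T) T y.
have TT : - T <= T by lra.
rewrite (min_l TT) (max_r TT) => /(_ _)/wrap[].
  move=> x xT; have xT' : `|x| <= T by rewrite ler_norml.
  by have [h1 h2] := hF x xT'; split=> //; exact: (holoB h1 (hG _)).
have -> : `|T - - T| = 2 * T by rewrite opprK ger0_norm ?addr_ge0 //; ring.
move: (hT T); set u := F _; set v := F _; set u' := G _; set v' := G _; set k := _ * coefs _ _ => b1 b2.
have -> : u - v - k = (u' - v' - k) + (u - u' - (v - v')) by ring.
by apply: le_trans (normcD _ _) _; rewrite (mulrC (2 * T)) lerD.
Qed.

Lemma le_of_slope (A B e : R) : (forall T, 1 <= T -> 2 * T * A <= B + 2 * T * e) -> A <= e.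
Proof.
move=> h; apply: le_of_forall_pos => d d0.
pose T := Num.max 1 (`|B| / (2 * d)).
have T1 : 1 <= T by rewrite le_max lexx.
have BT : B <= 2 * T * d.
  apply: le_trans (ler_norm _) _.
  have : `|B| / (2 * d) <= T by rewrite le_max lexx orbT.
  rewrite ler_pdivrMr ?mulr_gt0 //; lra.
have T0 : 0 < 2 * T by rewrite mulr_gt0 // (lt_le_trans ltr01).
rewrite -(ler_pM2l T0) mulrDr; have := h T T1; lra.
Qed.

Lemma le0_of_decay (A K k y0 : R) : 0 < k -> (forall y, y0 <= y -> A <= K * expR (- k * y)) -> A <= 0.
Proof.
move=> k0 h; apply: le_of_forall_pos => d d0; rewrite add0r.
pose y := Num.max y0 (Num.max 1 (`|K| / (k * d))).
have hy : y0 <= y by rewrite le_max lexx.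
have y1 : 1 <= y by rewrite le_max orbC le_max lexx.
have y2 : `|K| / (k * d) <= y by rewrite le_max orbC le_max lexx orbT.
apply: le_trans (h y hy) _.
have ky : 0 < k * y by rewrite mulr_gt0 // (lt_le_trans ltr01).
have e1 : expR (- k * y) <= (k * y)^-1.
  rewrite mulNr expRN lef_pV2 ?posrE ?expR_gt0 //.
  by apply: le_trans (expR_ge1Dx _); rewrite lerDr.
apply: (@le_trans _ _ (`|K| * (k * y)^-1)).
  apply: le_trans (ler_wpM2r (expR_ge0 _) (ler_norm K)) _.
  by rewrite ler_wpM2l.
rewrite ler_pdivrMr //; move: y2; rewrite ler_pdivrMr ?mulr_gt0 //; lra.
Qed.

(** An exponential sum decaying like e^(-2 pi r y) carries no frequency below r: compute its mean
  on a line of large height. *)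
Lemma coefs_eq0_of_decay P r h K t : (forall z, h <= Im z ->
    normc (evl P z) <= K * expR (- (2 * pi * r) * (Im z - h))) ->
  t < r -> coefs t P = 0.
Proof.
move=> hP tr; apply/eqP; rewrite -normc_eq0 eq_le normc_ge0 andbT.
have k0 : 0 < 2 * pi * (r - t) by rewrite !mulr_gt0 ?pi_gt0 // subr_gt0.
apply: (@le0_of_decay _ (K * expR (2 * pi * r * h)) _ h k0) => y hy.
have [F hF _] := exponential_sum_primitive P t.
have [B1 B10 h1] := mean_value_close P t y.
have [B2 B20 h2] := mean_value_close [::] t y.
apply: (@le_of_slope _ (B1 + B2)) => T T1.
have T0 : 0 <= T by lra.
have := h1 F (fun z => evl P z * exp_freq (- t) z) T 0 T0 => /(_ _)/wrap[].
  by move=> x _; split; [exact: hF|rewrite subrr normc0].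
have := h2 F (fun z => evl P z * exp_freq (- t) z) T (K * expR (2 * pi * r * h) * expR (- (2 * pi * (r - t)) * y)) T0 => /(_ _)/wrap[].
  move=> x _; split; first exact: hF.
  rewrite /evl big_nil mul0r subr0 -/(evl _ _) (normcM (evl _ _)) normc_exp_freq.
  have /= := hP (x +i* y) hy => b.
  have := expR_ge0 (- (2 * pi * y) * - t) => e0.
  apply: le_trans (ler_wpM2r e0 b) _.
  rewrite -!mulrA -!expRD le_eqVlt; apply/orP; left; apply/eqP; congr (_ * expR _); ring.
rewrite /coefs big_nil mulr0 subr0 -/(coefs t P).
set u := _ - _; set e := K * _ * _; rewrite mulr0 addr0 => b1 b2.
have -> : 2 * T * normc (coefs t P) = normc ((2 * T)%:C * coefs t P).
  by rewrite normcM normcR ger0_norm // mulr_ge0.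
have -> : (2 * T)%:C * coefs t P = u - (u - (2 * T)%:C * coefs t P) by ring.
by apply: le_trans (normcB _ _) _; lra.
Qed.

(** The increments of a primitive along the lines of height Y and -Y differ by two vertical sides,
  whose contribution does not grow with their distance. *)
Lemma contour_comparison c (L : seq R) t T Y M : 0 <= T -> 0 <= Y ->
  (forall x, `|x| <= T -> normc (zero_product c L (x +i* Y)) <= M) ->
  exists2 F : C -> C, forall z, holo F z (zero_product c L z * exp_freq (- t) z) &
    normc ((F (T +i* Y) - F (- T +i* Y)) - (F (T +i* (- Y)) - F (- T +i* (- Y)))) <=
      4 * Y * (M * expR (2 * pi * `|t| * Y)).
Proof.
move=> T0 Y0 hM.
have [F hF] := zero_product_primitive c L (0 +i* (2 * pi * - t)).
exists F => //.
have side x : `|x| <= T -> normc (F (x +i* Y) - F (x +i* (- Y))) <= (M * expR (2 * pi * `|t| * Y)) * (2 * Y).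
  move=> xT; have YY : - Y <= Y by lra.
  have := @holo_vertical R F (fun z => zero_product c L z * exp_freq (- t) z) (M * expR (2 * pi * `|t| * Y)) (- Y) Y x.
  rewrite (min_l YY) (max_r YY).
  have -> : `|Y - - Y| = 2 * Y by rewrite opprK ger0_norm ?addr_ge0 //; ring.
  apply=> y yY; split; first exact: hF.
  have yY' : `|y| <= Y by rewrite ler_norml.
  rewrite (normcM (zero_product _ _ _)) normc_exp_freq; apply: ler_pM; rewrite ?normc_ge0 ?expR_ge0 //.
    by apply: le_trans (hM x xT); apply: zero_product_le; rewrite (ger0_norm Y0).
  rewrite ler_expR /=; apply: le_trans (ler_norm _) _.
  rewrite normrM !normrN normrM gtr0_norm ?mulr_gt0 ?pi_gt0 //.
  have -> : 2 * pi * `|y| * `|t| = 2 * pi * `|t| * `|y| by ring.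
  by rewrite ler_wpM2l // !mulr_ge0 ?pi_ge0.
have TT : `|T| <= T by rewrite ger0_norm.
have NT : `|- T| <= T by rewrite normrN ger0_norm.
move: (side T TT) (side (- T) NT).
set a1 := F _; set a2 := F _; set a3 := F _; set a4 := F _; move=> b1 b2.
have -> : a1 - a3 - (a2 - a4) = (a1 - a2) - (a3 - a4) by ring.
by apply: le_trans (normcB _ _) _; lra.
Qed.

End mean_values.

(** * The limit is an exponential polynomial *)

Section exponential_polynomial_limit.
Variable R : realType.
Local Notation C := R[i].
Local Notation Re := (@complex.Re R).
Local Notation Im := (@complex.Im R).
Local Notation expsum := (seq (C * R)).
Implicit Types (P : expsum) (h r t s T y : R) (z : C) (p : C * R).

Variables (c : nat -> R) (L : nat -> seq R) (F : C -> C).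
Hypothesis hconv : forall X h Y e : R, 0 < h -> h <= 1 -> 1 <= Y -> 0 < e ->
  exists N0, forall N, (N0 <= N)%N -> forall z : C, `|Re z| <= X -> h <= Im z -> Im z <= Y ->
  normc (zero_product (c N) (L N) z - F z) <= e.
Variables (s0 K0 : R) (K : R -> R).
Hypotheses (s00 : 0 < s0) (K00 : 0 <= K0).
Hypothesis hgrow : forall z, 1 <= Im z -> normc (F z) <= K0 * expR (2 * pi * s0 * Im z).
Hypothesis htrunc : forall r, s0 < r -> exists2 P : expsum, (forall p, p \in P -> p.2 < r) &
  forall h, 0 < h -> forall z, h <= Im z ->
  normc (F z - evl P z) <= K h * expR (- (2 * pi * r) * (Im z - h)).

(** On the line of height -Y the products have the same modulus as at height Y, so of
  order at most e^(2 pi s0 Y), while e^(-2 pi i t z) brings the factor e^(-2 pi t Y): their mean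
  there tends to 0 as Y grows if t > s0.  By contour_comparison it equals the mean on the line of height Y, which
  approximates the coefficient of frequency t. *)
Lemma coefs_eq0_high P r t : s0 < t -> t < r ->
  (forall z, 1 <= Im z -> normc (F z - evl P z) <= K 1 * expR (- (2 * pi * r) * (Im z - 1))) ->
  coefs t P = 0.
Proof.
move=> st tr hP; apply/eqP; rewrite -normc_eq0 eq_le normc_ge0 andbT.
have p0 : 0 < 2 * pi :> R by rewrite mulr_gt0 // pi_gt0.
(* k is the slower of the two rates: truncation error above, decay of the mean below. *)
have [k kE] : exists k, k = Num.min (2 * pi * (r - t)) (2 * pi * (t - s0)) by eexists.
have k0 : 0 < k by rewrite kE lt_min !(mulr_gt0 p0) // subr_gt0.
have k1 : k <= 2 * pi * (r - t) by rewrite kE ge_min lexx.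
have k2 : k <= 2 * pi * (t - s0) by rewrite kE ge_min lexx orbT.
have K1 : 0 <= K 1.
  have := hP 'i (lexx _); rewrite subrr mulr0 expR0 mulr1; exact: le_trans (normc_ge0 _).
apply: (@le0_of_decay _ _ (1 + K 1 * expR (2 * pi * r) + (K0 + 1)) k 1 k0) => Y Y1.
have Y0 : 0 <= Y := le_trans ler01 Y1.
have [B1 B10 h1] := mean_value_close P t Y.
have [B2 B20 h2] := mean_value_close [::] t (- Y).
pose M := K0 * expR (2 * pi * s0 * Y) + 1.
apply: (@le_of_slope _ _ (B1 + B2 + 4 * Y * (M * expR (2 * pi * `|t| * Y)))) => T T1.
have T0 : 0 <= T := le_trans ler01 T1.
pose e := expR (- (2 * pi * r) * Y).
have e0 : 0 < e := expR_gt0 _.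
have rpos : 0 < r := lt_trans s00 (lt_trans st tr).
have e1 : e <= 1 by rewrite /e -expR0 ler_expR mulNr oppr_le0 !mulr_ge0 ?pi_ge0 ?(ltW rpos).
have [N hN] := hconv T ltr01 (lexx 1) Y1 e0; have {}hN := hN N (leqnn _).
pose psi := zero_product (c N) (L N).
have pF x : `|x| <= T -> normc (psi (x +i* Y) - F (x +i* Y)) <= e.
  by move=> xT; apply: hN.
have pM x : `|x| <= T -> normc (psi (x +i* Y)) <= K0 * expR (2 * pi * s0 * Y) + e.
  move=> xT; have -> : psi (x +i* Y) = F (x +i* Y) + (psi (x +i* Y) - F (x +i* Y)) by rewrite addrC subrK.
  by apply: le_trans (normcD _ _) _; apply: lerD (pF x xT); exact: (@hgrow (x +i* Y) Y1).
have [Phi hPhi cont] := contour_comparison t T0 Y0 (fun x xT => le_trans (pM x xT) (lerD (lexx _) e1)).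
rewrite -/M in cont.
have hbot x : `|x| <= T -> normc (psi (x +i* - Y)) <= K0 * expR (2 * pi * s0 * Y) + e.
  move=> xT; apply: le_trans (pM x xT); rewrite /psi -(normc_zero_product_conj _ _ (x +i* Y)).
  exact: lexx.
pose f z := psi z * exp_freq (- t) z.
pose e1' := (e + K 1 * expR (- (2 * pi * r) * (Y - 1))) * expR (2 * pi * t * Y).
pose e2' := (K0 * expR (2 * pi * s0 * Y) + e) * expR (- (2 * pi * t) * Y).
have {}top : normc (Phi (T +i* Y) - Phi (- T +i* Y) - (2 * T)%:C * coefs t P) <= B1 + 2 * T * e1'.
  apply: (h1 Phi f) => // x xT; split; first exact: hPhi.
  rewrite /f -mulrBl (normcM (psi _ - _)) normc_exp_freq /e1'.
  have -> : - (2 * pi * Y) * - t = 2 * pi * t * Y by ring.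
  apply: ler_wpM2r; first exact: expR_ge0.
  have -> : psi (x +i* Y) - evl P (x +i* Y) = (psi (x +i* Y) - F (x +i* Y)) + (F (x +i* Y) - evl P (x +i* Y)).
    by rewrite addrA subrK.
  by apply: le_trans (normcD _ _) _; apply: lerD (pF x xT) _; exact: (hP (x +i* Y) Y1).
have bot : normc (Phi (T +i* - Y) - Phi (- T +i* - Y) - (2 * T)%:C * coefs t [::]) <= B2 + 2 * T * e2'.
  apply: (h2 Phi f) => // x xT; split; first exact: hPhi.
  rewrite [evl [::] _]/evl big_nil mul0r subr0 /f (normcM (psi _)) normc_exp_freq /e2'.
  have -> : - (2 * pi * - Y) * - t = - (2 * pi * t) * Y by ring.
  by apply: ler_wpM2r; [exact: expR_ge0|exact: hbot].
rewrite [coefs t [::]]/coefs big_nil mulr0 subr0 in bot.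
have small : e1' + e2' <= (1 + K 1 * expR (2 * pi * r) + (K0 + 1)) * expR (- k * Y).
  have [E EE] : exists E, E = expR (- k * Y) by eexists.
  have f1 : expR (- (2 * pi * r) * Y) * expR (2 * pi * t * Y) <= E.
    rewrite EE -expRD ler_expR; have := ler_wpM2r Y0 k1; clear -hconv s00 K00 hgrow htrunc; lra.
  have f2 : expR (- (2 * pi * r) * (Y - 1)) * expR (2 * pi * t * Y) <= expR (2 * pi * r) * E.
    rewrite EE -!expRD ler_expR; have := ler_wpM2r Y0 k1; clear -hconv s00 K00 hgrow htrunc; lra.
  have f3 : expR (2 * pi * s0 * Y) * expR (- (2 * pi * t) * Y) <= E.
    rewrite EE -expRD ler_expR; have := ler_wpM2r Y0 k2; clear -hconv s00 K00 hgrow htrunc; lra.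
  have f4 : expR (- (2 * pi * r) * Y) * expR (- (2 * pi * t) * Y) <= E.
    rewrite EE -expRD ler_expR; have := ler_wpM2r Y0 k2.
    have : 0 <= 2 * pi * ((s0 + r) * Y) by rewrite !mulr_ge0 ?pi_ge0 ?addr_ge0 ?(ltW s00) ?(ltW rpos).
    clear -hconv s00 K00 hgrow htrunc; lra.
  rewrite /e1' /e2' /e -EE; move: f1 f2 f3 f4.
  move: (expR (- (2 * pi * r) * Y)) (expR (2 * pi * t * Y)) (expR (- (2 * pi * r) * (Y - 1))) (expR (2 * pi * r))
     (expR (2 * pi * s0 * Y)) (expR (- (2 * pi * t) * Y)) => u1 u2 u3 u4 u5 u6 f1 f2 f3 f4.
  have g2 := ler_wpM2l K1 f2; have g3 := ler_wpM2l K00 f3.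
  move: g2 g3 f1 f4; clear -hconv s00 K00 hgrow htrunc; lra.
have -> : 2 * T * normc (coefs t P) = normc ((2 * T)%:C * coefs t P).
  by rewrite normcM normcR ger0_norm // mulr_ge0.
have T2 : 0 <= 2 * T by rewrite mulr_ge0.
apply: le_trans (lerD (lexx _) (ler_wpM2l T2 small)).
move: top bot cont; set u := Phi _ - Phi _; set v := Phi _ - Phi _; set w := _ * coefs t P => top bot cont.
have -> : w = (u - v) + v - (u - w) by ring.
apply: le_trans (normcB _ _) _; apply: le_trans (lerD (normcD _ _) (lexx _)) _.
rewrite -/psi -/f -/u -/v in cont *; move: top bot cont; clear -hconv s00 K00 hgrow htrunc; lra.
Qed.

(** All truncations have the same coefficients up to s0 and none beyond, so F differs from one
  fixed exponential sum by an error decaying at every exponential rate. *)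
Lemma limit_exp_sum : exists q : expsum, forall z, 0 < Im z -> F z = evl q z.
Proof.
have s01 : s0 < s0 + 1 by rewrite ltrDl.
have [P0 hP0 hF0] := htrunc s01.
pose q : expsum := [seq p <- P0 | p.2 <= s0].
exists q => z z0.
have [h hE] : exists h, h = Im z / 2 by eexists.
have h0 : 0 < h by rewrite hE divr_gt0.
have hz : h < Im z by rewrite hE; lra.
have qP r P : s0 + 1 <= r -> (forall p, p \in P -> p.2 < r) ->
  (forall h, 0 < h -> forall z, h <= Im z ->
  normc (F z - evl P z) <= K h * expR (- (2 * pi * r) * (Im z - h))) -> forall w, evl P w = evl q w.
  move=> rs hP hF w; apply: eq_coefs_evl => t; rewrite (coefs_filter t P0 (fun x => x <= s0)).
  have K1 : 0 <= K 1.
    have := hF 1 ltr01 'i (lexx _); rewrite subrr mulr0 expR0 mulr1; exact: le_trans (normc_ge0 _).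
  have [ts|st] := leP t s0.
    have tr : t < s0 + 1 by lra.
    apply/eqP; rewrite -subr_eq0 -mulN1r -coefs_scales -coefs_cat; apply/eqP.
    apply: (@coefs_eq0_of_decay _ _ (s0 + 1) 1 (K 1 + K 1)) => // v v1.
    rewrite evl_cat evl_scales mulN1r.
    have -> : evl P v - evl P0 v = (F v - evl P0 v) - (F v - evl P v) by ring.
    apply: le_trans (normcB _ _) _; rewrite mulrDl; apply: lerD; first exact: hF0.
    apply: le_trans (hF 1 ltr01 v v1) _; rewrite ler_wpM2l // ler_expR.
    have : 0 <= 2 * pi * ((r - (s0 + 1)) * (Im v - 1)) by rewrite !mulr_ge0 ?pi_ge0 // subr_ge0.
    clear -hconv s00 K00 hgrow htrunc; lra.
  have [tr|rt] := ltP t r; first exact: (coefs_eq0_high st tr (hF 1 ltr01)).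
  rewrite /coefs big1_seq // => p /andP[/eqP pt /hP]; rewrite pt => /(le_lt_trans rt).
  by rewrite ltxx.
apply/eqP; rewrite -subr_eq0 -normc_eq0 eq_le normc_ge0 andbT.
have k0 : 0 < 2 * pi * (Im z - h) by rewrite !mulr_gt0 ?pi_gt0 // subr_gt0.
apply: (@le0_of_decay _ _ (K h) _ (s0 + 1) k0) => r rs.
have [P hP hF] := htrunc (lt_le_trans s01 rs).
rewrite -(qP r P rs hP hF z).
have -> : - (2 * pi * (Im z - h)) * r = - (2 * pi * r) * (Im z - h) by ring.
by apply: hF => //; exact: ltW.
Qed.

End exponential_polynomial_limit.

Section reflected_limit.
Variable R : realType.
Local Notation C := R[i].
Local Notation Re := (@complex.Re R).
Local Notation Im := (@complex.Im R).
Local Notation expsum := (seq (C * R)).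
Variables (c : nat -> R) (L : nat -> seq R) (q : expsum).
Hypothesis hconv : forall X h Y e : R, 0 < h -> h <= 1 -> 1 <= Y -> 0 < e ->
  exists N0, forall N, (N0 <= N)%N -> forall z : C, `|Re z| <= X -> h <= Im z -> Im z <= Y ->
  normc (zero_product (c N) (L N) z - evl q z) <= e.

Definition reflection (P : expsum) : expsum := [seq (conjc p.1, - p.2) | p <- P].

Lemma evl_reflection P z : evl (reflection P) z = conjc (evl P (conjc z)).
Proof.
rewrite /evl big_map (big_morph _ (@rmorphD _ _ (@conjc R)) (@rmorph0 _ _ (@conjc R))).
apply: eq_bigr => p _; apply: etrans (esym (conjc_mul _ _)); congr (_ * _).
rewrite /exp_freq conjc_cexp; congr cexp.
by apply: complex_ext; case: (z) => ? ? /=; ring.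
Qed.

(** The phases relating the products to their reflections need not converge a priori; comparing
  means on the lines Im z = 1 and Im z = -1 shows that the coefficients of q and of its reflection
  are proportional. *)
Lemma coefs_reflection t t' :
  coefs t q * coefs t' (reflection q) = coefs t' q * coefs t (reflection q).
Proof.
have key u e : 0 < e -> exists N0, forall N, (N0 <= N)%N -> forall w, 
    (forall z, zero_product (c N) (L N) z = w * conjc (zero_product (c N) (L N) (conjc z))) ->
    normc w = 1 -> normc (coefs u q - w * coefs u (reflection q)) <= e.
  move=> e0.
  have [B1 B10 h1] := mean_value_close q u 1.
  have [B2 B20 h2] := mean_value_close (reflection q) u (-1).
  have [E EE] : exists E, E = expR (2 * pi * `|u|) by eexists.
  have E0 : 0 < E by rewrite EE expR_gt0.
  have [A AE] : exists A, A = wnorm 1 q + 1 by eexists.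
  have A0 : 0 <= A by rewrite AE addr_ge0 // wnorm_ge0.
  have [B BE] : exists B, B = B1 + B2 + 4 * 1 * (A * E) by eexists.
  have B0 : 0 <= B by rewrite BE !addr_ge0 // !mulr_ge0 // ltW.
  (* T is so long that the boundary terms B are at most e T. *)
  pose T := Num.max 1 (B / e).
  have T1 : 1 <= T by rewrite le_max lexx.
  have BT : B <= T * e by rewrite -ler_pdivrMr // le_max lexx orbT.
  have T0 : 0 <= T := le_trans ler01 T1.
  have d0 : 0 < Num.min 1 (e / (4 * E)) by rewrite lt_min ltr01 divr_gt0 // mulr_gt0.
  move: d0; set d := Num.min _ _ => d0.
  have d1 : d <= 1 by rewrite ge_min lexx.
  have dE : d * E <= e / 4.
    have : d <= e / (4 * E) by rewrite ge_min lexx orbT.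
    rewrite ler_pdivlMr ?mulr_gt0 //; clear -hconv; lra.
  have [N0 hN] := hconv T ltr01 (lexx 1) (lexx 1) d0.
  exists N0 => N NN w hw w1; have {}hN := hN N NN.
  set psi := zero_product (c N) (L N) in hw hN.
  have pF x : `|x| <= T -> normc (psi (x +i* 1) - evl q (x +i* 1)) <= d.
    by move=> xT; apply: hN.
  have pM x : `|x| <= T -> normc (psi (x +i* 1)) <= A.
    move=> xT; have -> : psi (x +i* 1) = evl q (x +i* 1) + (psi (x +i* 1) - evl q (x +i* 1)) by rewrite addrC subrK.
    apply: le_trans (normcD _ _) _; rewrite AE; apply: lerD (le_trans (pF x xT) d1).
    apply: le_trans (normc_sum _ _ _) _; apply: ler_sum => p _.
    by rewrite normcM normc_exp_freq.
  have [Phi hPhi cont] := contour_comparison u T0 ler01 pM.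
  pose f z := psi z * exp_freq (- u) z.
  have top : normc (Phi (T +i* 1) - Phi (- T +i* 1) - (2 * T)%:C * coefs u q) <= B1 + 2 * T * (d * E).
    apply: (h1 Phi f) => // x xT; split; first exact: hPhi.
    rewrite /f -mulrBl (normcM (psi _ - _)); apply: ler_pM; [exact: normc_ge0|exact: normc_ge0|exact: pF|].
    rewrite normc_exp_freq EE ler_expR /= mulr1 mulrNN ler_wpM2l ?mulr_ge0 ?pi_ge0 //; exact: ler_norm.
  have bot : normc (w^-1 * Phi (T +i* -1) - w^-1 * Phi (- T +i* -1) - (2 * T)%:C * coefs u (reflection q)) <= B2 + 2 * T * (d * E).
    apply: (h2 (fun z => w^-1 * Phi z) (fun z => w^-1 * f z)) => // x xT; split; first exact: (holoZ _ (hPhi _)).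
    have w0 : w != 0 by rewrite -normc_gt0 w1.
    have fE v : w^-1 * f v = conjc (psi (conjc v)) * exp_freq (- u) v.
      by rewrite /f (hw v) -[w * _ * _]mulrA [LHS]mulrA mulVf // mul1r.
    rewrite fE evl_reflection -mulrBl (normcM (_ - _)).
    apply: ler_pM; [exact: normc_ge0|exact: normc_ge0| |].
      rewrite -(rmorphB (@conjc R)) normc_conj.
      have -> : conjc (x +i* -1) = x +i* 1 by apply: complex_ext => /=; ring.
      exact: pF.
    rewrite normc_exp_freq EE ler_expR /=.
    have -> : - (2 * pi * -1) * - u = 2 * pi * - u by ring.
    by rewrite ler_wpM2l ?mulr_ge0 ?pi_ge0 // -normrN ler_norm.
  have bot' : normc (Phi (T +i* -1) - Phi (- T +i* -1) - w * ((2 * T)%:C * coefs u (reflection q))) <= B2 + 2 * T * (d * E).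
    apply: le_trans bot.
    rewrite -[leLHS]mul1r -{1}w1.
    have w0 : w != 0 by rewrite -normc_gt0 w1.
    have wV : normc w^-1 = 1 by rewrite normcV w1 invr1.
    rewrite w1 -{1}wV -normcM; move: (Phi _) (Phi _) (_ * coefs _ _) => b a k.
    have -> : w^-1 * (a - b - w * k) = w^-1 * a - w^-1 * b - (w^-1 * w) * k by ring.
    by rewrite mulVf // mul1r.
  have T2 : 0 < 2 * T by rewrite mulr_gt0 // (lt_le_trans ltr01).
  rewrite -(ler_pM2l T2).
  have -> : 2 * T * normc (coefs u q - w * coefs u (reflection q)) =
    normc ((2 * T)%:C * coefs u q - w * ((2 * T)%:C * coefs u (reflection q))).
    rewrite mulrCA -mulrBr normcM normcR ger0_norm //; exact: ltW.
  rewrite [2 * pi * `|u| * 1]mulr1 -EE in cont; move: top bot' cont.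
  set a := Phi _ - Phi _; set b := Phi _ - Phi _; set k := _ * coefs u q; set k' := w * _ => top bot' cont.
  have -> : k - k' = (a - b) + (b - k') - (a - k) by ring.
  apply: le_trans (normcB _ _) _; apply: le_trans (lerD (normcD _ _) (lexx _)) _.
  have g : 2 * T * (d * E) <= 2 * T * (e / 4) by rewrite ler_wpM2l // ltW.
  rewrite BE in BT; move: top bot' cont g BT; clear -hconv; lra.
apply/eqP; rewrite -subr_eq0 -normc_eq0 eq_le normc_ge0 andbT; apply: le_of_forall_pos => e e0; rewrite add0r.
set D := coefs t' (reflection q); set D' := coefs t (reflection q).
have [d dE] : exists d, d = e / (normc D + normc D' + 1) by eexists.
have DD0 : 0 < normc D + normc D' + 1 by rewrite ltr_wpDl // addr_ge0 // normc_ge0.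
have d0 : 0 < d by rewrite dE divr_gt0.
have [N1 h1] := key t d d0; have [N2 h2] := key t' d d0.
pose N := maxn N1 N2.
have [w w1 hw] := zero_product_reflection (c N) (L N).
have b1 := h1 N (leq_maxl _ _) w hw w1; have b2 := h2 N (leq_maxr _ _) w hw w1.
rewrite -/D -/D' in b1 b2.
have -> : coefs t q * D - coefs t' q * D' = (coefs t q - w * D') * D - (coefs t' q - w * D) * D' by ring.
apply: le_trans (normcB _ _) _; rewrite (normcM _ D) (normcM _ D').
apply: (@le_trans _ _ (d * normc D + d * normc D')).
  by apply: lerD; rewrite ler_wpM2r ?normc_ge0.
rewrite -mulrDr dE mulrAC ler_pdivrMr // ler_wpM2l ?(ltW e0) //; lra.
Qed.

(** By proportionality of coefficients, q is a constant multiple of its reflection. *)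
Lemma evl_neq0_lower : (forall z : C, 0 < Im z -> evl q z != 0) -> forall z : C, Im z < 0 -> evl q z != 0.
Proof.
move=> hq z z0.
have : exists t, coefs t q != 0.
  apply: contrapT => h; have := hq 'i ltr01; rewrite evl_eq0 ?eqxx // => t.
  by apply: contrapT => ht; apply: h; exists t; apply/eqP.
move=> [t ht].
have cz : evl (reflection q) z != 0.
  by rewrite evl_reflection -normc_eq0 normc_conj normc_eq0 hq //; case: (z) z0 => a b /=; rewrite oppr_gt0.
have pr w : coefs t q * evl (reflection q) w = coefs t (reflection q) * evl q w.
  rewrite -!evl_scales; apply: eq_coefs_evl => u; rewrite !coefs_scales.
  by rewrite coefs_reflection mulrC.
apply/negP => /eqP h; have := pr z; rewrite h mulr0 => /eqP.
by rewrite mulf_eq0 (negPf ht) (negPf cz).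
Qed.

End reflected_limit.

(** * Zeros on the real line *)

Section real_zeros.
Variable R : realType.
Local Notation C := R[i].
Local Notation Re := (@complex.Re R).
Local Notation Im := (@complex.Im R).
Local Notation expsum := (seq (C * R)).
Implicit Types (P : expsum) (x y l t : R) (z : C) (L : seq R).

Definition ders P : expsum := [seq ((0 +i* (2 * pi * p.2)) * p.1, p.2) | p <- P].

Lemma exp_freq_taylor t z h : normc h <= 1 ->
  normc (exp_freq t (z + h) - exp_freq t z - h * ((0 +i* (2 * pi * t)) * exp_freq t z)) <=
  normc (exp_freq t z) * (`|2 * pi * t| ^+ 2 * expR `|2 * pi * t|) * normc h ^+ 2.
Proof.
move=> h1; have [w wE] : exists w : C, w = 0 +i* (2 * pi * t) by eexists.
have nw : normc w = `|2 * pi * t| by rewrite wE normc_i.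
rewrite -nw -wE /exp_freq -wE mulrDr cexpD; move: (cexp (w * z)) => E.
have -> : E * cexp (w * h) - E - h * (w * E) = E * (cexp (w * h) - 1 - w * h).
  by move: (cexp _) => e; ring.
rewrite (normcM E) -[leRHS]mulrA; apply: ler_wpM2l; first exact: normc_ge0.
apply: le_trans (cexp_sub1_linear _) _; rewrite normcM.
have wh : normc w * normc h <= normc w by rewrite ler_piMr // normc_ge0.
have : expR (normc w * normc h) <= expR (normc w) by rewrite ler_expR.
move: (normc_ge0 w) (normc_ge0 h) (expR_ge0 (normc w * normc h)).
move: (normc w) (normc h) (expR (normc w)) (expR (normc w * normc h)) => a b e2 e1 a0 b0 e10 ee.
have -> : a ^+ 2 * e2 * b ^+ 2 = (a ^+ 2 * b ^+ 2) * e2 by ring.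
rewrite exprMn; apply: ler_pM => //; first by rewrite mulr_ge0 // mulr_ge0 // sqr_ge0.
have : 0 <= a ^+ 2 * b ^+ 2 by rewrite mulr_ge0 // sqr_ge0.
lra.
Qed.

Lemma evl_taylor P z : exists2 K : R, 0 <= K & forall h, normc h <= 1 ->
  normc (evl P (z + h) - evl P z - h * evl (ders P) z) <= K * normc h ^+ 2.
Proof.
exists (\sum_(p <- P) normc p.1 * (normc (exp_freq p.2 z) * (`|2 * pi * p.2| ^+ 2 * expR `|2 * pi * p.2|))).
  apply: sumr_ge0 => p _; apply: mulr_ge0; first exact: normc_ge0.
  by apply: mulr_ge0; [exact: normc_ge0|apply: mulr_ge0; [exact: sqr_ge0|exact: expR_ge0]].
move=> h h1; rewrite /evl big_map [h * _]mulr_sumr -!sumrB mulr_suml.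
apply: le_trans (normc_sum _ _ _) _; apply: ler_sum => p _ /=.
have -> : p.1 * exp_freq p.2 (z + h) - p.1 * exp_freq p.2 z - h * ((0 +i* (2 * pi * p.2)) * p.1 * exp_freq p.2 z) =
  p.1 * (exp_freq p.2 (z + h) - exp_freq p.2 z - h * ((0 +i* (2 * pi * p.2)) * exp_freq p.2 z)).
  by move: (exp_freq _ _) (exp_freq _ _) => u v; ring.
rewrite (normcM p.1) -[leRHS]mulrA; apply: ler_wpM2l; first exact: normc_ge0.
exact: exp_freq_taylor.
Qed.

Lemma evl_lipschitz P z : exists2 K : R, 0 <= K & forall h, normc h <= 1 ->
  normc (evl P (z + h) - evl P z) <= K * normc h.
Proof.
have [K K0 hK] := evl_taylor P z.
exists (K + normc (evl (ders P) z)) => [|h h1]; first by rewrite addr_ge0 // normc_ge0.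
have -> : evl P (z + h) - evl P z = (evl P (z + h) - evl P z - h * evl (ders P) z) + h * evl (ders P) z by rewrite subrK.
apply: le_trans (normcD _ _) _; rewrite mulrDl; apply: lerD; last by rewrite normcM mulrC.
by apply: le_trans (hK h h1) _; rewrite ler_wpM2l // expr2 ler_piMl // normc_ge0.
Qed.

(** The factor with zero l gives y; the other factors are larger at height 1. *)
Lemma zero_product_small c L l y : l \in L -> 0 <= y <= 1 ->
  normc (zero_product c L (l +i* y)) <= y * normc (zero_product c L (l +i* 1)).
Proof.
move=> lL /andP[y0 y1].
have prodE (f : R -> R) : \prod_(k <- L) f k = f l * \prod_(k <- rem l L) f k by rewrite (big_rem l lL).
rewrite !normc_zero_product !prodE.
rewrite -[Re (l +i* y)]/l -[Re (l +i* 1)]/l.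
have nl u : 0 <= u -> normc (l +i* u - l%:C) = u.
  move=> u0; have -> : l +i* u - l%:C = 0 +i* u by apply: complex_ext => /=; ring.
  by rewrite normc_i ger0_norm.
rewrite !nl //.
have rest : \prod_(k <- rem l L) (normc (l +i* y - k%:C) / normc ('i - k%:C)) <=
            \prod_(k <- rem l L) (normc (l +i* 1 - k%:C) / normc ('i - k%:C)).
  apply: ler_prod_seq => k _; rewrite divr_ge0 ?normc_ge0 //=.
  by rewrite ler_wpM2r ?invr_ge0 ?normc_ge0 // normc_sub_real_le // !ger0_norm.
move: rest; set A := \prod_(k <- _) _; set B := \prod_(k <- _) _ => rest.
have g : 0 <= expR (c * l) * (y / normc ('i - l%:C)) by rewrite mulr_ge0 ?expR_ge0 // divr_ge0 // normc_ge0.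
have := ler_wpM2l g rest; rewrite mul1r.
move: (expR _) (normc _) => e n; rewrite -!mulrA !(mulrCA y) => h.
by apply: le_trans h _; rewrite le_eqVlt; apply/orP; left; apply/eqP; ring.
Qed.

(** With u = (x - l)^2 the squared ratio of the moduli at heights y and 1 is at least u / (u + 1),
  and 1 + 1/u <= e^(1/u) turns this into an exponential, suited to products. *)
Lemma factor_lower_bound x y l d : 0 < d -> d <= `|x - l| ->
  expR (- ((1 + d ^- 2) * ((x - l) ^+ 2 + 1) ^-1)) * normc (x +i* 1 - l%:C) <= normc (x +i* y - l%:C).
Proof.
move=> d0 dx; have [u uE] : exists u, u = (x - l) ^+ 2 by eexists.
have du : d ^+ 2 <= u.
  by rewrite uE -(real_normK (num_real (x - l))) ler_sqr ?nnegrE // ltW.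
have d20 : 0 < d ^+ 2 by rewrite exprn_gt0.
have u0 : 0 < u := lt_le_trans d20 du.
have [v vE] : exists v, v = expR (- ((1 + d ^- 2) * (u + 1)^-1)) by eexists.
have v0 : 0 <= v by rewrite vE expR_ge0.
have v1 : v <= 1.
  by rewrite vE -expR0 ler_expR oppr_le0 mulr_ge0 ?invr_ge0 ?addr_ge0 ?invr_ge0 ?(ltW d20) ?(ltW u0).
have vu : v * (u + 1) <= u.
  have h1 : expR (- u^-1) * (1 + u^-1) <= 1.
    rewrite -[leRHS]expR0 -(subrr u^-1) [X in _ <= expR X]addrC expRD ler_wpM2l ?expR_ge0 //.
    exact: expR_ge1Dx.
  have h2 : v <= expR (- u^-1).
    rewrite vE ler_expR lerN2.
    have -> : u^-1 = (1 + u^-1) * (u + 1)^-1 by field; rewrite !gt_eqF // addr_gt0.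
    rewrite ler_wpM2r ?invr_ge0 ?addr_ge0 ?(ltW u0) // lerD2l lef_pV2 ?posrE //.
  have h3 : v * (1 + u^-1) <= 1.
    by apply: le_trans h1; rewrite ler_wpM2r // addr_ge0 // invr_ge0 ltW.
  have -> : v * (u + 1) = u * (v * (1 + u^-1)) by field; rewrite gt_eqF.
  by rewrite -[leRHS]mulr1 ler_wpM2l // ltW.
rewrite -uE -vE.
have -> : v * normc (x +i* 1 - l%:C) = normc (v%:C * (x +i* 1 - l%:C)) by rewrite normcM normcR ger0_norm.
rewrite ler_normc normcM normcR (ger0_norm v0) exprMn !normc_sqrE !Re_sub_real !Im_sub_real /= -uE expr1n.
have : v ^+ 2 * (u + 1) <= v * (u + 1).
  by rewrite ler_wpM2r ?addr_ge0 ?(ltW u0) // expr2 ler_piMl.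
have := sqr_ge0 y; lra.
Qed.

Lemma prod_except_one L (l0 r : R) (v w : R -> R) : uniq L -> 0 <= r <= 1 ->
  (forall l, 0 <= v l <= 1) -> (forall l, w l = if l == l0 then r else v l) ->
  r * \prod_(l <- L) v l <= \prod_(l <- L) w l.
Proof.
move=> + /andP[r0 r1] hv hw; elim: L => [|l L IH] /=; first by rewrite !big_nil mulr1.
move=> /andP[lL uL]; rewrite !big_cons hw; have /andP[vl0 vl1] := hv l.
have p0 : 0 <= \prod_(k <- L) v k by apply: prodr_ge0 => k _; have /andP[] := hv k.
case: eqP => [e|_]; last by rewrite mulrCA ler_wpM2l // IH.
have -> : \prod_(k <- L) w k = \prod_(k <- L) v k.
  rewrite big_seq [RHS]big_seq; apply: eq_bigr => k kL; rewrite hw; case: eqP => // ke.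
  by rewrite -e in ke; rewrite -ke kL in lL.
by rewrite ler_wpM2l // ler_piMl.
Qed.

(** Between heights 1 and y the product loses a bounded factor, by convergence of the sum of
  1 / (1 + l^2), except for the factor whose zero l0 may be close to x. *)
Lemma zero_product_lower_bound c L x y l0 d B X : uniq L -> 0 < d -> `|x| <= X ->
  (forall l, l \in L -> l != l0 -> d <= `|x - l|) ->
  \sum_(l <- L) (1 + l ^+ 2)^-1 <= B ->
  expR (- ((1 + d ^- 2) * (poisson_kernel_weight X 1 * B))) * `|x - l0| * normc (zero_product c L (x +i* 1)) <=
  normc (zero_product c L (x +i* y)) * normc (x +i* 1 - l0%:C).
Proof.
move=> uL d0 xX hd hB.
have d20 : 0 < d ^+ 2 by rewrite exprn_gt0.
have dd : 0 <= 1 + d ^- 2 by rewrite addr_ge0 // invr_ge0 ltW.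
have [n nE] : exists n, n = normc (x +i* 1 - l0%:C) by eexists.
have n0 : 0 < n by rewrite nE normc_gt0 sub_real_neq0 //= oner_neq0.
have [r rE] : exists r, r = `|x - l0| / n by eexists.
have r0 : 0 <= r by rewrite rE divr_ge0 // ltW.
have rn : r * n = `|x - l0| by rewrite rE divfK // gt_eqF.
have r1 : r <= 1.
  rewrite rE ler_pdivrMr // mul1r nE; have := ler_Re_normc (x +i* 1 - l0%:C).
  by rewrite Re_sub_real.
pose v l := expR (- ((1 + d ^- 2) * ((x - l) ^+ 2 + 1)^-1)).
have q0 l : 0 <= ((x - l) ^+ 2 + 1)^-1 by rewrite invr_ge0 addr_ge0 // sqr_ge0.
have hv l : 0 <= v l <= 1.
  by rewrite expR_ge0 -expR0 ler_expR oppr_le0 mulr_ge0.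
pose w l := if l == l0 then r else v l.
have pr := prod_except_one uL (introT andP (conj r0 r1)) hv (fun l => erefl (w l)).
have vprod : expR (- ((1 + d ^- 2) * (poisson_kernel_weight X 1 * B))) <= \prod_(l <- L) v l.
  rewrite -expR_sum ler_expR sumrN lerN2 -mulr_sumr ler_wpM2l //.
  apply: (@le_trans _ _ (\sum_(l <- L) poisson_kernel_weight X 1 * (1 + l ^+ 2)^-1)).
    apply: ler_sum => l _; rewrite -[X in _ + X](expr1n _ 2); apply: inverse_dist_sqr_le => //.
    by rewrite normr1.
  by rewrite -mulr_sumr ler_wpM2l // poisson_kernel_weight_ge0.
have wprod : (\prod_(l <- L) w l) * normc (zero_product c L (x +i* 1)) <= normc (zero_product c L (x +i* y)).
  have prodM (f g : R -> R) : (\prod_(l <- L) f l) * (\prod_(l <- L) g l) = \prod_(l <- L) (f l * g l) by rewrite big_split.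
  rewrite !normc_zero_product -[Re (x +i* y)]/x -[Re (x +i* 1)]/x mulrCA prodM.
  apply: ler_wpM2l; first exact: expR_ge0.
  apply: ler_prod_seq => l lL; apply/andP; split.
    rewrite mulr_ge0 ?divr_ge0 ?normc_ge0 // /w; case: ifP => // _; by have /andP[] := hv l.
  have s : w l * normc (x +i* 1 - l%:C) <= normc (x +i* y - l%:C).
    rewrite /w; case: eqP => [->|/eqP ll]; last exact: factor_lower_bound d0 (hd l lL ll).
    rewrite -nE rn; have := ler_Re_normc (x +i* y - l0%:C).
    by rewrite Re_sub_real.
  have g : 0 <= (normc ('i - l%:C))^-1 by rewrite invr_ge0 normc_ge0.
  have := ler_wpM2r g s; move: (normc _) (normc _) (normc _) => n1 n2 n3.
  by rewrite mulrA.
rewrite -nE -rn; move: (normc (zero_product c L (x +i* 1))) (normc_ge0 (zero_product c L (x +i* 1))) wprod => p p0 wprod.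
have -> : expR (- ((1 + d ^- 2) * (poisson_kernel_weight X 1 * B))) * (r * n) * p =
  r * expR (- ((1 + d ^- 2) * (poisson_kernel_weight X 1 * B))) * p * n by ring.
apply: ler_wpM2r; first exact: ltW.
by apply: le_trans wprod; rewrite ler_wpM2r // (le_trans _ pr) // ler_wpM2l.
Qed.

Lemma separation (S : set R) x : locally_finite S ->
  exists2 d : R, 0 < d & forall l, S l -> l != x -> d <= `|x - l|.
Proof.
move=> lf; pose s := [seq l <- pts S (`|x| + 1) | l != x].
exists (\big[Num.min/1]_(l <- s) `|x - l|).
  have : all (fun l => l != x) s by apply/allP => l; rewrite mem_filter => /andP[].
  elim: s => [|l s IH]; first by rewrite big_nil.
  by rewrite big_cons lt_min normr_gt0 subr_eq0 eq_sym /= => /andP[-> /IH].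
move=> l Sl lx; have [l1|l1] := leP 1 `|x - l|.
  apply: le_trans l1; elim: (s) => [|k t IH]; first by rewrite big_nil.
  by rewrite big_cons ge_min IH orbT.
have : l \in s.
  rewrite mem_filter lx; apply/mem_pts => //; split=> //.
  have -> : l = x - (x - l) by rewrite subKr.
  by apply: le_trans (ler_normB _ _) _; rewrite lerD2l ltW.
elim: s => [|k s IH] //; rewrite inE big_cons ge_min => /orP[/eqP ->|/IH ->]; first by rewrite lexx.
by rewrite orbT.
Qed.

Variables (S : set R) (c : nat -> R) (q : expsum).
Hypothesis lf : locally_finite S.
Hypothesis hden : exists2 B : R, 0 <= B & forall N : nat, \sum_(l <- pts S N%:R) (1 + l ^+ 2)^-1 <= B.
Hypothesis hconv : forall X h Y e : R, 0 < h -> h <= 1 -> 1 <= Y -> 0 < e ->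
  exists N0, forall N, (N0 <= N)%N -> forall z : C, `|Re z| <= X -> h <= Im z -> Im z <= Y ->
  normc (zero_product (c N) (pts S N%:R) z - evl q z) <= e.
Hypothesis hq : forall z : C, 0 < Im z -> evl q z != 0.

Lemma vertical_approach x : exists2 K : R, 0 <= K & forall y, 0 < y -> y <= 1 ->
  normc (evl q (x +i* y) - evl q x%:C) <= K * y.
Proof.
have [K K0 hK] := evl_lipschitz q x%:C; exists K => // y y0 y1.
have -> : x +i* y = x%:C + 0 +i* y by apply: complex_ext => /=; ring.
have n : normc (0 +i* y) = y by rewrite normc_i gtr0_norm.
by have := hK (0 +i* y); rewrite n => /(_ y1).
Qed.

Lemma evl_vanishes l : S l -> evl q l%:C = 0.
Proof.
move=> Sl; apply/eqP; rewrite -normc_eq0 eq_le normc_ge0 andbT.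
have [K K0 hK] := vertical_approach l.
have [A AE] : exists A, A = normc (evl q (l +i* 1)) by eexists.
have A0 : 0 <= A by rewrite AE normc_ge0.
apply: le_of_forall_pos => e e0; rewrite add0r.
have D0 : 0 < K + A + 2 by lra.
have [y yE] : exists y, y = Num.min 1 (e / (K + A + 2)) by eexists.
have y0 : 0 < y by rewrite yE lt_min ltr01 divr_gt0.
have y1 : y <= 1 by rewrite yE ge_min lexx.
have ye : y * (K + A + 2) <= e by rewrite -ler_pdivlMr // yE ge_min lexx orbT.
have [N1 hN1] := hconv `|l| y0 y1 (lexx 1) y0.
have [N2 hN2] := ex_nat_ge `|l|.
pose N := maxn N1 N2.
have lN : l \in pts S N%:R by apply/mem_pts => //; split=> //; exact: hN2 (leq_maxr _ _).
have b1 := hN1 N (leq_maxl _ _) (l +i* y) (lexx _) (lexx _) y1.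
have b2 := hN1 N (leq_maxl _ _) (l +i* 1) (lexx _) y1 (lexx _).
have b3 := @zero_product_small (c N) _ l y lN (introT andP (conj (ltW y0) y1)).
have b4 := hK y y0 y1.
move: b1 b2 b3 b4; rewrite -/(evl q _); set P1 := zero_product _ _ _; set P2 := zero_product _ _ _ => b1 b2 b3 b4.
have c2 : normc P2 <= A + y.
  have -> : P2 = evl q (l +i* 1) + (P2 - evl q (l +i* 1)) by rewrite addrC subrK.
  by apply: le_trans (normcD _ _) _; rewrite AE lerD.
have c3 : normc P1 <= y * (A + y) by apply: le_trans b3 _; rewrite ler_wpM2l // ltW.
have -> : evl q l%:C = P1 - (P1 - evl q (l +i* y)) - (evl q (l +i* y) - evl q l%:C) by ring.
apply: le_trans (normcB _ _) _; apply: le_trans (lerD (normcB _ _) (lexx _)) _.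
have c4 : y * y <= y by rewrite ler_piMr // ltW.
lra.
Qed.

(** The bound for the products is independent of y and survives the limit of the products, then
  y to 0.  For x outside S, taking for l0 any point other than x makes the left-hand side positive;
  for x near a point l0 of S it shows that the zero at l0 is simple. *)
Lemma evl_lower_bound X d : 0 < d -> exists2 k : R, 0 < k & forall x l0, `|x| <= X ->
  (forall l, S l -> l != l0 -> d <= `|x - l|) ->
  k * `|x - l0| * normc (evl q (x +i* 1)) <= normc (evl q x%:C) * normc (x +i* 1 - l0%:C).
Proof.
move=> d0; have [B B0 hB] := hden.
exists (expR (- ((1 + d ^- 2) * (poisson_kernel_weight X 1 * B)))); first exact: expR_gt0.
move: (fun x l0 => @zero_product_lower_bound) => _.
move=> x l0 xX hd.
have lb := fun N y => @zero_product_lower_bound (c N) (pts S N%:R) x y l0 d B X (uniq_pts _ _) d0 xX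
  (fun l lN => hd l ((mem_pts _ _ lf).1 lN).1) (hB N).
move: lb; move: (expR _) (expR_ge0 (- ((1 + d ^- 2) * (poisson_kernel_weight X 1 * B)))) => k k0 lb.
have [K K0 hK] := vertical_approach x.
have [n nE] : exists n, n = normc (x +i* 1 - l0%:C) by eexists.
have n0 : 0 <= n by rewrite nE normc_ge0.
rewrite -nE; apply: le_of_forall_pos => e e0.
have [j jE] : exists j, j = k * `|x - l0| by eexists.
have j0 : 0 <= j by rewrite jE mulr_ge0.
have D0 : 0 < j + (K + 1) * n + 1 by rewrite ltr_wpDl // addr_ge0 // mulr_ge0 // addr_ge0.
have [y yE] : exists y, y = Num.min 1 (e / (j + (K + 1) * n + 1)) by eexists.
have y0 : 0 < y by rewrite yE lt_min ltr01 divr_gt0.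
have y1 : y <= 1 by rewrite yE ge_min lexx.
have ye : y * (j + (K + 1) * n + 1) <= e by rewrite -ler_pdivlMr // yE ge_min lexx orbT.
have [N hN] := hconv `|x| y0 y1 (lexx 1) y0.
have b1 := hN N (leqnn _) (x +i* y) (lexx _) (lexx _) y1.
have b2 := hN N (leqnn _) (x +i* 1) (lexx _) y1 (lexx _).
have b3 := lb N y; have b4 := hK y y0 y1; rewrite -nE -jE in b3 *.
move: b1 b2 b3 b4; set P1 := zero_product _ _ _; set P2 := zero_product _ _ _ => b1 b2 b3 b4.
have c1 : normc P1 <= normc (evl q x%:C) + (K + 1) * y.
  have -> : P1 = evl q x%:C + ((evl q (x +i* y) - evl q x%:C) + (P1 - evl q (x +i* y))) by ring.
  apply: le_trans (normcD _ _) _; rewrite lerD2l; apply: le_trans (normcD _ _) _; move: b1 b4; clear -lf hden hconv hq; lra.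
have c2 : normc (evl q (x +i* 1)) <= normc P2 + y.
  have -> : evl q (x +i* 1) = P2 - (P2 - evl q (x +i* 1)) by ring.
  by apply: le_trans (normcB _ _) _; rewrite lerD2l.
have d1 := ler_wpM2l j0 c2; have d2 := ler_wpM2r n0 c1.
move: b3 d1 d2 ye y0; clear -lf hden hconv hq; lra.
Qed.

Lemma evl_neq0_off x : ~ S x -> evl q x%:C != 0.
Proof.
move=> Sx; have [d d0 hd] := separation x lf.
have [k k0 hk] := evl_lower_bound `|x| d0.
have := hk x (x + 1) (lexx _) => /(_ _)/wrap[].
  by move=> l Sl _; apply: hd => //; apply/eqP => h; apply: Sx; rewrite -h.
have -> : `|x - (x + 1)| = 1 by rewrite opprD addNKr normrN normr1.
rewrite mulr1 => h; apply/eqP => h0; move: h; rewrite h0 normc0 mul0r.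
by rewrite leNgt mulr_gt0 // normc_gt0 hq.
Qed.

(** Otherwise evl q would be quadratically small near l, against the linear lower bound. *)
Lemma evl_simple l : S l -> evl (ders q) l%:C != 0.
Proof.
move=> Sl; apply/eqP => d0; have p0 := evl_vanishes Sl.
have [d dpos hd] := separation l lf.
have d2 : 0 < d / 2 by rewrite divr_gt0.
have [k k0 hk] := evl_lower_bound (`|l| + 1) d2.
have [K K0 hK] := evl_taylor q l%:C.
have [K' K'0 hK'] := evl_lipschitz q (l +i* 1).
have A0 : 0 < normc (evl q (l +i* 1)) by rewrite normc_gt0 hq.
move: A0; have [A AE] : exists A, A = normc (evl q (l +i* 1)) by eexists.
rewrite -AE => A0.
suff : k * A <= 0 by rewrite leNgt mulr_gt0.
apply: le_of_forall_pos => e e0; rewrite add0r.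
have D0 : 0 < 2 * K + k * K' + 1 by rewrite ltr_wpDl // addr_ge0 // mulr_ge0 // ltW.
(* At distance h <= d/2 from l the other points of S are still at distance d/2. *)
have [h hE] : exists h, h = Num.min (Num.min 1 (d / 2)) (e / (2 * K + k * K' + 1)) by eexists.
have h0 : 0 < h by rewrite hE !lt_min ltr01 d2 divr_gt0.
have h1 : h <= 1 by rewrite hE !ge_min lexx.
have hd2 : h <= d / 2 by rewrite hE !ge_min lexx orbT.
have he : h * (2 * K + k * K' + 1) <= e by rewrite -ler_pdivlMr // hE ge_min lexx orbT.
have nh : normc h%:C = h by rewrite normcR gtr0_norm.
have b1 : normc (evl q (l + h)%:C) <= K * h ^+ 2.
  by have := hK h%:C; rewrite nh d0 p0 mulr0 !subr0 complexRD; apply.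
have b2 : A <= normc (evl q ((l + h) +i* 1)) + K' * h.
  have := hK' h%:C; rewrite nh => /(_ h1).
  have -> : l +i* 1 + h%:C = (l + h) +i* 1 by apply: complex_ext => /=; ring.
  move=> b; rewrite AE.
  have -> : evl q (l +i* 1) = evl q ((l + h) +i* 1) - (evl q ((l + h) +i* 1) - evl q (l +i* 1)) by ring.
  by apply: le_trans (normcB _ _) _; rewrite lerD2l.
have := hk (l + h) l => /(_ _ _)/wrap[].
- by apply: le_trans (ler_normD _ _) _; rewrite lerD2l gtr0_norm.
- move=> l' Sl' ll'; have := hd l' Sl' ll' => dl.
  have : `|l - l'| <= `|l + h - l'| + h.
    have -> : l - l' = (l + h - l') - h by ring.
    by apply: le_trans (ler_normB _ _) _; rewrite (gtr0_norm h0).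
  lra.
rewrite [l + h]addrC addrK gtr0_norm // [h + l]addrC.
have nn : normc ((l + h) +i* 1 - l%:C) <= 2.
  apply: le_trans (normc_le_ReIm _) _; rewrite Re_sub_real Im_sub_real /= normr1 [l + h]addrC addrK gtr0_norm //; lra.
have nn0 := normc_ge0 ((l + h) +i* 1 - l%:C).
move=> b3; have b4 : k * h * normc (evl q ((l + h) +i* 1)) <= K * h ^+ 2 * 2.
  by apply: le_trans b3 _; apply: ler_pM => //; exact: normc_ge0.
rewrite -(ler_pM2l h0).
have b5 : k * h * A <= k * h * (normc (evl q ((l + h) +i* 1)) + K' * h).
  by rewrite ler_wpM2l // mulr_ge0 // ltW.
have b6 := ler_wpM2l (ltW h0) he.
have b7 : 0 <= h * h by rewrite mulr_ge0 // ltW.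
rewrite expr2 in b4; move: b4 b5 b6 b7; clear -lf hden hconv hq; lra.
Qed.

End real_zeros.

(** * Assembly *)

Section complex_derivative.
Variable R : realType.
Local Notation C := R[i].

Lemma normr_normc (z : C) : `|z| = (normc z)%:C.
Proof. by []. Qed.

(** In R[i] the order makes every positive epsilon a real number. *)
Lemma taylor_cvg (f : C -> C) (z d : C) (K : R) : 0 <= K ->
  (forall h, normc h <= 1 -> normc (f (z + h) - f z - h * d) <= K * normc h ^+ 2) ->
  (fun h : C^o => h^-1 *: (f (h + z) - f z : C^o)) @ 0^' --> (d : C^o).
Proof.
move=> K0 hf; apply/cvgrPdist_le => e e0.
have [r r0 er] : exists2 r : R, 0 < r & e = r%:C.
  move: e0; case: e => a b; rewrite ltcE /= => /andP[/eqP -> a0].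
  by exists a.
have d0 : 0 < (Num.min 1 (r / (K + 1)))%:C :> C.
  by rewrite ltcR lt_min ltr01 divr_gt0 // ltr_wpDl.
near=> h.
have h0 : h != 0 by near: h; exact: nbhs_dnbhs_neq.
have hd : `|h| < (Num.min 1 (r / (K + 1)))%:C.
  by near: h; exact: dnbhs0_lt d0.
rewrite normr_normc ltcR lt_min in hd; case/andP: hd => h1 hr.
rewrite er normr_normc lecR.
have nh : 0 < normc h by rewrite normc_gt0.
have -> : (d : C) - h^-1 *: (f (h + z) - f z : C^o) = - (h^-1 * (f (z + h) - f z - h * d)).
  rewrite -[h^-1 *: _]/(h^-1 * (f (h + z) - f z) : C) [h + z]addrC; move: (f (z + h)) (f z) => u v.
  have -> : (h : C)^-1 * (u - v - h * d) = h^-1 * (u - v) - (h^-1 * h) * d by ring.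
  by rewrite mulVf // mul1r opprB.
rewrite normc_opp normcM normcV mulrC ler_pdivrMr //.
apply: le_trans (hf h (ltW h1)) _; rewrite expr2 mulrA ler_wpM2r ?(ltW nh) //.
move: hr; rewrite ltr_pdivlMr ?ltr_wpDl // => hr; have := ltW nh; lra.
Unshelve. all: by end_near. Qed.

Lemma taylor_derivable (f : C -> C) (z d : C) (K : R) : 0 <= K ->
  (forall h, normc h <= 1 -> normc (f (z + h) - f z - h * d) <= K * normc h ^+ 2) ->
  derivable (f : C^o -> C^o) z 1 /\ derive1 (f : C^o -> C^o) z = d.
Proof.
move=> K0 hf; have cv := taylor_cvg K0 hf; split; last exact: cvg_lim cv.
rewrite /derivable; have -> : (fun h : C^o => h^-1 *: ((f \o shift z) (h *: (1 : C^o)) - f z : C^o)) =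
   (fun h : C^o => h^-1 *: (f (h + z) - f z : C^o)).
  by apply/funext => h; rewrite /= /GRing.scale /= mulr1.
by apply/cvg_ex; exists d.
Qed.

End complex_derivative.

Section assembly.
Variable R : realType.
Local Notation C := R[i].
Local Notation Re := (@complex.Re R).
Local Notation Im := (@complex.Im R).
Local Notation expsum := (seq (C * R)).

Lemma exp_poly_evl (q : expsum) z :
  exp_poly (fun k : 'I_(size q) => (nth (0, 0) q k).1) (fun k => 2 * pi * (nth (0, 0) q k).2) z = evl q z.
Proof.
rewrite /exp_poly /evl (big_nth (0, 0)) big_mkord; apply: eq_bigr => k _.
move: (nth _ _ _) => p; rewrite /exp_freq.
have -> : (0 +i* 1) * (2 * pi * p.2)%:C = 0 +i* (2 * pi * p.2) :> C; last by [].
by rewrite -[RHS]mulr1; apply: complex_ext; rewrite /= !(mulr0, mul0r, mulr1, mul1r, subr0, add0r).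
Qed.

Lemma psi_limitE (sigma : R) (H : C -> C) z :
  psi_limit sigma H z = cexp (- sigma%:C - H 'i) * (exp_freq (- (sigma / (2 * pi))) z * cexp (H z)).
Proof.
rewrite /psi_limit /exp_freq -!cexpD; congr cexp.
have -> : 0 +i* (2 * pi * - (sigma / (2 * pi))) = - ('i * sigma%:C) :> C.
  have p0 : 2 * pi != 0 :> R by rewrite gt_eqF // mulr_gt0 // pi_gt0.
  have sp : 2 * pi * - (sigma / (2 * pi)) = - sigma by rewrite mulrN mulrC divfK.
  by rewrite sp; apply: complex_ext => /=; ring.
ring.
Qed.

Lemma fourier_quasicrystal_exp_sum (S : set R) : fourier_quasicrystal (unit_masses S) ->
  exists q : expsum, [/\ forall z, Im z != 0 -> evl q z != 0,
    forall l, S l -> evl q l%:C = 0 /\ evl (ders q) l%:C != 0 &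
    forall x, ~ S x -> evl q x%:C != 0].
Proof.
move=> [a [[lfS lfa [T [TT TS Ta]]] _ [lfv [Tv TTv Tva]]]].
have va : atoms (variation_measure a) = atoms a.
  by apply/seteqP; split => x; rewrite /atoms /variation_measure /= normr_eq0.
have [K [M [K0 gr]]] := tempered_growth TT TS lfS
  ltac:(by move=> x; rewrite /unit_masses normc_real_ge0 // /indic ler0n).
have [Ka [Ma [Ka0 gra]]] := tempered_growth TTv Tva lfv
  ltac:(by move=> x; rewrite /variation_measure normr_normc normc_real_ge0 // normc_ge0).
rewrite atoms_unit_masses in lfS gr; rewrite va in gra.
have {}gr N : \sum_(x <- pts S N%:R) 1 <= K * N.+1%:R ^+ M :> R.
  apply: le_trans (gr N); rewrite big_seq [leRHS]big_seq; apply: ler_sum => x /(mem_pts _ _ lfS)[Sx _].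
  by rewrite unit_masses_in // normc1.
have {}gra N : \sum_(x <- pts (atoms a) N%:R) normc (a x) <= Ka * N.+1%:R ^+ Ma.
  apply: le_trans (gra N); apply: ler_sum => x _.
  by rewrite /variation_measure normr_normc normc_real_ge0 // normc_ge0.
have hden := sum_inverse_square_bounded lfS lfa TT TS Ta K0 gr.
have hexp := sum_exponential_bounded lfa Ka0 gra.
have hres := summation_resolvent lfS lfa TT TS Ta K0 gr Ka0 gra.
have [c [sigma hlog]] := log_derivative_converges lfS lfa hden hexp hres.
have [H [Q Q0 hH]] := log_series_limit lfa hexp.
have hpsi := psi_converges lfa hexp hlog Q0 hH.
have [K1 htr] := exp_series_truncation lfa hexp Q0 hH.
have [Wl hWl] := exp_weight_limit lfa hexp.
have [k kE] : exists k, k = cexp (- sigma%:C - H 'i) by eexists.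
have [s sE] : exists s, s = sigma / (2 * pi) by eexists.
have FE z : psi_limit sigma H z = k * (exp_freq (- s) z * cexp (H z)) by rewrite psi_limitE kE sE.
have nF z : normc (psi_limit sigma H z) = normc k * (expR (2 * pi * s * Im z) * expR (Re (H z))).
  rewrite FE (normcM k) (normcM (exp_freq _ _)) normc_exp_freq normc_cexp.
  by congr (_ * (expR _ * _)); ring.
have s0 : 0 < `|s| + 1 by rewrite ltr_wpDl.
have K00 : 0 <= normc k * expR (Q * Wl 1) by apply: mulr_ge0; [exact: normc_ge0|exact: expR_ge0].
have hgrow z : 1 <= Im z -> normc (psi_limit sigma H z) <= (normc k * expR (Q * Wl 1)) * expR (2 * pi * (`|s| + 1) * Im z).
  move=> z1; rewrite nF -[leRHS]mulrA; apply: ler_wpM2l; first exact: normc_ge0.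
  rewrite mulrC; apply: ler_pM; rewrite ?expR_ge0 // ler_expR.
    by have [_ h] := hH 1 ltr01 _ (hWl 1 ltr01) z 0%N z1; apply: le_trans (Re_le_normc _) h.
  rewrite ler_wpM2r ?(le_trans ler01 z1) // ler_wpM2l ?mulr_ge0 ?pi_ge0 //.
  by apply: le_trans (ler_norm _) _; rewrite lerDl.
have htrunc r : `|s| + 1 < r -> exists2 P : expsum, (forall p, p \in P -> p.2 < r) &
    forall h, 0 < h -> forall z, h <= Im z ->
    normc (psi_limit sigma H z - evl P z) <= (normc k * K1 h * expR (2 * pi * s * h)) * expR (- (2 * pi * r) * (Im z - h)).
  move=> sr; have rs : 0 < r + s by have := ler_norm (- s); rewrite normrN; lra.
  have [P hP hPz] := htr _ rs.
  exists (scales k (shifts (- s) P)) => [p /mapP[p' /mapP[p'' /hP h ->] ->] /=|h h0 z hz]; first by lra.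
  rewrite evl_scales evl_shifts FE -mulrBr [exp_freq _ _ * _]mulrC -mulrBl.
  rewrite (normcM k) (normcM (_ - _)) normc_exp_freq -(mulrA (normc k * K1 h)) -(mulrA (normc k)); apply: ler_wpM2l; first exact: normc_ge0.
  have b := ler_wpM2r (expR_ge0 (- (2 * pi * Im z) * - s)) (hPz h h0 z hz).
  apply: le_trans b _; rewrite -(mulrA (K1 h)) -!expRD le_eqVlt; apply/orP; left; apply/eqP.
  congr (_ * expR _); ring.
have [q qE] := limit_exp_sum hpsi s0 K00 hgrow htrunc.
have hconv X h Y e : 0 < h -> h <= 1 -> 1 <= Y -> 0 < e ->
    exists N0, forall N, (N0 <= N)%N -> forall z : C, `|Re z| <= X -> h <= Im z -> Im z <= Y ->
    normc (zero_product (c N) (pts S N%:R) z - evl q z) <= e.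
  move=> h0 h1 Y1 e0; have [N0 hN] := hpsi X h Y e h0 h1 Y1 e0; exists N0 => N NN z zX zh zY.
  by rewrite -qE ?(lt_le_trans h0) //; exact: hN.
have hq z : 0 < Im z -> evl q z != 0.
  by move=> z0; rewrite -qE // cexp_neq0.
exists q; split.
- move=> z; case: ltgtP => // z0 _; last exact: hq.
  exact: (evl_neq0_lower hconv hq).
- move=> l Sl; split; first exact: (evl_vanishes lfS hconv).
  exact: (evl_simple lfS hden hconv hq).
- exact: (evl_neq0_off lfS hden hconv hq).
Qed.

End assembly.

Unset Implicit Arguments.
Theorem theorem1 (R : realType) (Lambda : set R)
    (hLambda : fourier_quasicrystal (unit_masses Lambda)) :
  exists (n : nat) (b : 'I_n -> R[i]) (gamma : 'I_n -> R),
    (forall z : R[i], exp_poly b gamma z = 0 ->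
       complex.Im z = 0 /\ simple_zero (exp_poly b gamma) z) /\
    [set z : R[i] | exp_poly b gamma z = 0] = [set x%:C | x in Lambda].
Proof.
have [q [offR zeros nonzeros]] := fourier_quasicrystal_exp_sum hLambda.
exists (size q), (fun k => (nth (0, 0) q k).1), (fun k => 2 * pi * (nth (0, 0) q k).2).
set p := exp_poly _ _; have pE : p = evl q by apply/funext => z; exact: exp_poly_evl.
have real z : p z = 0 -> exists2 x, Lambda x & z = x%:C.
  rewrite pE => z0; have zi : complex.Im z = 0.
    by apply/eqP/negPn/negP => /offR; rewrite z0 eqxx.
  have zE : z = (complex.Re z)%:C by apply: complex_ext.
  exists (complex.Re z) => //; apply: contrapT => /nonzeros.
  by rewrite -zE z0 eqxx.
split=> [z z0|].
  have [x Lx zx] := real z z0; rewrite zx; have [p0 d0] := zeros x Lx.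
  split=> //; have [K K0 hK] := evl_taylor q x%:C.
  have [der derE] := taylor_derivable K0 hK.
  by split; rewrite ?pE // derE.
apply/seteqP; split => [z /= /real[x Lx ->]|z /= [x Lx <-]]; first by exists x.
by rewrite pE; have [] := zeros x Lx.
Qed.
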